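(* Let $(L\rightrightarrows L_M;G\rightrightarrows M)$ be a line bundle groupoid. The assignment $\theta\mapsto\omega\rightleftharpoons(\theta,0)$ (i.e. $\omega=d_D\sigma^*\theta$) establishes a bijection between $0$-shifted contact structures on $L$ and $0$-shifted symplectic Atiyah forms on $L$.
   Context: A line bundle groupoid (LBG) $(L\rightrightarrows L_M;G\rightrightarrows M)$ consists of (Hausdorff) Lie groupoids $L\rightrightarrows L_M$, $G\rightrightarrows M$ and line bundles $L\to G$, $L_M\to M$ such that all structure maps of $L$ are vector bundle morphisms covering those of $G$ (structure maps of both denoted $s,t,m,i,u$). All structure maps are then isomorphisms on fibers, and $G$ acts on $L_M$ by $g.v=t(s_g^{-1}(v))$, $s_g=s|_{L_g}$. Let $A=\ker(ds)|_M$ be the Lie algebroid of $G$ and $\rho=dt|_A\colon A\to TM$ its anchor. For a line bundle $L_M\to M$, $DL_M\to M$ is the Atiyah algebroid: $D_xL_M$ consists of $\mathbb R$-linear $\delta\colon\Gamma(L_M)\to L_{M,x}$ with $\delta(f\lambda)=v(f)\lambda_x+f(x)\delta(\lambda)$ for a unique $v=\sigma(\delta)\in T_xM$ (the symbol). Atiyah forms are $\Omega_D^\bullet(L_M)=\Gamma(\operatorname{Alt}^\bullet(DL_M,L_M))$, with Lie algebroid differential $d_D$ for the tautological action of $DL_M$ on $L_M$; $(\sigma^*\tau)(\delta_1,\dots)=\tau(\sigma\delta_1,\dots)$. Every $\omega\in\Omega^k_D(L_M)$ is uniquely $\sigma^*\omega_1+d_D\sigma^*\omega_0$ with $\omega_0\in\Omega^{k-1}(M,L_M)$,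 $\omega_1\in\Omega^k(M,L_M)$, written $\omega\rightleftharpoons(\omega_0,\omega_1)$. A VB morphism $F$ of line bundles over $f$ which is an isomorphism on fibers induces $DF(\delta)\lambda=F(\delta(F^*\lambda))$, with $(F^*\lambda)_x=F_x^{-1}\lambda_{f(x)}$, and pull-backs of Atiyah forms (using $DF$) and line bundle valued forms (using $df$), composed with $F_x^{-1}$ on values. On Atiyah forms on $L_M$ and on $L_M$-valued forms on $M$ put $\partial=s^*-t^*$. Write $E^\dagger=\operatorname{Hom}(E,L_M)$ for vector bundles $E\to M$, and $\phi^\dagger$ for the transpose $\psi\mapsto\psi\circ\phi$ (with $L_M^\dagger=\mathbb R_M=M\times\mathbb R$); $J^1L_M=(DL_M)^\dagger$, $T^\dagger M=(TM)^\dagger$. Let $\mathcal D\colon A\to DL_M$ be the infinitesimal action: $\mathcal D_a\lambda=\frac{d}{d\varepsilon}|_{0}\,g(\varepsilon)^{-1}.\lambda_{t(g(\varepsilon))}$ for $a=\frac{d}{d\varepsilon}|_0g(\varepsilon)$, $g(\varepsilon)$ a curve in $s^{-1}(x)$ with $g(0)=x$. A $0$-shifted symplectic Atiyah form on $L$ is $\omega\in\Omega_D^2(L_M)$ with $\partial\omega=0$, $d_D\omega=0$ and such that, for all $x\in M$, the cochain map from $0\to A_x\xrightarrow{\mathcal D}D_xL_M\to0\to0$ to $0\to0\to J^1_xL_M\xrightarrow{\mathcal D^\dagger}A_x^\dagger\to0$ given by $\omega\colon D_xL_M\to J^1_xL_M$, $\delta\mapsto\omega(\delta,-)$ (and $0$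 elsewhere) is a quasi-isomorphism; i.e. $\mathcal D$ is injective and $\operatorname{im}\mathcal D=\ker\omega$. Let $\nabla$ be a connection on $L_M$, $f_\nabla\colon DL_M\to\mathbb R_M$, $f_\nabla(\delta)=\delta-\nabla_{\sigma(\delta)}\in\operatorname{End}L_M=\mathbb R_M$, and $F_\nabla=f_\nabla\circ\mathcal D\colon A\to\mathbb R_M$. If $\theta\in\Omega^1(M,L_M)$ satisfies $\partial\theta=0$, its Morita curvature at $x\in M$ is the cochain map from $0\to A_x\xrightarrow{\rho}T_xM\xrightarrow{\theta}L_{M,x}\to0$ to $0\to\mathbb R\xrightarrow{\theta^\dagger}T^\dagger_xM\xrightarrow{\rho^\dagger}A_x^\dagger\to0$ with components $-F_\nabla$, $d^\nabla\theta$ (as $v\mapsto d^\nabla\theta(v,-)$), $F_\nabla^\dagger$; its homotopy class does not depend on $\nabla$. A $0$-shifted contact structure on $L$ is $\theta\in\Omega^1(M,L_M)$ with $\partial\theta=0$ whose Morita curvature at $x$ is a quasi-isomorphism for all $x\in M$. *)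

(* Defs.v *)
From HB Require Import structures.
From mathcomp Require Import all_boot all_order all_algebra.
From mathcomp Require Import all_classical all_reals all_analysis.
From mathcomp Require Import ring.

Set Implicit Arguments.
Unset Strict Implicit.
Unset Printing Implicit Defensive.

Import Order.TTheory GRing.Theory Num.Theory.
Import numFieldNormedType.Exports.

Local Open Scope classical_set_scope.
Local Open Scope ring_scope.

Section Smooth.
Variable R : realType.

(* k.+1 times differentiable on U; a function is C^oo on an open set exactly
   when all its iterated directional derivatives are differentiable there. *)
Fixpoint diff_iter n (k : nat) (U : set 'rV[R]_n) (f : 'rV[R]_n -> R) : Prop :=
  (forall x, U x -> differentiable f x) /\
  (if k is k'.+1 then forall v, diff_iter k' U ('D_v f) else True).

Definition Csmooth n (U : set 'rV[R]_n) (f : 'rV[R]_n -> R) : Prop :=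
  forall k, diff_iter k U f.

Lemma diff_iterE n k (U : set 'rV[R]_n) f : diff_iter k U f =
  ((forall x, U x -> differentiable f x) /\
  (if k is k'.+1 then forall v, diff_iter k' U ('D_v f) else True)).
Proof. by case: k. Qed.

Lemma diff_iter1 n k (U : set 'rV[R]_n) f :
  diff_iter k U f -> forall x, U x -> differentiable f x.
Proof. by rewrite diff_iterE => -[]. Qed.

Lemma diff_iterS n k (U : set 'rV[R]_n) f : diff_iter k.+1 U f -> diff_iter k U f.
Proof.
elim: k f => [|k IH] f; first by move=> [].
by move=> [h1 h2]; split => // v; apply: IH.
Qed.

Lemma diff_iter_subset n k (U V : set 'rV[R]_n) f :
  U `<=` V -> diff_iter k V f -> diff_iter k U f.
Proof.
move=> UV; elim: k f => [|k IH] f [h1 h2]; split => //; try by move=> x /UV /h1.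
by move=> v; exact: (IH _ (h2 v)).
Qed.

Lemma diff_iter_local n k (U : set 'rV[R]_n) f :
  (forall x, U x -> exists2 V, V x & diff_iter k V f) -> diff_iter k U f.
Proof.
elim: k f => [|k IH] f H; split => //.
- by move=> x /H [V Vx] [/(_ x Vx)].
- by move=> x /H [V Vx] [/(_ x Vx)].
- by move=> v; apply: IH => x /H [V Vx] [_ /(_ v) h]; exists V.
Qed.

Lemma near_eq_differentiable n (f g : 'rV[R]_n -> R) x :
  {near x, f =1 g} -> differentiable f x -> differentiable g x.
Proof.
move=> fg df.
have fgx : f x = g x by exact: (nbhs_singleton fg).
have /eqaddoP h := diff_locally df.
have H : g \o shift x = cst (g x) + 'd f x +o_ 0 id.
  apply/eqaddoP => e e0; have := h e e0.
  have : \forall y \near (0 : 'rV[R]_n), f (y + x) = g (y + x).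
    have : \forall y \near x, f y = g y by [].
    by rewrite (near_shift 0 x); apply: filterS => y /=; rewrite subr0.
  apply: filterS2 => y /= fgy; congr (_ <= _); congr (`| _ |).
  by rewrite /= /cst fgx; congr (_ - _).
apply/diff_locallyP; rewrite (diff_unique (diff_continuous df) H); split => //.
exact: diff_continuous.
Qed.

Lemma open_near_eq n (U : set 'rV[R]_n) (f g : 'rV[R]_n -> R) x :
  open U -> {in U, f =1 g} -> U x -> {near x, f =1 g}.
Proof.
move=> oU fg Ux; have : nbhs x U by exact: open_nbhs_nbhs.
by apply: filterS => y Uy; apply: fg; rewrite inE.
Qed.

Lemma diff_iter_ext n k (U : set 'rV[R]_n) f g : open U ->
  {in U, f =1 g} -> diff_iter k U f -> diff_iter k U g.
Proof.
move=> oU; elim: k f g => [|k IH] f g fg [h1 h2]; split => //.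
- by move=> x Ux; apply: near_eq_differentiable (h1 x Ux); exact: open_near_eq fg Ux.
- by move=> x Ux; apply: near_eq_differentiable (h1 x Ux); exact: open_near_eq fg Ux.
move=> v; apply: (IH _ _ _ (h2 v)) => x; rewrite inE => Ux.
by apply: near_eq_derive; exact: open_near_eq fg Ux.
Qed.

Lemma diff_iter_cst n k (U : set 'rV[R]_n) (a : R) : diff_iter k U (cst a).
Proof.
elim: k a => [|k IH] a; split => // v.
rewrite (_ : 'D_v _ = cst 0) //; by apply/funext => x; rewrite derive_cst.
Qed.

Lemma diff_iterD n k (U : set 'rV[R]_n) f g : open U ->
  diff_iter k U f -> diff_iter k U g -> diff_iter k U (fun x => f x + g x).
Proof.
move=> oU; elim: k f g => [|k IH] f g [h1 h2] [h3 h4]; split => //.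
- by move=> x Ux; apply: differentiableD; [exact: h1|exact: h3].
- by move=> x Ux; apply: differentiableD; [exact: h1|exact: h3].
move=> v; apply: (@diff_iter_ext _ _ _ (fun x => 'D_v f x + 'D_v g x)) => //.
  move=> x; rewrite inE => Ux; rewrite [RHS]deriveD //.
    by apply: diff_derivable; exact: h1.
  by apply: diff_derivable; exact: h3.
exact: (IH _ _ (h2 v) (h4 v)).
Qed.

Lemma diff_iterM n k (U : set 'rV[R]_n) f g : open U ->
  diff_iter k U f -> diff_iter k U g -> diff_iter k U (fun x => f x * g x).
Proof.
move=> oU; elim: k f g => [|k IH] f g.
  move=> [h1 h2] [h3 h4]; split => //.
  by move=> x Ux; apply: differentiableM; [exact: h1|exact: h3].
move=> Hf Hg; have [h1 h2] := Hf; have [h3 h4] := Hg; split => //.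
  by move=> x Ux; apply: differentiableM; [exact: h1|exact: h3].
move=> v; apply: (@diff_iter_ext _ _ _
   (fun x => f x * 'D_v g x + g x * 'D_v f x)) => //.
  move=> x; rewrite inE => Ux; rewrite [RHS]deriveM //.
    by apply: diff_derivable; exact: h1.
  by apply: diff_derivable; exact: h3.
apply: diff_iterD => //; first exact: (IH _ _ (diff_iterS Hf) (h4 v)).
exact: (IH _ _ (diff_iterS Hg) (h2 v)).
Qed.

Lemma diff_iter_sum n k (U : set 'rV[R]_n) m (f : 'I_m -> 'rV[R]_n -> R) : open U ->
  (forall i, diff_iter k U (f i)) -> diff_iter k U (fun x => \sum_i f i x).
Proof.
move=> oU; elim: m f => [|m IH] f hf.
  rewrite (_ : (fun x => _) = cst 0); first exact: diff_iter_cst.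
  by apply/funext => x; rewrite big_ord0.
rewrite (_ : (fun x => _) =
  fun x => (\sum_(i < m) f (widen_ord (leqnSn m) i) x) + f ord_max x); last first.
  by apply/funext => x; rewrite big_ord_recr.
by apply: diff_iterD => //; apply: IH.
Qed.

Lemma diff_iter_coord n k (U : set 'rV[R]_n) j :
  diff_iter k U (fun x : 'rV[R]_n => x 0 j).
Proof.
have D x : differentiable (fun x : 'rV[R]_n => x 0 j) x.
  exact: differentiable_coord.
case: k => [|k]; split => // v.
have -> : 'D_v (fun x : 'rV[R]_n => x 0 j) = cst (v 0 j).
  apply/funext => x; have := derive_mx (@derivable_id R 'rV[R]_n x v).
  by rewrite derive_id => /matrixP/(_ 0 j); rewrite mxE.
exact: diff_iter_cst.
Qed.

Lemma differentiable_rV n m (F : 'rV[R]_n -> 'rV[R]_m) x :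
  (forall j, differentiable (fun y => F y 0 j) x) -> differentiable F x.
Proof.
move=> H; rewrite (_ : F = fun y => \sum_j F y 0 j *: delta_mx 0 j); last first.
  by apply/funext => y; rewrite -row_sum_delta.
rewrite -fct_sumE; apply: differentiable_sum => j.
exact: differentiableZl.
Qed.

Lemma derive_compE n m (F : 'rV[R]_n -> 'rV[R]_m) (f : 'rV[R]_m -> R) x v :
  (forall j, differentiable (fun y => F y 0 j) x) -> differentiable f (F x) ->
  'D_v (f \o F) x =
    \sum_j 'D_v (fun y => F y 0 j) x * 'D_(delta_mx 0 j) f (F x).
Proof.
move=> dF df; have DF := differentiable_rV dF.
rewrite deriveE; last exact: differentiable_comp.
rewrite diff_comp //= -(deriveE v DF) [X in 'd f _ X]row_sum_delta linear_sum.
apply: eq_bigr => j _; rewrite linearZ /= -deriveE // derive_mx ?mxE //.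
exact: diff_derivable.
Qed.

Lemma diff_iter_comp n m k (U : set 'rV[R]_n) (V : set 'rV[R]_m)
    (F : 'rV[R]_n -> 'rV[R]_m) (f : 'rV[R]_m -> R) :
  open U -> open V -> (forall x, U x -> V (F x)) ->
  (forall j, diff_iter k U (fun x => F x 0 j)) -> diff_iter k V f ->
  diff_iter k U (fun x => f (F x)).
Proof.
move=> oU oV UV; elim: k f => [|k IH] f hF hf.
  split => // x Ux; apply: differentiable_comp; last exact: (diff_iter1 hf (UV _ Ux)).
  by apply: differentiable_rV => j; exact: (diff_iter1 (hF j) Ux).
have [h1 h2] := hf; have dF x : U x -> differentiable F x.
  by move=> Ux; apply: differentiable_rV => j; exact: (diff_iter1 (hF j) Ux).
split; first by move=> x Ux; apply: differentiable_comp; [exact: dF|exact/h1/UV].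
move=> v; apply: (@diff_iter_ext _ _ _
  (fun x => \sum_j 'D_v (fun y => F y 0 j) x * 'D_(delta_mx 0 j) f (F x))) => //.
  move=> x; rewrite inE => Ux; rewrite -derive_compE //; last exact/h1/UV.
  by move=> j; exact: (diff_iter1 (hF j) Ux).
apply: diff_iter_sum => // j; apply: diff_iterM => //.
  by have [_ /(_ v)] := hF j.
exact: (IH _ (fun i => diff_iterS (hF i)) (h2 (delta_mx 0 j))).
Qed.

Lemma diff_iterV n k (U : set 'rV[R]_n) f : open U ->
  (forall x, U x -> f x != 0) -> diff_iter k U f ->
  diff_iter k U (fun x => (f x)^-1).
Proof.
move=> oU f0; elim: k => [|k IH] hf.
  by split => // x Ux; apply: differentiableV; [exact: (diff_iter1 hf Ux)|exact: f0].
have [h1 h2] := hf; split.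
  by move=> x Ux; apply: differentiableV; [exact: h1|exact: f0].
move=> v; apply: (@diff_iter_ext _ _ _
  (fun x => -1 * ((f x)^-1 * (f x)^-1 * 'D_v f x))) => //.
  move=> x; rewrite inE => Ux; rewrite [RHS]deriveV ?f0 //.
    by rewrite -exprVn expr2 mulN1r scaleNr.
  by apply: diff_derivable; exact: h1.
have hV := IH (diff_iterS hf).
apply: diff_iterM => //; first exact: diff_iter_cst.
apply: diff_iterM (h2 v) => //; exact: diff_iterM.
Qed.

End Smooth.

Section Manifolds.
Variable R : realType.

Definition Csmooth_map n k (U : set 'rV[R]_n) (F : 'rV[R]_n -> 'rV[R]_k) : Prop :=
  forall j, Csmooth U (fun z => F z 0 j).

(* [cmap] and [cinv] are total functions whose values are irrelevant outside
   [cdom] and [cimg] respectively. *)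
Record chart (T : topologicalType) (n : nat) := Chart {
  cdom : set T;
  cimg : set 'rV[R]_n;
  cmap :> T -> 'rV[R]_n;
  cinv : 'rV[R]_n -> T;
  cdom_open : open cdom;
  cimg_open : open cimg;
  cmap_img : forall p, cdom p -> cimg (cmap p);
  cinv_dom : forall z, cimg z -> cdom (cinv z);
  cmapK : forall p, cdom p -> cinv (cmap p) = p;
  cinvK : forall z, cimg z -> cmap (cinv z) = z;
  cmap_cont : forall p, cdom p -> {for p, continuous cmap};
  cinv_cont : forall z, cimg z -> {for z, continuous cinv} }.

Definition compatible (T : topologicalType) n (c d : chart T n) : Prop :=
  Csmooth_map (cimg c `&` cinv c @^-1` cdom d) (d \o cinv c) /\
  Csmooth_map (cimg d `&` cinv d @^-1` cdom c) (c \o cinv d).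

Record manifold (n : nat) := Manifold {
  mspace :> topologicalType;
  _ : hausdorff_space mspace;
  _ : @second_countable mspace;
  atlas : set (chart mspace n);
  atlas_cover : forall p : mspace, exists2 c, atlas c & cdom c p;
  atlas_compat : forall c d, atlas c -> atlas d -> compatible c d;
  atlas_max : forall c, (forall d, atlas d -> compatible c d) -> atlas c }.

(* smoothness, on an open U of R^k, of a map to a manifold *)
Definition smooth_from k n (N : manifold n) (U : set 'rV[R]_k) (F : 'rV[R]_k -> N)
    : Prop :=
  (forall z, U z -> {for z, continuous F}) /\
  (forall d : chart N n, atlas d -> Csmooth_map (U `&` F @^-1` cdom d) (d \o F)).

Record smap m n (M : manifold m) (N : manifold n) := SMap {
  smap_fun :> M -> N;
  smapP : forall c : chart M m, atlas c -> smooth_from (cimg c) (smap_fun \o cinv c) }.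

Definition smooth_fun_on m (M : manifold m) (W : set M) (f : M -> R) : Prop :=
  forall c : chart M m, atlas c -> Csmooth (cimg c `&` cinv c @^-1` W) (f \o cinv c).

(* A map is a submersion if, near every point, it is a coordinate projection in
   suitable charts. *)
Definition submersion m n (M : manifold m) (N : manifold n) (F : M -> N) : Prop :=
  forall p, exists (c : chart M m) (d : chart N n) (pr : 'I_n -> 'I_m),
    [/\ atlas c, atlas d, cdom c p, injective pr &
        forall q, cdom c q -> cdom d (F q) /\ forall j, d (F q) 0 j = c q 0 (pr j)].

(* Smoothness, on a subset A of the product manifold M x N, of a map to P: near
   each point of A the map is the restriction of a smooth map defined on an open
   set of M x N (smoothness being tested in product charts). *)
Definition smooth2_on m n k (M : manifold m) (N : manifold n) (P : manifold k)
    (A : set (M * N)) (F : M * N -> P) : Prop :=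
  forall pq, A pq -> exists (W : set (M * N)) (F' : M * N -> P),
    [/\ open W, W pq, (forall y, W y -> A y -> F' y = F y) &
      forall (c : chart M m) (d : chart N n), atlas c -> atlas d ->
      let par (z : 'rV[R]_(m + n)) := (cinv c (lsubmx z), cinv d (rsubmx z)) in
      smooth_from [set z | [/\ cimg c (lsubmx z), cimg d (rsubmx z) & W (par z)]]
        (F' \o par)].

Lemma open_cont_pre (S T : topologicalType) (U : set S) (f : S -> T) (W : set T) :
  open U -> (forall z, U z -> {for z, continuous f}) -> open W ->
  open (U `&` f @^-1` W).
Proof.
move=> oU cf oW; rewrite openE => z [Uz Wz] /=.
apply: filterI; first exact: open_nbhs_nbhs.
by apply: cf => //; exact: open_nbhs_nbhs.
Qed.

Lemma open_chart (T : topologicalType) n (c : chart T n) W : open W ->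
  open (cimg c `&` cinv c @^-1` W).
Proof. by apply: open_cont_pre; [exact: cimg_open|exact: cinv_cont]. Qed.

Lemma Csmooth_local n (U : set 'rV[R]_n) f :
  (forall x, U x -> exists2 V, V x & Csmooth V f) -> Csmooth U f.
Proof. by move=> H k; apply: diff_iter_local => x /H [V Vx hV]; exists V. Qed.

Lemma Csmooth_subset n (U V : set 'rV[R]_n) f : U `<=` V -> Csmooth V f -> Csmooth U f.
Proof. by move=> UV h k; exact: diff_iter_subset UV (h k). Qed.

Lemma Csmooth_ext n (U : set 'rV[R]_n) f g : open U ->
  (forall x, U x -> f x = g x) -> Csmooth U f -> Csmooth U g.
Proof.
move=> oU fg h k; apply: diff_iter_ext (h k) => // x; rewrite inE; exact: fg.
Qed.

Lemma Csmooth_comp n m (U : set 'rV[R]_n) (V : set 'rV[R]_m) F f :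
  open U -> open V -> (forall x, U x -> V (F x)) ->
  Csmooth_map U F -> Csmooth V f -> Csmooth U (fun x => f (F x)).
Proof. by move=> oU oV UV hF hf k; apply: diff_iter_comp (hf k) => // j; exact: hF. Qed.

(* a function smooth on the open set W, composed with a map smooth on U *)
Lemma smooth_from_comp k n (N : manifold n) (U : set 'rV[R]_k) (F : 'rV[R]_k -> N)
    (W : set N) (f : N -> R) :
  open U -> open W -> smooth_from U F -> smooth_fun_on W f ->
  Csmooth (U `&` F @^-1` W) (f \o F).
Proof.
move=> oU oW [cF sF] sf; apply: Csmooth_local => z [Uz Wz].
have [d ad dFz] := atlas_cover (F z).
pose V := (U `&` F @^-1` cdom d) `&` (U `&` F @^-1` W).
have oV : open V by apply: openI; apply: open_cont_pre => //; exact: cdom_open.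
exists V => //.
apply: (@Csmooth_ext _ _ (fun x => (f \o cinv d) (d (F x)))) => //.
  by move=> x [[_ dFx] _] /=; rewrite cmapK.
apply: (@Csmooth_comp _ _ _ (cimg d `&` cinv d @^-1` W)) => //.
- exact: open_chart.
- by move=> x [[_ dFx] [_ Wx]]; split; [exact: cmap_img|rewrite /preimage /= cmapK].
- by move=> j; apply: Csmooth_subset (sF d ad j); exact: subIsetl.
- exact: sf.
Qed.

Record Cinf m (M : manifold m) := CInf {
  cinf_fun :> M -> R;
  cinfP : smooth_fun_on [set: M] cinf_fun }.

Section Functions.
Variables (m : nat) (M : manifold m).

Lemma smooth_fun_lin (W : set M) (a : R) (f g : M -> R) : open W ->
  smooth_fun_on W f -> smooth_fun_on W g -> smooth_fun_on W (fun x => a * f x + g x).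
Proof.
move=> oW hf hg c ac k; apply: diff_iterD; [exact: open_chart| |exact: hg].
by apply: diff_iterM; [exact: open_chart|exact: diff_iter_cst|exact: hf].
Qed.

Lemma smooth_fun_mul (W : set M) (f g : M -> R) : open W ->
  smooth_fun_on W f -> smooth_fun_on W g -> smooth_fun_on W (fun x => f x * g x).
Proof.
by move=> oW hf hg c ac k; apply: diff_iterM; [exact: open_chart|exact: hf|exact: hg].
Qed.

Lemma smooth_fun_subset (W V : set M) (f : M -> R) :
  W `<=` V -> smooth_fun_on V f -> smooth_fun_on W f.
Proof.
move=> WV h c ac; apply: Csmooth_subset (h c ac) => z [cz Wz].
by split => //; exact: WV.
Qed.

Definition cinf_lin (a : R) (f g : Cinf M) : Cinf M :=
  CInf (smooth_fun_lin a openT (cinfP f) (cinfP g)).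

Definition cinf_mul (f g : Cinf M) : Cinf M :=
  CInf (smooth_fun_mul openT (cinfP f) (cinfP g)).

Lemma cinf_eq (f g : Cinf M) : f =1 g -> f = g.
Proof.
case: f g => [f hf] [g hg] /= /funext fg; rewrite fg in hf *.
by congr CInf; exact: Prop_irrelevance.
Qed.
End Functions.

Lemma smooth_fun_comp m n (M : manifold m) (N : manifold n) (F : smap M N)
  (W : set N) (f : N -> R) : open W -> smooth_fun_on W f ->
  smooth_fun_on (F @^-1` W) (fun x => f (F x)).
Proof.
move=> oW hf c ac; apply: (@smooth_from_comp _ _ _ _ (F \o cinv c)) => //.
  exact: cimg_open.
exact: smapP.
Qed.

Definition cinf_comp m n (M : manifold m) (N : manifold n) (F : smap M N) (f : Cinf N) :
  Cinf M := CInf (@smooth_fun_comp _ _ _ _ F _ _ openT (cinfP f)).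

Let lin_aux (a b x y z t : R) :
  a * (b * x + y) + (b * z + t) = b * (a * x + z) + (a * y + t).
Proof. by ring. Qed.

Let der_aux (a b c x y z t : R) :
  a * (b * x + c * y) + (b * z + c * t) = b * (a * x + z) + c * (a * y + t).
Proof. by ring. Qed.

Section Tangent.
Variables (m : nat) (M : manifold m).

Definition is_tangent (x : M) (v : Cinf M -> R^o) : Prop :=
  (forall a f g, v (cinf_lin a f g) = a * v f + v g) /\
  (forall f g, v (cinf_mul f g) = f x * v g + g x * v f).

Definition tangent_pred (x : M) : {pred Cinf M -> R^o} := fun v => `[< is_tangent x v >].

Lemma tangent_submod (x : M) : submod_closed (tangent_pred x).
Proof.
split => [|a v w].
  apply/asboolP; split => [a f g|f g] /=; first by rewrite /GRing.zero /= mulr0 addr0.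
  by rewrite /GRing.zero /= !mulr0 addr0.
move=> /asboolP [h1 h2] /asboolP [h3 h4]; apply/asboolP.
have E f : (a *: v + w) f = a * v f + w f :> R by [].
by split => [b f g|f g]; rewrite !E ?(h1, h3, h2, h4); [exact: lin_aux|exact: der_aux].
Qed.
HB.instance Definition _ x := GRing.isSubmodClosed.Build R (Cinf M -> R^o)
  (tangent_pred x) (tangent_submod x).

(* T_x M, as the space of derivations of the algebra of smooth functions at x *)
Record tangent (x : M) := Tangent {
  tangent_val :> Cinf M -> R^o;
  tangent_valP : tangent_val \in tangent_pred x }.
HB.instance Definition _ x := [isSub for @tangent_val x].
HB.instance Definition _ x := [Choice of tangent x by <:].
HB.instance Definition _ x := [SubChoice_isSubLmodule of tangent x by <:].
End Tangent.
End Manifolds.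

Section VectorFields.
Variables (R : realType) (m : nat) (M : manifold R m).

Lemma tangent_lin (x : M) (v : tangent x) a f g : v (cinf_lin a f g) = a * v f + v g.
Proof. by have /asboolP [] := tangent_valP v. Qed.

Lemma tangent_mul (x : M) (v : tangent x) f g :
  v (cinf_mul f g) = f x * v g + g x * v f.
Proof. by have /asboolP [] := tangent_valP v. Qed.

Lemma tangentDZ (x : M) a (v w : tangent x) f : (a *: v + w) f = a * v f + w f.
Proof. by []. Qed.

Lemma tangent_eq (x : M) (v w : tangent x) : (forall f, v f = w f) -> v = w.
Proof. by move=> vw; apply: val_inj; apply/funext. Qed.

Record vfield := VField {
  vfield_fun :> forall x : M, tangent x;
  vfieldP : forall f : Cinf M, smooth_fun_on [set: M] (fun x => vfield_fun x f) }.

Definition vf_act (X : vfield) (f : Cinf M) : Cinf M := CInf (vfieldP X f).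

Lemma vf_act_lin X a f g :
  vf_act X (cinf_lin a f g) = cinf_lin a (vf_act X f) (vf_act X g).
Proof. by apply: cinf_eq => x /=; rewrite tangent_lin. Qed.

Lemma vf_act_mul X f g : vf_act X (cinf_mul f g) =
  cinf_lin 1 (cinf_mul f (vf_act X g)) (cinf_mul g (vf_act X f)).
Proof. by apply: cinf_eq => x /=; rewrite tangent_mul mul1r. Qed.

Lemma vf_bracket_subproof (X Y : vfield) (x : M) :
  (fun f => X x (vf_act Y f) - Y x (vf_act X f)) \in tangent_pred x.
Proof.
apply/asboolP; split => [a f g|f g].
  by rewrite !vf_act_lin !tangent_lin; ring.
by rewrite !vf_act_mul !tangent_lin !tangent_mul /=; ring.
Qed.

Lemma vf_bracket_smooth (X Y : vfield) (f : Cinf M) :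
  smooth_fun_on [set: M] (fun x => Tangent (vf_bracket_subproof X Y x) f).
Proof.
have -> : (fun x => Tangent (vf_bracket_subproof X Y x) f) =
    cinf_lin (-1) (vf_act Y (vf_act X f)) (vf_act X (vf_act Y f)).
  by apply/funext => x /=; rewrite mulN1r addrC.
exact: cinfP.
Qed.

Definition vf_bracket (X Y : vfield) : vfield := VField (vf_bracket_smooth X Y).
End VectorFields.

Section TangentMap.
Variables (R : realType) (m n : nat) (M : manifold R m) (N : manifold R n).
Variable F : smap M N.

Lemma dmap_subproof (x : M) (y : N) : F x = y -> forall v : tangent x,
  (fun f : Cinf N => v (cinf_comp F f)) \in tangent_pred y.
Proof.
move=> <- v; apply/asboolP; split => [a f g|f g].
  by rewrite -tangent_lin; congr (v _); exact: cinf_eq.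
have -> : cinf_comp F (cinf_mul f g) = cinf_mul (cinf_comp F f) (cinf_comp F g).
  exact: cinf_eq.
by rewrite tangent_mul.
Qed.

(* the differential of F at x; the equation F x = y gives control on the type *)
Definition dmap_at (x : M) (y : N) (e : F x = y) (v : tangent x) : tangent y :=
  Tangent (dmap_subproof e v).

Definition dmap (x : M) (v : tangent x) : tangent (F x) := dmap_at erefl v.

Lemma dmap_atDZ x y (e : F x = y) : linear (dmap_at e).
Proof. by move=> a v w; exact: tangent_eq. Qed.
End TangentMap.

Section LineBundles.
Variable R : realType.

Record trivialization m (M : manifold R m) (L : M -> lmodType R) := Triv {
  tdom : set M;
  tmap :> forall x, {linear L x -> R^o};
  tframe : forall x, L x;
  tdom_open : open tdom;
  tmap_frame : forall x, tdom x -> tmap x (tframe x) = 1;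
  tframe_span : forall x, tdom x -> forall v, tmap x v *: tframe x = v }.

(* A line bundle: a family of vector spaces, a manifold structure on its total
   space (the points of which are the [lpt x v], v in the fiber over x), and a cover
   of the base by local trivializations.  Clause [ltriv_smooth] says that these are
   diffeomorphisms between the restriction of the total space to [tdom] and
   tdom x R, expressed in charts. *)
Record line_bundle m (M : manifold R m) := LineBundle {
  lfib :> M -> lmodType R;
  ltot : manifold R (m + 1);
  lproj : ltot -> M;
  lpt : forall x, lfib x -> ltot;
  lproj_pt : forall x v, lproj (@lpt x v) = x;
  lpt_inj : forall x, injective (@lpt x);
  lpt_surj : forall e, exists v, @lpt (lproj e) v = e;
  ltriv : set (trivialization lfib);
  ltriv_cover : forall x, exists2 tau, ltriv tau & tdom tau x;
  ltriv_smooth : forall (c : chart R M m) (tau : trivialization lfib),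
    atlas c -> ltriv tau ->
    exists d : chart R ltot (m + 1),
      [/\ atlas d, cdom d = lproj @^-1` (cdom c `&` tdom tau),
          cimg d = [set z | cimg c (lsubmx z) /\ tdom tau (cinv c (lsubmx z))] &
          forall x v, cdom c x -> tdom tau x -> d (@lpt x v) = row_mx (c x) (tau x v)%:M ] }.

Section Sections.
Variables (m : nat) (M : manifold R m) (L : line_bundle M).

(* The coefficients in local trivializations are smooth. *)
Definition smooth_section (l : forall x, L x) : Prop :=
  forall tau : trivialization L, ltriv tau ->
    smooth_fun_on (tdom tau) (fun x => tau x (l x)).

Record sect := Sect {
  sect_fun :> forall x, L x;
  sectP : smooth_section sect_fun }.

Lemma sect_eq (l l' : sect) : (forall x, l x = l' x) -> l = l'.
Proof.
case: l l' => [l hl] [l' hl'] /= ll'.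
have {}ll' : l = l' by exact: functional_extensionality_dep.
by rewrite ll' in hl *; congr Sect; exact: Prop_irrelevance.
Qed.

Lemma sect0_subproof : smooth_section (fun x => 0).
Proof.
move=> tau _ c ac k; rewrite (_ : _ \o _ = cst 0); first exact: diff_iter_cst.
by apply/funext => z /=; rewrite linear0.
Qed.
Definition sect0 : sect := Sect sect0_subproof.

Lemma sect_lin_subproof (a : R) (l l' : sect) : smooth_section (fun x => a *: l x + l' x).
Proof.
move=> tau at_; rewrite (_ : (fun x => _) = fun x => a * tau x (l x) + tau x (l' x)).
  by apply: smooth_fun_lin; [exact: tdom_open|exact: sectP|exact: sectP].
by apply/funext => x; rewrite linearP.
Qed.
Definition sect_lin a l l' : sect := Sect (sect_lin_subproof a l l').

Lemma sect_mul_subproof (f : Cinf M) (l : sect) : smooth_section (fun x => f x *: l x).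
Proof.
move=> tau at_; rewrite (_ : (fun x => _) = fun x => f x * tau x (l x)).
  apply: smooth_fun_mul; [exact: tdom_open| |exact: sectP].
  exact: smooth_fun_subset (cinfP f).
by apply/funext => x; rewrite linearZ.
Qed.
Definition sect_mul f l : sect := Sect (sect_mul_subproof f l).

(* The fiber D_x L of the Atiyah algebroid.  An element is stored together with its
   symbol, which it determines. *)
Definition is_atiyah (x : M) (d : (sect -> L x) * tangent x) : Prop :=
  (forall a l l', d.1 (sect_lin a l l') = a *: d.1 l + d.1 l') /\
  (forall f l, d.1 (sect_mul f l) = d.2 f *: l x + f x *: d.1 l).

Definition atiyah_pred (x : M) : {pred (sect -> L x) * tangent x} :=
  fun d => `[< is_atiyah d >].

Lemma atiyah_submod (x : M) : submod_closed (@atiyah_pred x).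
Proof.
split => [|a d d'].
  apply/asboolP; split => [a l l'|f l] /=.
    by rewrite /GRing.zero /= scaler0 addr0.
  by rewrite /GRing.zero /= scaler0 scale0r addr0.
move=> /asboolP [h1 h2] /asboolP [h3 h4]; apply/asboolP.
have E1 l : (a *: d + d').1 l = a *: d.1 l + d'.1 l by [].
have E2 f : (a *: d + d').2 f = a * d.2 f + d'.2 f by rewrite -tangentDZ.
split => [b l l'|f l].
  rewrite !E1 h1 h3 !scalerDr addrACA !scalerA; congr (_ + _ + _).
  by rewrite mulrC.
rewrite !E1 E2 h2 h4 !scalerDr scalerDl !scalerA addrACA; congr (_ + (_ *: _ + _)).
by rewrite mulrC.
Qed.
HB.instance Definition _ x := GRing.isSubmodClosed.Build R ((sect -> L x) * tangent x)%type
  (@atiyah_pred x) (@atiyah_submod x).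

Record atiyah (x : M) := Atiyah {
  atiyah_val : (sect -> L x) * tangent x;
  atiyah_valP : atiyah_val \in @atiyah_pred x }.
HB.instance Definition _ x := [isSub for @atiyah_val x].
HB.instance Definition _ x := [Choice of atiyah x by <:].
HB.instance Definition _ x := [SubChoice_isSubLmodule of atiyah x by <:].

Definition at_act (x : M) (d : atiyah x) : sect -> L x := (atiyah_val d).1.
Definition symb (x : M) (d : atiyah x) : tangent x := (atiyah_val d).2.

Lemma at_act_lin x (d : atiyah x) a l l' :
  at_act d (sect_lin a l l') = a *: at_act d l + at_act d l'.
Proof. by have /asboolP [h _] := atiyah_valP d; exact: h. Qed.

Lemma at_act_mul x (d : atiyah x) f l :
  at_act d (sect_mul f l) = symb d f *: l x + f x *: at_act d l.
Proof. by have /asboolP [_ h] := atiyah_valP d; exact: h. Qed.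

Lemma symb_is_linear x : linear (@symb x).
Proof. by []. Qed.
HB.instance Definition _ x := GRing.isLinear.Build R (atiyah x) (tangent x) _ (@symb x)
  (@symb_is_linear x).

(* smooth sections of DL (smoothness of the symbol follows from the first
   condition) *)
Record derivation := Derivation {
  der_fun :> forall x, atiyah x;
  derP : forall l : sect, smooth_section (fun x => at_act (der_fun x) l);
  der_symbP : forall f, smooth_fun_on [set: M] (fun x => symb (der_fun x) f) }.

Definition der_act (D : derivation) (l : sect) : sect := Sect (derP D l).
Definition der_symb (D : derivation) : vfield M := VField (der_symbP D).

Lemma der_act_lin D a l l' :
  der_act D (sect_lin a l l') = sect_lin a (der_act D l) (der_act D l').
Proof. by apply: sect_eq => x; exact: at_act_lin. Qed.

Lemma der_act_mul D f l : der_act D (sect_mul f l) =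
  sect_lin 1 (sect_mul (vf_act (der_symb D) f) l) (sect_mul f (der_act D l)).
Proof. by apply: sect_eq => x /=; rewrite scale1r; exact: at_act_mul. Qed.

Let bracket_aux (V : zmodType) (a b c d a' d' : V) :
  (a + b + (c + d)) - (a' + c + (b + d')) = (a - a') + (d - d').
Proof.
have -> : a + b + (c + d) = (a + d) + (c + b) by rewrite addrACA [b + d]addrC addrACA.
have -> : a' + c + (b + d') = (a' + d') + (c + b).
  by rewrite addrACA [c + d']addrC addrACA [b + c]addrC.
by rewrite opprD addrACA subrr addr0 opprD addrACA.
Qed.

Lemma der_bracket_subproof (D E : derivation) (x : M) :
  ((fun l => at_act (D x) (der_act E l) - at_act (E x) (der_act D l)),
   vf_bracket (der_symb D) (der_symb E) x) \in @atiyah_pred x.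
Proof.
apply/asboolP; split => [a l l'|f l] /=.
  by rewrite !der_act_lin !at_act_lin scalerBr opprD addrACA.
rewrite !der_act_mul !at_act_lin !at_act_mul /= !scale1r scalerBl scalerBr.
exact: bracket_aux.
Qed.

Lemma der_bracket_act D E l (x : M) :
  at_act (Atiyah (der_bracket_subproof D E x)) l =
  sect_lin (-1) (der_act E (der_act D l)) (der_act D (der_act E l)) x.
Proof. by rewrite /= scaleN1r addrC. Qed.

Lemma der_bracket_smooth D E l :
  smooth_section (fun x => at_act (Atiyah (der_bracket_subproof D E x)) l).
Proof.
have -> : (fun x => at_act (Atiyah (der_bracket_subproof D E x)) l) =
    sect_lin (-1) (der_act E (der_act D l)) (der_act D (der_act E l)).
  by apply: functional_extensionality_dep => x; exact: der_bracket_act.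
exact: sectP.
Qed.

Lemma der_bracket_symb_smooth D E f :
  smooth_fun_on [set: M] (fun x => symb (Atiyah (der_bracket_subproof D E x)) f).
Proof. exact: (vfieldP (vf_bracket (der_symb D) (der_symb E)) f). Qed.

Definition der_bracket (D E : derivation) : derivation :=
  Derivation (der_bracket_smooth D E) (der_bracket_symb_smooth D E).

(* L-valued forms on M, and Atiyah forms, of degrees 1 and 2; together with
   [form2_alt], linearity in the second argument gives bilinearity. *)
Record form1 := Form1 {
  form1_fun :> forall x, {linear tangent x -> L x};
  form1P : forall X : vfield M, smooth_section (fun x => form1_fun x (X x)) }.

Record form2 := Form2 {
  form2_fun :> forall x : M, tangent x -> tangent x -> L x;
  form2_linl : forall x w, linear (fun v => @form2_fun x v w);
  form2_linr : forall x v, linear (@form2_fun x v);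
  form2_alt : forall x v, @form2_fun x v v = 0;
  form2P : forall X Y : vfield M, smooth_section (fun x => form2_fun (X x) (Y x)) }.

Record aform1 := AForm1 {
  aform1_fun :> forall x, {linear atiyah x -> L x};
  aform1P : forall D : derivation, smooth_section (fun x => aform1_fun x (D x)) }.

Record aform2 := AForm2 {
  aform2_fun :> forall x : M, atiyah x -> atiyah x -> L x;
  aform2_linl : forall x e, linear (fun d => @aform2_fun x d e);
  aform2_linr : forall x d, linear (@aform2_fun x d);
  aform2_alt : forall x d, @aform2_fun x d d = 0;
  aform2P : forall D E : derivation, smooth_section (fun x => aform2_fun (D x) (E x)) }.

Arguments form2_fun : clear implicits.
Arguments aform2_fun : clear implicits.
Definition form1_eval (theta : form1) (X : vfield M) : sect := Sect (form1P theta X).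
Definition aform1_eval (eta : aform1) (D : derivation) : sect := Sect (aform1P eta D).
Definition aform2_eval (omega : aform2) (D E : derivation) : sect :=
  Sect (aform2P omega D E).

Let linear0_aux (V W : lmodType R) : linear (fun _ : V => 0 : W).
Proof. by move=> a u v; rewrite scaler0 addr0. Qed.

Definition form2_0 : form2 :=
  @Form2 (fun _ _ _ => 0) (fun _ _ => @linear0_aux _ _) (fun _ _ => @linear0_aux _ _)
    (fun _ _ => erefl) (fun _ _ => sect0_subproof).

Definition aform2_0 : aform2 :=
  @AForm2 (fun _ _ _ => 0) (fun _ _ => @linear0_aux _ _) (fun _ _ => @linear0_aux _ _)
    (fun _ _ => erefl) (fun _ _ => sect0_subproof).

(* the Lie algebroid differential of DL acting on L, in degrees 1 and 2 *)
Definition koszul1 (eta : aform1) (D1 D2 : derivation) (x : M) : L x :=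
  at_act (D1 x) (aform1_eval eta D2) - at_act (D2 x) (aform1_eval eta D1)
  - eta x (der_bracket D1 D2 x).

Definition koszul2 (omega : aform2) (D1 D2 D3 : derivation) (x : M) : L x :=
  at_act (D1 x) (aform2_eval omega D2 D3) - at_act (D2 x) (aform2_eval omega D1 D3)
  + at_act (D3 x) (aform2_eval omega D1 D2)
  - omega x (der_bracket D1 D2 x) (D3 x) + omega x (der_bracket D1 D3 x) (D2 x)
  - omega x (der_bracket D2 D3 x) (D1 x).

(* d_D eta is the form whose values on sections of DL are given by [koszul1].  There is
   exactly one such form, so the default value of [xget], here and in the definitions
   by [xget] below, is never used. *)
Definition dD (eta : aform1) : aform2 :=
  xget (aform2_0 : {classic aform2})
    [set omega : {classic aform2} |
      forall (D1 D2 : derivation) x, omega x (D1 x) (D2 x) = koszul1 eta D1 D2 x].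

Definition dD_closed (omega : aform2) : Prop :=
  forall D1 D2 D3 x, koszul2 omega D1 D2 D3 x = 0.

Lemma sigma_pull_smooth (theta : form1) (D : derivation) :
  smooth_section (fun x => (theta x \o @symb x) (D x)).
Proof. exact: (form1P theta (der_symb D)). Qed.

(* sigma^* theta *)
Definition sigma_pull (theta : form1) : aform1 :=
  AForm1 (sigma_pull_smooth theta).

Record connection := Connection {
  nabla :> forall x, {linear tangent x -> atiyah x};
  nabla_symb : forall x v, symb (nabla x v) = v;
  nabla_smooth : forall (X : vfield M) (l : sect),
    smooth_section (fun x => at_act (nabla x (X x)) l) }.

(* d^nabla theta *)
Definition dnabla (na : connection) (theta : form1) : form2 :=
  xget (form2_0 : {classic form2})
    [set tau : {classic form2} | forall (X Y : vfield M) x, tau x (X x) (Y x) =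
      at_act (na x (X x)) (form1_eval theta Y) - at_act (na x (Y x)) (form1_eval theta X)
      - theta x (vf_bracket X Y x)].

(* f_nabla : delta - nabla_(sigma delta) acts on sections by a multiple of the
   evaluation at x *)
Definition fnabla (na : connection) (x : M) (d : atiyah x) : R :=
  xget 0 [set r : R | forall l : sect,
    at_act d l - at_act (na x (symb d)) l = r *: l x].
End Sections.
End LineBundles.

Section VBMorphisms.
Variables (R : realType) (m n : nat) (M : manifold R m) (N : manifold R n).
Variables (L : line_bundle M) (L' : line_bundle N) (f : smap M N).

(* vector bundle morphisms over f that are isomorphisms on fibers *)
Record vbiso := VBIso {
  vb_tot : smap (ltot L) (ltot L');
  vb_fib :> forall x, {linear L x -> L' (f x)};
  vb_inv : forall x, L' (f x) -> L x;
  vb_fibK : forall x, cancel (vb_fib x) (@vb_inv x);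
  vb_invK : forall x, cancel (@vb_inv x) (vb_fib x);
  vb_totE : forall x v, vb_tot (@lpt _ _ _ L x v) = lpt (vb_fib x v) }.

Variable F : vbiso.

Lemma vb_inv_linear x : linear (@vb_inv F x).
Proof.
move=> a u v; rewrite -[RHS](vb_fibK F); congr (vb_inv _).
by rewrite linearP !vb_invK.
Qed.

Lemma vb_frame_neq0 x (tau : trivialization L) (tau' : trivialization L') :
  tdom tau x -> tdom tau' (f x) -> tau' (f x) (F x (tframe tau x)) != 0.
Proof.
move=> tx tfx; apply/eqP => h0.
have /eqP := tmap_frame tx.
have : F x (tframe tau x) = F x 0.
  by rewrite -[LHS](tframe_span tfx) h0 scale0r linear0.
move=> /(can_inj (@vb_fibK F x)) ->.
by rewrite linear0 eq_sym oner_eq0.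
Qed.

Lemma vb_pull_smooth (l : sect L') : smooth_section (fun x => vb_inv F (l (f x))).
Proof.
move=> tau atau c ac; apply: Csmooth_local => z0 [cz0 tz0].
have [tau' atau' tf] := ltriv_cover L' (f (cinv c z0)).
have [c' ac' c'f] := atlas_cover (f (cinv c z0)).
have [d [ad dd di dE]] := ltriv_smooth ac atau.
have [d' [ad' dd' di' dE']] := ltriv_smooth ac' atau'.
have [cfc sfc] := smapP f ac.
pose W' := tdom tau' `&` cdom c'.
pose V := (cimg c `&` cinv c @^-1` tdom tau) `&` (cimg c `&` (f \o cinv c) @^-1` W').
have oW' : open W' by apply: openI; [exact: tdom_open|exact: cdom_open].
have oV : open V.
  apply: openI; first by apply: open_chart; exact: tdom_open.
  by apply: open_cont_pre => //; exact: cimg_open.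
exists V; first by [].
pose num z := tau' (f (cinv c z)) (l (f (cinv c z))).
pose den z := tau' (f (cinv c z)) (F (cinv c z) (tframe tau (cinv c z))).
have den0 z : V z -> den z != 0 by move=> [[? ?] [? [? ?]]]; exact: vb_frame_neq0.
apply: (@Csmooth_ext _ _ _ (fun z => num z * (den z)^-1)) => //.
  move=> z Vz; apply: (canLR (mulfK (den0 z Vz))); rewrite /num /den.
  case: Vz => [[cz tz] _] /=; set p := cinv c z.
  rewrite -[X in tau' _ X = _](vb_invK F) -{1}[vb_inv F _](tframe_span tz).
  by rewrite !linearZ.
have snum : Csmooth V num.
  apply: (@Csmooth_subset _ _ _ (cimg c `&` (f \o cinv c) @^-1` tdom tau')).
    by move=> z [_ [cz [tz _]]].
  exact: (smooth_from_comp (@cimg_open _ _ _ c) (@tdom_open _ _ _ _ tau') (smapP f ac)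
    (sectP l atau')).
pose row1 (z : 'rV[R]_m) : 'rV[R]_(m + 1) := row_mx z (1 : 'M[R]_1).
have row1P z : V z -> cimg d (row1 z) /\
    cinv d (row1 z) = lpt (tframe tau (cinv c z)).
  move=> [[cz tz] _]; have cdz := cinv_dom cz; split.
    by rewrite di /row1 /= row_mxKl.
  rewrite -[RHS](@cmapK _ _ _ d); last by rewrite dd /preimage /= lproj_pt.
  by rewrite dE // cinvK // tmap_frame.
have [cF sF] := smapP (vb_tot F) ad.
pose V' := cimg d `&` (vb_tot F \o cinv d) @^-1` cdom d'.
have sden : Csmooth V den.
  apply: (@Csmooth_ext _ _ _
    (fun z => (d' \o (vb_tot F \o cinv d)) (row1 z) 0 (rshift n (0 : 'I_1)))) => //.
    move=> z Vz; have [_ e] := row1P z Vz; case: Vz => [[cz tz] [_ [t'z c'z]]] /=.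
    by rewrite e vb_totE dE' // row_mxEr mxE eqxx mulr1n.
  apply: (@Csmooth_comp R m (m + 1) V V' row1
    (fun z => (d' \o (vb_tot F \o cinv d)) z 0 (rshift n (0 : 'I_1)))) => //.
  - apply: open_cont_pre => //; [exact: cimg_open|exact: cdom_open].
  - move=> z Vz; have [h e] := row1P z Vz; split => //.
    by case: Vz => [[cz tz] [_ [t'z c'z]]]; rewrite /preimage /= e vb_totE dd' /preimage /= lproj_pt.
  - move=> j k; rewrite /row1; case: (splitP j) => i ji.
      rewrite (_ : (fun z => _) = fun z : 'rV[R]_m => z 0 i); first exact: diff_iter_coord.
      apply/funext => z; rewrite -(row_mxEl z (1 : 'M[R]_1)).
      by congr (row_mx _ _ _ _); exact: val_inj.
    rewrite (_ : (fun z => _) = cst 1); first exact: diff_iter_cst.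
    apply/funext => z; rewrite -[RHS](_ : (1 : 'M[R]_1) 0 i = 1).
      by rewrite -(row_mxEr z (1 : 'M[R]_1)); congr (row_mx _ _ _ _); exact: val_inj.
    by rewrite mxE ord1.
  - exact: (sF d' ad' (rshift n 0)).
move=> k; apply: (@diff_iterM _ _ _ _ num (fun z => (den z)^-1) oV (snum k)).
exact: (diff_iterV oV den0 (sden k)).
Qed.

(* F^* lambda *)
Definition vb_pull (l : sect L') : sect L := Sect (vb_pull_smooth l).

Lemma vb_pull_lin a l l' : vb_pull (sect_lin a l l') = sect_lin a (vb_pull l) (vb_pull l').
Proof. by apply: sect_eq => x /=; exact: vb_inv_linear. Qed.

Lemma vb_pull_mul g l : vb_pull (sect_mul g l) = sect_mul (cinf_comp f g) (vb_pull l).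
Proof.
apply: sect_eq => x /=; have := vb_inv_linear (g (f x)) (l (f x)) 0.
have -> : vb_inv F 0 = 0 :> L x by rewrite -(linear0 (F x)) vb_fibK.
by rewrite !addr0.
Qed.

Lemma at_map_subproof (x : M) (d : atiyah L x) :
  ((fun l => F x (at_act d (vb_pull l))), dmap f (symb d)) \in @atiyah_pred _ _ _ L' (f x).
Proof.
apply/asboolP; split => [a l l'|g l] /=.
  by rewrite vb_pull_lin at_act_lin linearP.
by rewrite vb_pull_mul at_act_mul linearD !linearZ /= vb_invK.
Qed.

(* DF *)
Definition at_map (x : M) (d : atiyah L x) : atiyah L' (f x) := Atiyah (at_map_subproof d).

Definition pull1 (theta : form1 L') (x : M) (v : tangent x) : L x :=
  vb_inv F (theta (f x) (dmap f v)).

Definition apull2 (omega : aform2 L') (x : M) (d e : atiyah L x) : L x :=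
  vb_inv F (omega (f x) (at_map d) (at_map e)).
End VBMorphisms.

Section Groupoids.
Variable R : realType.

(* The values of [gmul] on non-composable pairs are irrelevant. *)
Record lie_groupoid n m (G : manifold R n) (M : manifold R m) := LieGroupoid {
  src : smap G M;
  tgt : smap G M;
  gunit : smap M G;
  ginv : smap G G;
  gmul : G -> G -> G;
  src_subm : submersion src;
  tgt_subm : submersion tgt;
  mul_smooth : smooth2_on [set gh : G * G | src gh.1 = tgt gh.2]
                 (fun gh : G * G => gmul gh.1 gh.2);
  src_unit : forall x, src (gunit x) = x;
  tgt_unit : forall x, tgt (gunit x) = x;
  src_mul : forall g h, src g = tgt h -> src (gmul g h) = src h;
  tgt_mul : forall g h, src g = tgt h -> tgt (gmul g h) = tgt g;
  mulA : forall g h k, src g = tgt h -> src h = tgt k ->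
    gmul g (gmul h k) = gmul (gmul g h) k;
  mul_unitl : forall g, gmul (gunit (tgt g)) g = g;
  mul_unitr : forall g, gmul g (gunit (src g)) = g;
  src_inv : forall g, src (ginv g) = tgt g;
  tgt_inv : forall g, tgt (ginv g) = src g;
  mul_invl : forall g, gmul (ginv g) g = gunit (src g);
  mul_invr : forall g, gmul g (ginv g) = gunit (tgt g) }.

(* For the structure maps s, t, u, i, invertibility on fibers (part of [vbiso])
   follows from their being vector bundle morphisms. *)
Record lbg n m := LBG {
  arr : manifold R n;
  obj : manifold R m;
  grpd : lie_groupoid arr obj;
  larr : line_bundle arr;
  lobj : line_bundle obj;
  lgrpd : lie_groupoid (ltot larr) (ltot lobj);
  src_vb : vbiso larr lobj (src grpd);
  tgt_vb : vbiso larr lobj (tgt grpd);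
  unit_vb : vbiso lobj larr (gunit grpd);
  inv_vb : vbiso larr larr (ginv grpd);
  src_vbE : vb_tot src_vb = src lgrpd;
  tgt_vbE : vb_tot tgt_vb = tgt lgrpd;
  unit_vbE : vb_tot unit_vb = gunit lgrpd;
  inv_vbE : vb_tot inv_vb = ginv lgrpd;
  mul_vb : forall g h, larr g -> larr h -> larr (gmul grpd g h);
  mul_vbE : forall g h (v : larr g) (w : larr h), src grpd g = tgt grpd h ->
    src lgrpd (lpt v) = tgt lgrpd (lpt w) ->
    gmul lgrpd (lpt v) (lpt w) = lpt (mul_vb v w);
  mul_vb_lin : forall g h a (v v' : larr g) (w w' : larr h),
    src grpd g = tgt grpd h ->
    src lgrpd (lpt v) = tgt lgrpd (lpt w) ->
    src lgrpd (lpt v') = tgt lgrpd (lpt w') ->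
    mul_vb (a *: v + v') (a *: w + w') = a *: mul_vb v w + mul_vb v' w' }.

Variables (n m : nat) (L : lbg n m).
Local Notation G := (arr L).
Local Notation M := (obj L).
Local Notation LM := (lobj L).
Local Notation s := (src (grpd L)).
Local Notation t := (tgt (grpd L)).
Local Notation u := (gunit (grpd L)).

(* partial theta = 0 and partial omega = 0, for partial = s^* - t^* *)
Definition partial_closed1 (theta : form1 LM) : Prop :=
  forall (g : G) (v : tangent g), pull1 (src_vb L) theta v - pull1 (tgt_vb L) theta v = 0.

Definition partial_closed2 (omega : aform2 LM) : Prop :=
  forall (g : G) (d e : atiyah (larr L) g),
    apull2 (src_vb L) omega d e - apull2 (tgt_vb L) omega d e = 0.

Definition algebroid_pred (x : M) : {pred tangent (u x)} := fun a => `[< dmap s a = 0 >].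

Lemma algebroid_submod x : submod_closed (@algebroid_pred x).
Proof.
split => [|a v w]; first by apply/asboolP; exact: tangent_eq.
move=> /asboolP v0 /asboolP w0; apply/asboolP.
by rewrite /dmap dmap_atDZ -/(dmap s v) -/(dmap s w) v0 w0 scaler0 addr0.
Qed.
HB.instance Definition _ x := GRing.isSubmodClosed.Build R (tangent (u x))
  (@algebroid_pred x) (@algebroid_submod x).

(* A_x, the kernel of ds at the unit u x *)
Record algebroid (x : M) := Algebroid {
  alg_val :> tangent (u x);
  alg_valP : alg_val \in @algebroid_pred x }.
HB.instance Definition _ x := [isSub for @alg_val x].
HB.instance Definition _ x := [Choice of algebroid x by <:].
HB.instance Definition _ x := [SubChoice_isSubLmodule of algebroid x by <:].

Definition anchor (x : M) (a : algebroid x) : tangent x :=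
  dmap_at (tgt_unit (grpd L) x) (alg_val a).

(* [e' = g.e], where g.v = t (s_g^-1 v), for points of the total space of L_M *)
Definition acts (g : G) (e e' : ltot LM) : Prop :=
  exists v : LM (s g), e = lpt v /\ e' = lpt (tgt_vb L g (vb_inv (src_vb L) v)).

(* [gam], restricted to ]-r, r[, is a curve in the s-fiber of x through the unit of
   x, with velocity a *)
Definition alg_curve (x : M) (a : algebroid x) (r : R) (gam : R -> G) : Prop :=
  [/\ 0 < r, gam 0 = u x,
      smooth_from [set z : 'rV[R]_1 | `|z 0 0| < r] (fun z => gam (z 0 0)),
      (forall e, `|e| < r -> s (gam e) = x) &
      forall f : Cinf G, is_derive (0 : R) 1 (fun e => f (gam e) : R) (alg_val a f)].

(* The infinitesimal action: D_a lambda is the derivative at 0 of the curve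
   e |-> g(e)^-1 . lambda_(t (g e)) of the line over x.  Derivatives in this
   1-dimensional space are taken through linear forms. *)
Definition inf_action_spec (x : M) (a : algebroid x) (d : atiyah LM x) : Prop :=
  exists r gam, alg_curve a r gam /\
    forall l : sect LM, exists c : R -> LM x,
      (forall e, `|e| < r ->
         acts (ginv (grpd L) (gam e)) (lpt (l (t (gam e)))) (lpt (c e))) /\
      forall phi : {linear LM x -> R^o},
        is_derive (0 : R) 1 (fun e => phi (c e) : R) (phi (at_act d l)).

Definition inf_action (x : M) (a : algebroid x) : atiyah LM x :=
  xget 0 (inf_action_spec a).
End Groupoids.

Section Cochains.
Variable R : realType.

(* Three-term cochain complexes; the terms are subspaces [S0], [S1], [S2] of the
   modules [C0], [C1], [C2]. *)
Record cochain := Cochain {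
  C0 : lmodType R; S0 : set C0;
  C1 : lmodType R; S1 : set C1;
  C2 : lmodType R; S2 : set C2;
  dif0 : C0 -> C1;
  dif1 : C1 -> C2 }.

Definition linear_on (U V : lmodType R) (A : set U) (B : set V) (f : U -> V) : Prop :=
  (forall v, A v -> B (f v)) /\
  (forall a v w, A v -> A w -> f (a *: v + w) = a *: f v + f w).

Arguments S0 : clear implicits.
Arguments S1 : clear implicits.
Arguments S2 : clear implicits.
Arguments dif0 : clear implicits.
Arguments dif1 : clear implicits.

Definition is_complex (C : cochain) : Prop :=
  [/\ linear_on (S0 C) (S1 C) (dif0 C), linear_on (S1 C) (S2 C) (dif1 C) &
      forall v, S0 C v -> dif1 C (dif0 C v) = 0].

Section Maps.
Variables (C C' : cochain).
Variables (f0 : C0 C -> C0 C') (f1 : C1 C -> C1 C') (f2 : C2 C -> C2 C').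

Definition is_cochain_map : Prop :=
  [/\ linear_on (S0 C) (S0 C') f0, linear_on (S1 C) (S1 C') f1,
      linear_on (S2 C) (S2 C') f2,
      (forall v, S0 C v -> f1 (dif0 C v) = dif0 C' (f0 v)) &
      (forall v, S1 C v -> f2 (dif1 C v) = dif1 C' (f1 v))].

(* f induces a bijection Z / B -> Z' / B' *)
Definition quotient_iso (U V : lmodType R) (Z B : set U) (Z' B' : set V) (f : U -> V)
    : Prop :=
  (forall v, Z v -> B' (f v) -> B v) /\
  (forall w, Z' w -> exists2 v, Z v & B' (w - f v)).

Definition quasi_iso : Prop :=
  [/\ is_complex C, is_complex C', is_cochain_map &
  [/\ quotient_iso (S0 C `&` [set v | dif0 C v = 0]) [set 0]
        (S0 C' `&` [set v | dif0 C' v = 0]) [set 0] f0,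
      quotient_iso (S1 C `&` [set v | dif1 C v = 0]) (dif0 C @` S0 C)
        (S1 C' `&` [set v | dif1 C' v = 0]) (dif0 C' @` S0 C') f1 &
      quotient_iso (S2 C) (dif1 C @` S1 C) (S2 C') (dif1 C' @` S1 C') f2 ]].
End Maps.
End Cochains.

Section Structures.
Variables (R : realType) (n m : nat) (L : lbg R n m).
Local Notation M := (obj L).
Local Notation LM := (lobj L).

(* Hom(E, L_x) as a subspace of the space of all functions *)
Definition dual_space (E V : lmodType R) : set (E -> V) := [set psi | linear psi].

Definition transpose (E E' : lmodType R) (V : Type) (phi : E -> E') (psi : E' -> V) : E -> V :=
  psi \o phi.

(* A_x --> D_x L_M --> 0 *)
Definition atiyah_cplx (x : M) : cochain R :=
  @Cochain R (algebroid x) setT (atiyah LM x) setT 'rV[R]_0 setT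
    (@inf_action _ _ _ L x) (fun=> 0).

(* 0 --> J^1_x L_M --> A_x^dagger *)
Definition jet_cplx (x : M) : cochain R :=
  @Cochain R 'rV[R]_0 setT
    (atiyah LM x -> LM x) (@dual_space (atiyah LM x) (LM x))
    (algebroid x -> LM x) (@dual_space (algebroid x) (LM x))
    (fun=> 0) (transpose (@inf_action _ _ _ L x)).

(* A_x --> T_x M --> L_{M,x} *)
Definition kernel_cplx (theta : form1 LM) (x : M) : cochain R :=
  @Cochain R (algebroid x) setT (tangent x) setT (LM x) setT
    (@anchor _ _ _ L x) (theta x).

(* R --> T^dagger_x M --> A_x^dagger *)
Definition cokernel_cplx (theta : form1 LM) (x : M) : cochain R :=
  @Cochain R R^o setT
    (tangent x -> LM x) (@dual_space (tangent x) (LM x))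
    (algebroid x -> LM x) (@dual_space (algebroid x) (LM x))
    (fun r v => r *: theta x v) (transpose (@anchor _ _ _ L x)).

Definition Fnabla (na : connection LM) (x : M) (a : algebroid x) : R :=
  fnabla na (inf_action a).

Definition morita_quasi_iso (na : connection LM) (theta : form1 LM) (x : M) : Prop :=
  @quasi_iso R (kernel_cplx theta x) (cokernel_cplx theta x)
    (fun a => - Fnabla na a)
    (fun v => dnabla na theta x v)
    (fun w a => Fnabla na a *: w).

(* The quasi-isomorphism condition does not depend on the connection. *)
Definition contact0 : set (form1 LM) :=
  [set theta | partial_closed1 theta /\
     exists na : connection LM, forall x, morita_quasi_iso na theta x].

Definition symplectic0 : set (aform2 LM) :=
  [set omega | [/\ partial_closed2 omega, dD_closed omega &
     forall x, @quasi_iso R (atiyah_cplx x) (jet_cplx x)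
       (fun=> 0) (fun d => omega x d) (fun=> 0)]].
End Structures.

(* Main.v *)
(* Splitting DL = TM + R by a connection nabla, the form omega = d_D sigma^* theta reads
   f_nabla /\ theta + d^nabla theta, and the infinitesimal action is (rho, F_nabla).  The
   symplectic condition on omega and the quasi-isomorphism condition on the Morita curvature
   of theta are then equivalent by a diagram chase in which no dimension count is needed.
   Contraction with the identity derivation is a contracting homotopy of the Atiyah complex
   (Cartan's formula), so that every closed omega is d_D sigma^* theta for the unique theta
   with theta o sigma = omega (1, -); naturality of d_D under fiberwise isomorphisms turns
   partial theta = 0 into partial omega = 0 and back.  Since tangent vectors are derivations of
   global functions, all of this rests on Hadamard's lemma and on cutoff functions, which
   provide extensions of vectors to fields, connections, and the curve in the s-fiber that
   defines the infinitesimal action. *)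
From HB Require Import structures.
Require Import Defs.
From mathcomp Require Import all_boot all_order all_algebra.
From mathcomp Require Import all_classical all_reals all_analysis.
From mathcomp Require Import ring lra.

Set Implicit Arguments.
Unset Strict Implicit.
Unset Printing Implicit Defensive.

Import Order.TTheory GRing.Theory Num.Theory.
Import numFieldNormedType.Exports.

Local Open Scope classical_set_scope.
Local Open Scope ring_scope.

(** * Flat functions and Hadamard's lemma *)

(** [dD] is specified by its values on global derivations, and source and target do not push
    derivations forward, so the Koszul formula alone does not show that [dD] commutes with
    pull-back. The remedy is to write a multiple [h theta] as a finite sum of terms [df_j] times
    [mu_j], with [h] equal to 1 at the point under study. The Leibniz rule then expresses [dD] at
    that point by functions and sections, which do pull back; the expression is also pointwise and
    bilinear, so that a form with the Koszul values exists. Multiplying by cutoffs keeps every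
    function global, as a derivation applies to nothing else. The infinitesimal action is likewise
    given by a specification, through curves. It is met by differentiating a quotient of two
    functions on [G], which involves only the velocity. The diagram chase works because, up to
    signs, the mapping cones of the two cochain maps are the same four-term complex, from [A_x] to
    [T_x M + R] to [T_x^dagger M + L_x] to [A_x^dagger]; both conditions say that it is exact. *)

Section Flat.
Variable R : realType.

(* x^-k exp (-1/x), extended by 0: for varying k these functions span a space closed under
   differentiation. *)
Definition flat (k : nat) (x : R) : R :=
  if 0 < x then x^-1 ^+ k * expR (- x^-1) else 0.

Lemma flat_le0 k x : x <= 0 -> flat k x = 0.
Proof. by rewrite /flat ltNge => ->. Qed.

Lemma flat_gt0 k x : 0 < x -> 0 < flat k x.
Proof. by move=> x0; rewrite /flat x0 mulr_gt0 ?expR_gt0 // exprn_gt0 // invr_gt0. Qed.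

(** The exponential dominates the term of degree k + 2 of its series at 1/x; the two spare powers of
    x give continuity at 0. *)
Lemma flat_bound k x : `|flat k x| <= (k.+2)`!%:R * x ^+ 2.
Proof.
have [x0|x0] := ltP 0 x; last by rewrite flat_le0 // normr0 mulr_ge0 // sqr_ge0.
rewrite ger0_norm; last exact: ltW (flat_gt0 _ _).
rewrite /flat x0 expRN.
have y0 : 0 < x^-1 by rewrite invr_gt0.
have := expR_ge1Dxn k.+1 (ltW y0).
set y := x^-1 in y0 *; have -> : x = y^-1 by rewrite invrK.
move=> h; rewrite ler_pdivrMr ?expR_gt0 //.
have {}h : y ^+ k.+2 / k.+2`!%:R <= expR y by apply: le_trans h; rewrite lerDr.
have f0 : 0 < k.+2`!%:R :> R by rewrite ltr0n fact_gt0.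
rewrite ler_pdivrMr // mulrC in h.
have -> : y ^+ k = y ^+ k.+2 * y^-1 ^+ 2.
  by rewrite -addn2 exprD exprVn mulfK // expf_neq0 // gt_eqF.
by rewrite [leRHS]mulrAC ler_pM2r // exprn_gt0 // invr_gt0.
Qed.

Lemma flat_cont0 k : {for 0, continuous (flat k)}.
Proof.
rewrite /prop_for /continuous_at (flat_le0 k (lexx 0)); apply/norm_cvg0P.
have C : (fun x : R => (k.+2)`!%:R * x ^+ 2) @ (0:R) --> (k.+2)`!%:R * (0:R) ^+ 2.
  by apply: cvgM; [exact: cvg_cst|exact: exprn_continuous].
rewrite expr0n mulr0 in C.
apply: (squeeze_cvgr _ (cvg_cst 0) C).
by near=> x; rewrite normr_ge0 flat_bound.
Unshelve. all: by end_near. Qed.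

Lemma flat_derive k (x : R) : is_derive x 1 (flat k) (flat k.+2 x - k%:R * flat k.+1 x).
Proof.
have [x0|x0|->] := ltgtP x 0.
- rewrite !flat_le0 ?(ltW x0) // mulr0 subr0.
  apply: (near_eq_is_derive _ (is_derive_cst 0 x 1)).
  by apply: filterS (lt_le_nbhsl x0) => y y0; rewrite flat_le0.
- have dV : is_derive x 1 (fun y : R => y^-1) (- x^-1 ^+ 2).
    have := @is_deriveV R id x 1 1 (lt0r_neq0 x0) (is_derive_id _ _).
    by rewrite exprVn [_ *: _]mulr1.
  have dE : is_derive x 1 (fun y : R => expR (- y^-1)) (expR (- x^-1) * x^-1 ^+ 2).
    have := @is_derive1_comp R expR (fun y : R => - y^-1) x _ _
      (is_derive_expR _) (is_deriveN dV).
    by rewrite opprK.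
  have D := is_deriveM (is_deriveX k dV) dE.
  have -> : flat k.+2 x - k%:R * flat k.+1 x =
     x^-1 ^+ k *: (expR (- x^-1) * x^-1 ^+ 2) +
     expR (- x^-1) *: ((k%:R * x^-1 ^+ k.-1) *: - x^-1 ^+ 2).
    rewrite /flat x0; case: (k) => [|k'] /=.
      by rewrite expr0 !mul0r scale0r scaler0 addr0 scale1r subr0 mulrC.
    rewrite /GRing.scale /= !exprS; ring.
  rewrite exprfctE in D; apply: (near_eq_is_derive _ D).
  by apply: filterS (lt_nbhsr x0) => y y0; rewrite /flat y0.
(* At 0 the slope function is [flat k.+1], since [flat k z = flat k.+1 z * z] for all z. *)
- apply/is_derive1_caratheodory; exists (flat k.+1); split.
  + move=> z; rewrite (flat_le0 k (lexx 0)) !subr0.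
    have [z0|z0] := ltP 0 z; last by rewrite !flat_le0 // mul0r.
    by rewrite /flat z0 exprSr mulrAC mulfVK // gt_eqF.
  + exact: flat_cont0.
  + by rewrite !flat_le0 // mulr0 subr0.
Unshelve. all: by end_near. Qed.

Lemma flat_diff_iter K k : diff_iter K setT (fun z : 'rV[R]_1 => flat k (z 0 0)).
Proof.
have D k' (z : 'rV[R]_1) : differentiable (flat k' \o (fun z : 'rV[R]_1 => z 0 0)) z.
  apply: differentiable_comp; first exact: differentiable_coord.
  by apply/derivable1_diffP; case: (flat_derive k' (z 0 0)).
elim: K k => [|K IH] k; first by split => // z _; exact: D.
split => [z _|v]; first exact: D.
have -> : 'D_v (fun z : 'rV[R]_1 => flat k (z 0 0)) =
    fun z => v 0 0 * (flat k.+2 (z 0 0) + - k%:R * flat k.+1 (z 0 0)).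
  apply/funext => z.
  have df : differentiable (flat k) (z 0 0).
    by apply/derivable1_diffP; case: (flat_derive k (z 0 0)).
  have dc : differentiable (fun z : 'rV[R]_1 => z 0 0) z by exact: differentiable_coord.
  rewrite -[LHS]/('D_v (flat k \o (fun z : 'rV[R]_1 => z 0 0)) z).
  rewrite deriveE; last exact: D.
  rewrite diff_comp //= -(deriveE v dc).
  have -> : 'D_v (fun z : 'rV[R]_1 => z 0 0) z = v 0 0.
    have := derive_mx (@derivable_id R 'rV[R]_1 z v).
    by rewrite derive_id => /matrixP/(_ 0 0); rewrite mxE.
  rewrite -[in LHS](mulr1 (v 0 0)) -[in LHS]/(v 0 0 *: (1:R)) linearZ /= -deriveE //.
  have [_ ->] := flat_derive k (z 0 0).
  by rewrite mulNr.
apply: diff_iterM; [exact: openT|exact: diff_iter_cst|].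
apply: diff_iterD; [exact: openT|exact: IH|].
by apply: diff_iterM; [exact: openT|exact: diff_iter_cst|exact: IH].
Qed.

Lemma Csmooth_flat n (U : set 'rV[R]_n) f : open U ->
  Csmooth U f -> Csmooth U (fun z => flat 0 (f z)).
Proof.
move=> oU sf.
have E : (fun z => flat 0 (f z)) =
    fun z => (fun y : 'rV[R]_1 => flat 0 (y 0 0)) ((fun z => \row__ f z) z).
  by apply/funext => z; rewrite mxE.
rewrite E => K; apply: (@diff_iter_comp R n 1 K U setT (fun z => \row__ f z)
  (fun y : 'rV[R]_1 => flat 0 (y 0 0))) => //.
- exact: openT.
- move=> j; rewrite (_ : (fun x => _) = f) //.
  by apply/funext => z; rewrite mxE.
- exact: flat_diff_iter.
Qed.

Definition sqdist n (y z : 'rV[R]_n) : R := \sum_i (z 0 i - y 0 i) * (z 0 i - y 0 i).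

Lemma sqdist_ge n (y z : 'rV[R]_n) i : (z 0 i - y 0 i) ^+ 2 <= sqdist y z.
Proof.
rewrite /sqdist (bigD1 i) //= -expr2 lerDl.
by apply: sumr_ge0 => j _; rewrite -expr2 sqr_ge0.
Qed.

Lemma Csmooth_sqdist n (U : set 'rV[R]_n) y : open U -> Csmooth U (sqdist y).
Proof.
move=> oU K; apply: diff_iter_sum => // i.
have H : diff_iter K U (fun z => z 0 i + - y 0 i).
  by apply: diff_iterD => //; [exact: diff_iter_coord|exact: diff_iter_cst].
exact: diff_iterM.
Qed.

(** The squared Euclidean distance is polynomial, hence smooth, and dominates the square of the
    maximum norm of ['rV]; so the Euclidean ball on which the bump is nonzero lies in the required
    ball. *)
Lemma bump_rV n (y : 'rV[R]_n) (r : R) : 0 < r ->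
  exists b : 'rV[R]_n -> R, [/\ Csmooth setT b, 0 < b y &
    forall z, b z != 0 -> `|z - y| < r].
Proof.
move=> r0; exists (fun z => flat 0 (r ^+ 2 + -1 * sqdist y z)); split.
- apply: Csmooth_flat; first exact: openT.
  move=> K; apply: diff_iterD; [exact: openT|exact: diff_iter_cst|].
  apply: diff_iterM; [exact: openT|exact: diff_iter_cst|].
  by apply: Csmooth_sqdist; exact: openT.
- apply: flat_gt0; rewrite /sqdist big1 ?mulr0 ?addr0 ?exprn_gt0 // => i _.
  by rewrite subrr mul0r.
- move=> z; case: (ltP 0 (r ^+ 2 + -1 * sqdist y z)) => [h _|h]; last first.
    by rewrite flat_le0 ?eqxx.
  rewrite [`|_|]mx_normrE; apply/bigmax_ltP; split => // -[i j] _ /=; rewrite !mxE ord1.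
  have : `|z 0 j - y 0 j| ^+ 2 < r ^+ 2.
    rewrite real_normK ?num_real //; apply: le_lt_trans (sqdist_ge y z j) _.
    by rewrite mulN1r subr_gt0 in h.
  by rewrite ltr_pXn2r ?nnegrE // ltW.
Qed.

End Flat.

Section Hadamard.
Variable R : realType.

Lemma line_is_derive n (f : 'rV[R]_n -> R) (p v : 'rV[R]_n) (s : R) :
  derivable f (p + s *: v) v ->
  is_derive s 1 (fun s : R => f (p + s *: v) : R) ('D_v f (p + s *: v)).
Proof.
have E : (fun h : R => h^-1 *: (((fun s : R => f (p + s *: v) : R) \o shift s) (h *: (1 : R))
    - f (p + s *: v))) =
    (fun h => h^-1 *: ((f \o shift (p + s *: v)) (h *: v) - f (p + s *: v))).
  apply/funext => h /=; congr (_ *: (f _ - _)).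
  by rewrite [h *: 1]mulr1 scalerDl addrCA.
by move=> df; apply: DeriveDef; rewrite ?/derivable ?/derive E.
Qed.

Lemma derive_mul_coord n (f : 'rV[R]_n -> R) (z w : 'rV[R]_n) j : derivable f z w ->
  'D_w (fun z : 'rV[R]_n => z 0 j * f z) z = z 0 j * 'D_w f z + f z * w 0 j.
Proof.
move=> df; rewrite -[LHS]/('D_w ((fun z : 'rV[R]_n => z 0 j) * f) z) deriveM //.
  have -> // : 'D_w (fun z : 'rV[R]_n => z 0 j) z = w 0 j.
  have := derive_mx (@derivable_id R 'rV[R]_n z w).
  by rewrite derive_id => /matrixP/(_ 0 j); rewrite mxE.
by apply: diff_derivable; exact: differentiable_coord.
Qed.

Lemma line_continuous n (z w : 'rV[R]_n) : continuous (fun e : R => z + e *: w).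
Proof.
by move=> e; apply: cvgD; [exact: cvg_cst|apply: cvgZr_tmp; exact: cvg_id].
Qed.

Lemma line_MVT n (f : 'rV[R]_n -> R) (p v : 'rV[R]_n) :
  (forall s : R, s \in `[0, 1] -> differentiable f (p + s *: v)) ->
  exists2 s : R, s \in `[0, 1] & f (p + v) - f p = 'D_v f (p + s *: v).
Proof.
move=> df; pose F (s : R) : R := f (p + s *: v); pose F' (s : R) : R := 'D_v f (p + s *: v).
have H (s : R) : s \in `[0, 1] -> is_derive s 1 F (F' s).
  by move=> s01; apply: line_is_derive; apply: diff_derivable; exact: df.
have Fo (s : R) : s \in `]0, 1[ -> is_derive s 1 F (F' s).
  by move=> s01; apply: H; exact: subset_itv_oo_cc s01.
have Fc : {within `[0, 1], continuous F}.
  by apply: derivable_within_continuous => s /H [].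
have [s s01] := MVT_segment ler01 Fo Fc.
by rewrite /F /F' scale1r scale0r addr0 subr0 mulr1; exists s.
Qed.

Local Notation mu := (@lebesgue_measure R).

Definition int01 (f : R -> R) : R := \int[mu]_(t in `[0, 1]) f t.

Lemma cont_int01 (f : R -> R) :
  {within `[(0:R), 1], continuous f} -> mu.-integrable `[(0:R), 1] (EFin \o f).
Proof. by apply: continuous_compact_integrable; exact: segment_compact. Qed.

Lemma int01_bound (f : R -> R) M : {within `[(0:R), 1], continuous f} ->
  (forall t, t \in `[0, 1] -> `|f t| <= M) -> `|int01 f| <= M.
Proof.
move=> cf fM; rewrite /int01.
have intf := cont_int01 cf.
apply: le_trans (le_normr_Rintegral _ intf) _ => //.
have -> : M = \int[mu]_(t in `[(0:R), 1]) M.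
  rewrite Rintegral_cst //= lebesgue_measure_itv /= lte_fin ltr01 /=.
  by rewrite oppr0 addr0 mulr1.
apply: le_Rintegral => //.
- exact: integrable_norm.
- by apply: cont_int01; exact: cst_continuous.
Qed.

Lemma int01_linear (a b : R) (f g : R -> R) :
  {within `[(0:R), 1], continuous f} -> {within `[(0:R), 1], continuous g} ->
  int01 (fun t => a * f t + b * g t) = a * int01 f + b * int01 g.
Proof.
move=> cf cg; have [intf intg] := (cont_int01 cf, cont_int01 cg).
rewrite /int01 -(RintegralZl _ _ intf) // -(RintegralZl _ _ intg) // -RintegralD //.
- by apply: cont_int01 => t; apply: cvgM; [exact: cvg_cst|exact: cf].
- by apply: cont_int01 => t; apply: cvgM; [exact: cvg_cst|exact: cg].
Qed.

Lemma int01_sum m (c : 'I_m -> R) (f : 'I_m -> R -> R) :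
  (forall i, {within `[(0:R), 1], continuous (f i)}) ->
  {within `[(0:R), 1], continuous (fun t => \sum_i c i * f i t)} /\
  int01 (fun t => \sum_i c i * f i t) = \sum_i c i * int01 (f i).
Proof.
elim: m c f => [|m IH] c f cf.
  rewrite (_ : (fun t => _) = cst 0); last by apply/funext => t; rewrite big_ord0.
  by split; [exact: cst_continuous|rewrite big_ord0 /int01 Rintegral_cst // mul0r].
rewrite (_ : (fun t => _) = fun t => c ord0 * f ord0 t +
    \sum_(i < m) c (lift ord0 i) * f (lift ord0 i) t); last first.
  by apply/funext => t; rewrite big_ord_recl.
rewrite big_ord_recl.
have [c1 I1] := IH (fun i => c (lift ord0 i)) (fun i => f (lift ord0 i))
  (fun i => cf (lift ord0 i)).
split.
  move=> t; apply: cvgD; last exact: c1.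
  by apply: cvgM; [exact: cvg_cst|exact: cf].
rewrite -I1 -[in RHS](mul1r (int01 (fun t => \sum_(i < m) _))) -int01_linear //.
by congr int01; apply/funext => t; rewrite mul1r.
Qed.

Section Ball.
Variables (n : nat) (y : 'rV[R]_n) (r : R).
Local Notation B := [set z : 'rV[R]_n | `|z - y| < r].

Definition seg (z : 'rV[R]_n) (t : R) : 'rV[R]_n := y + t *: (z - y).

Lemma seg_ball z t : B z -> t \in `[0, 1] -> B (seg z t).
Proof.
rewrite in_itv /= => zr /andP[t0 t1]; rewrite /seg addrC addKr normrZ ger0_norm //.
by apply: le_lt_trans zr; rewrite ler_piMl.
Qed.

Lemma seg_shift z w t : seg (z + w) t = seg z t + t *: w.
Proof. by rewrite /seg addrAC scalerDr addrA. Qed.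

Lemma normball_open : open B.
Proof.
rewrite (_ : B = ball y r); first exact: ball_open.
by rewrite -ball_normE; apply/seteqP; split => z /=; rewrite distrC.
Qed.

Lemma seg_continuous z : continuous (seg z).
Proof. exact: line_continuous. Qed.

Lemma cont_seg (g : 'rV[R]_n -> R) z : (forall x, B x -> {for x, continuous g}) -> B z ->
  {within `[(0:R), 1], continuous (fun t => g (seg z t))}.
Proof.
move=> cg Bz; apply: continuous_in_subspaceT => t; rewrite inE /= => t01.
apply: continuous_comp; first exact: seg_continuous.
exact/cg/seg_ball.
Qed.

(** Compactness of [0, 1] makes the continuity of [g] along the segment uniform in t, which is what
    differentiation under the integral sign requires. *)
Lemma unif_seg (g : 'rV[R]_n -> R) z (e : R) : (forall x, B x -> {for x, continuous g}) -> B z ->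
  0 < e -> \forall u \near (0 : 'rV[R]_n), forall t, t \in `[0, 1] ->
    `|g (seg z t + u) - g (seg z t)| < e.
Proof.
move=> cg Bz e0.
have /compact_near_coveringP K := @segment_compact R 0 1.
suff H : forall t : R, `[0, 1]%classic t -> \forall t' \near t & u \near (0 : 'rV[R]_n),
    `|g (seg z t' + u) - g (seg z t')| < e.
  have := K _ (nbhs (0 : 'rV[R]_n))
    (fun u t => `|g (seg z t + u) - g (seg z t)| < e) (nbhs_filter _) H.
  by apply: filterS => u h t t01; exact: h.
move=> t /= t01.
have c1 : (fun tu : R * 'rV[R]_n => seg z tu.1 + tu.2) @ (nbhs t, nbhs (0 : 'rV[R]_n))
    --> seg z t + 0.
  by apply: cvgD; [apply: cvg_comp; [exact: cvg_fst|exact: seg_continuous]|exact: cvg_snd].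
have c2 : (fun tu : R * 'rV[R]_n => seg z tu.1) @ (nbhs t, nbhs (0 : 'rV[R]_n))
    --> seg z t.
  by apply: cvg_comp; [exact: cvg_fst|exact: seg_continuous].
rewrite addr0 in c1.
have cgt : {for seg z t, continuous g} by exact/cg/seg_ball.
have FF : Filter (filter_prod (nbhs t) (nbhs (0 : 'rV[R]_n))) by exact: filter_prod_filter.
have := @cvgB R R^o _ _ FF _ _ _ _ (cvg_comp _ _ c1 cgt) (cvg_comp _ _ c2 cgt).
by rewrite subrr => /cvgr0_norm_lt; apply.
Qed.

Hypothesis r0 : 0 < r.

(* The remainders in Hadamard's lemma: the derivative of such an integral in a direction v
   is again one, with k increased and h replaced by 'D_v h. *)
Definition radint (k : nat) (h : 'rV[R]_n -> R) (z : 'rV[R]_n) : R :=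
  int01 (fun t => t ^+ k * h (seg z t)).

Lemma cont_radint k h z : (forall x, B x -> {for x, continuous h}) -> B z ->
  {within `[(0:R), 1], continuous (fun t => t ^+ k * h (seg z t))}.
Proof.
move=> ch Bz t; apply: cvgM; last exact: cont_seg.
have cX : {within `[(0:R), 1], continuous (fun t : R => t ^+ k)}.
  by apply: continuous_subspaceT; exact: exprn_continuous.
exact: cX.
Qed.

Lemma derive_delta (h : 'rV[R]_n -> R) x w : differentiable h x ->
  'D_w h x = \sum_i w 0 i * 'D_(delta_mx 0 i) h x.
Proof.
move=> dh; rewrite deriveE // [X in 'd h _ X]row_sum_delta linear_sum.
by apply: eq_bigr => i _; rewrite linearZ /= -deriveE.
Qed.

Lemma radint_sum k (h : 'rV[R]_n -> R) z w :
  (forall x, B x -> differentiable h x) ->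
  (forall i x, B x -> {for x, continuous ('D_(delta_mx 0 i) h)}) -> B z ->
  radint k ('D_w h) z = \sum_i w 0 i * radint k ('D_(delta_mx 0 i) h) z.
Proof.
move=> dh ch Bz; rewrite /radint -(int01_sum _ _).2; last first.
  by move=> i; exact: (cont_radint (ch i) Bz).
rewrite /int01; apply: eq_Rintegral => t; rewrite inE /= => t01.
rewrite derive_delta; last exact/dh/seg_ball.
by rewrite mulr_sumr; apply: eq_bigr => i _; rewrite mulrCA.
Qed.

Lemma norm_sum_rV (w : 'rV[R]_n) (c : 'I_n -> R) e : (forall i, `|c i| <= e) ->
  `|\sum_i w 0 i * c i| <= n%:R * e * `|w|.
Proof.
move=> ce; apply: le_trans (ler_norm_sum _ _ _) _.
rewrite -[n in n%:R]card_ord -sum1_card natr_sum !mulr_suml; apply: ler_sum => i _.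
rewrite mul1r normrM mulrC; apply: ler_pM => //.
by rewrite [leRHS]mx_normrE; apply: (le_bigmax _ (fun i : 'I_1 * 'I_n => `|w i.1 i.2|) (0, i)).
Qed.

Definition lincomb (c : 'I_n -> R) (w : 'rV[R]_n) : R := \sum_i w 0 i * c i.

Lemma lincomb_is_linear c : linear (lincomb c : 'rV[R]_n -> R^o).
Proof.
move=> a v w; rewrite /lincomb scaler_sumr -big_split /=; apply: eq_bigr => i _.
by rewrite !mxE mulrDl -mulrA.
Qed.

HB.instance Definition _ c := GRing.isLinear.Build R 'rV[R]_n (R : normedModType R) _ (lincomb c)
  (lincomb_is_linear c).

Lemma lincomb_continuous c : continuous (lincomb c : 'rV[R]_n -> R).
Proof.
move=> w; apply: differentiable_continuous.
have oT : open [set: 'rV[R]_n] by exact: openT.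
have H : diff_iter 0 [set: 'rV[R]_n] (fun w => \sum_i w 0 i * c i).
  apply: diff_iter_sum => // i; apply: (@diff_iterM _ _ _ _ _ (cst (c i)) oT).
    exact: diff_iter_coord.
  exact: diff_iter_cst.
by case: H => /(_ w I).
Qed.

(** Differentiation under the integral sign: for each t the mean value theorem turns the increment
    of [h] into a derivative at an intermediate point, and [unif_seg] bounds the error independently
    of t. *)
Lemma radint_expansion k (h : 'rV[R]_n -> R) z :
  (forall x, B x -> differentiable h x) ->
  (forall v x, B x -> {for x, continuous ('D_v h)}) -> B z ->
  radint k h \o shift z = cst (radint k h z) +
    lincomb (fun i => radint k.+1 ('D_(delta_mx 0 i) h) z) +o_ (0 : 'rV[R]_n) id.
Proof.
move=> dh cdh Bz.
pose L : {linear 'rV[R]_n -> R} := lincomb (fun i => radint k.+1 ('D_(delta_mx 0 i) h) z).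
have LE w : radint k.+1 ('D_w h) z = L w by rewrite radint_sum // => i; exact: cdh.
have ch x : B x -> {for x, continuous h} by move=> /dh /differentiable_continuous.
apply/eqaddoP => e e0.
(* The error is a sum over n coordinates; [n.+1] also covers n = 0. *)
pose e' := e / n.+1%:R.
have e'0 : 0 < e' by rewrite divr_gt0.
have : \forall u \near (0 : 'rV[R]_n), forall (i : 'I_n) (t : R), t \in `[0, 1] ->
  `|'D_(delta_mx 0 i) h (seg z t + u) - 'D_(delta_mx 0 i) h (seg z t)| < e'.
  exact: (@filter_forall _ _ (fun (i : 'I_n) u => forall t : R, t \in `[0, 1] ->
    `|'D_(delta_mx 0 i) h (seg z t + u) - 'D_(delta_mx 0 i) h (seg z t)| < e')
    (nbhs (0 : 'rV[R]_n)) (nbhs_filter _) (fun i => unif_seg (cdh _) Bz e'0)).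
move=> /nbhs_norm0P[d /= d0 Hd].
(* The bound [d] serves the uniform estimate, and [r - |z - y|] keeps the displaced segment in
   [B]. *)
apply: (iffRL (@nbhs_norm0P R 'rV[R]_n _)); exists (Num.min d (r - `|z - y|)) => /=.
  by rewrite lt_min d0 subr_gt0.
move=> w /=; rewrite lt_min => /andP[wd wr].
have Bs (s : R) : s \in `[0, 1] -> B (z + s *: w).
  rewrite in_itv /= => /andP[s0 s1]; rewrite addrAC; apply: le_lt_trans (ler_normD _ _) _.
  rewrite -ltrBrDl; apply: le_lt_trans wr; rewrite normrZ ger0_norm // ler_piMl //.
have Bzw : B (z + w) by rewrite -[w]scale1r; apply: Bs; rewrite in_itv /= ler01 lexx.
rewrite !fctE /= [w + z]addrC -LE.
have cont_radint_D : {within `[(0:R), 1], continuous (fun t => t ^+ k.+1 * 'D_w h (seg z t))}.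
  exact: (cont_radint (cdh w)).
have cD : {within `[(0:R), 1], continuous (fun t =>
    1 * (t ^+ k * h (seg (z + w) t)) + -1 * (t ^+ k * h (seg z t)))}.
  move=> t; apply: cvgD; apply: cvgM; try exact: cvg_cst; exact: cont_radint.
have -> : radint k h (z + w) - (radint k h z + radint k.+1 ('D_w h) z) =
  int01 (fun t => 1 * (1 * (t ^+ k * h (seg (z + w) t)) + -1 * (t ^+ k * h (seg z t)))
    + -1 * (t ^+ k.+1 * 'D_w h (seg z t))).
  rewrite int01_linear; [|by move=> t; apply: (cD t)|exact: cont_radint_D].
  by rewrite int01_linear; [rewrite /radint; ring|exact: cont_radint|exact: cont_radint].
apply: int01_bound.
  move=> t; apply: cvgD; apply: cvgM; try exact: cvg_cst.
    exact: cD.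
  exact: cont_radint_D.
move=> t t01; set p := seg z t.
have [s s01 hs] : exists2 s : R, s \in `[0, 1] &
    h (seg (z + w) t) - h p = t * 'D_w h (p + s *: (t *: w)).
  have S (s : R) : p + s *: (t *: w) = seg (z + s *: w) t.
    by rewrite seg_shift !scalerA mulrC.
  have [|s s01] := @line_MVT _ h p (t *: w).
    by move=> s s01; apply: dh; rewrite S; apply: seg_ball => //; exact: Bs.
  rewrite -seg_shift => ->; exists s => //.
  have D : differentiable h (p + s *: (t *: w)).
    by apply: dh; rewrite S; apply: seg_ball => //; exact: Bs.
  by rewrite !deriveE // linearZ.
set u := s *: (t *: w) in hs *.
have ud : `|u| < d.
  move: t01 s01; rewrite !in_itv /= => /andP[t0 t1] /andP[s0 s1].
  rewrite /u scalerA normrZ ger0_norm ?mulr_ge0 //; apply: le_lt_trans wd.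
  by rewrite ler_piMl // mulr_ile1.
have Dp : differentiable h p by exact/dh/seg_ball.
have Dq : differentiable h (p + u).
  by apply: dh; rewrite /u scalerA mulrC -scalerA -seg_shift; apply: seg_ball => //; exact: Bs.
have -> : 1 * (1 * (t ^+ k * h (seg (z + w) t)) + -1 * (t ^+ k * h p)) +
    -1 * (t ^+ k.+1 * 'D_w h p) = t ^+ k.+1 *
    \sum_i w 0 i * ('D_(delta_mx 0 i) h (p + u) - 'D_(delta_mx 0 i) h p).
  rewrite (eq_bigr _ (fun i _ => mulrBr _ _ _)) sumrB -!derive_delta // exprSr.
  transitivity (t ^+ k * (h (seg (z + w) t) - h p) - t ^+ k * t * 'D_w h p); first by ring.
  by rewrite hs; ring.
have := norm_sum_rV w (fun i => ltW (Hd u ud i t t01)).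
rewrite normrM => hb; apply: le_trans (_ : 1 * (n%:R * e' * `|w|) <= _).
  apply: ler_pM => //; move: t01; rewrite in_itv /= => /andP[t0 t1].
  by rewrite normrX ger0_norm // exprn_ile1.
rewrite mul1r; apply: ler_wpM2r => //.
by rewrite /e' mulrCA ler_piMr ?(ltW e0) // ler_pdivrMr // mul1r ler_nat.
Qed.

Lemma radint_differentiable k (h : 'rV[R]_n -> R) z :
  (forall x, B x -> differentiable h x) ->
  (forall v x, B x -> {for x, continuous ('D_v h)}) -> B z ->
  differentiable (radint k h) z /\ forall v, 'D_v (radint k h) z = radint k.+1 ('D_v h) z.
Proof.
move=> dh cdh Bz.
pose L : {linear 'rV[R]_n -> R} := lincomb (fun i => radint k.+1 ('D_(delta_mx 0 i) h) z).
have LE w : radint k.+1 ('D_w h) z = L w by rewrite radint_sum // => i; exact: cdh.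
have H := radint_expansion k dh cdh Bz.
have Lc : continuous L by exact: lincomb_continuous.
have dL := diff_unique Lc H.
have D : differentiable (radint k h) z.
  by apply/diff_locallyP; rewrite dL.
by split => // v; rewrite LE deriveE // dL.
Qed.

Lemma radint_diff_iter K k h : Csmooth B h -> diff_iter K B (radint k h).
Proof.
move=> sh.
have dh v x : B x -> differentiable ('D_v h) x.
  by move=> Bx; have [_ /(_ v) [H _]] := sh 1%N; exact: H.
have D k' h' : Csmooth B h' -> forall z, B z -> differentiable (radint k' h') z /\
    forall v, 'D_v (radint k' h') z = radint k'.+1 ('D_v h') z.
  move=> sh' z Bz; apply: radint_differentiable => // [x Bx|v x Bx].
    by have [H _] := sh' 0%N; exact: H.
  apply: differentiable_continuous.
  by have [_ /(_ v) [H _]] := sh' 1%N; exact: H.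
elim: K k h sh {dh} => [|K IH] k h sh; first by split => // z Bz; have [] := D k h sh z Bz.
split => [z Bz|v]; first by have [] := D k h sh z Bz.
apply: (@diff_iter_ext _ _ _ _ (radint k.+1 ('D_v h))); first exact: normball_open.
  by move=> z; rewrite inE => Bz; have [_ ->] := D k h sh z Bz.
by apply: IH => K'; have [_ /(_ v)] := sh K'.+1.
Qed.

(** By the fundamental theorem of calculus, [g i] can be the mean of the i-th partial derivative
    over the segment from [y] to z; at z = [y] this segment is constant. *)
Lemma hadamard (F : 'rV[R]_n -> R) : Csmooth B F ->
  exists g : 'I_n -> 'rV[R]_n -> R, [/\ forall i, Csmooth B (g i),
    forall i, g i y = 'D_(delta_mx 0 i) F y &
    forall z, B z -> F z = F y + \sum_i (z 0 i - y 0 i) * g i z].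
Proof.
move=> sF; have By : B y by rewrite /= subrr normr0.
have dF x : B x -> differentiable F x by have [H _] := sF 0%N; exact: H.
have dF' v x : B x -> {for x, continuous ('D_v F)}.
  move=> Bx; apply: differentiable_continuous.
  by have [_ /(_ v) [H _]] := sF 1%N; exact: H.
exists (fun i => radint 0 ('D_(delta_mx 0 i) F)); split.
- by move=> i K; apply: radint_diff_iter => K'; have [_ ] := sF K'.+1; apply.
- move=> i; rewrite /radint /int01.
  rewrite (_ : (fun t => _) = cst ('D_(delta_mx 0 i) F y)).
    rewrite Rintegral_cst //= lebesgue_measure_itv /= lte_fin ltr01 /=.
    by rewrite oppr0 addr0 mulr1.
  by apply/funext => t; rewrite expr0 mul1r /seg subrr scaler0 addr0.
move=> z Bz.
have -> : \sum_i (z 0 i - y 0 i) * radint 0 ('D_(delta_mx 0 i) F) z =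
    radint 0 ('D_(z - y) F) z.
  rewrite radint_sum //; last by move=> i; exact: dF'.
  by apply: eq_bigr => i _; rewrite !mxE.
have H (s : R) : s \in `[0, 1] -> is_derive s 1 (fun s : R => F (seg z s) : R)
    ('D_(z - y) F (seg z s)).
  by move=> s01; apply: line_is_derive; apply: diff_derivable; apply: dF; exact: seg_ball.
have cF := cont_radint (k := 0) (dF' (z - y)) Bz.
have dFs : {within `[(0:R), 1], continuous (fun s => F (seg z s))}.
  by apply: derivable_within_continuous => s s01; case: (H s s01).
have [_ c0 c1] := (continuous_within_itvP _ ltr01).1 dFs.
have := @continuous_FTC2 R (fun t => t ^+ 0 * 'D_(z - y) F (seg z t))
  (fun s => F (seg z s)) 0 1 ltr01 cF.
rewrite /radint /int01 /Rintegral => ->.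
- rewrite /= /seg scale1r scale0r addr0 addrC [y + _]addrC subrK.
  by rewrite addNKr.
- split => //= s s01; by case: (H s (subset_itv_oo_cc s01)).
- move=> s s01; rewrite derive1E expr0 mul1r.
  by case: (H s (subset_itv_oo_cc s01)).
Qed.

End Ball.

End Hadamard.

(** * Cutoff functions and local frames of the tangent bundle *)

Section Functions.
Variables (R : realType) (m : nat) (M : manifold R m).
Implicit Types (W V : set M) (f g : M -> R).

Lemma mspace_hausdorff : hausdorff_space M.
Proof. by case: M. Qed.

Lemma smooth_fun_ext W f g : open W -> (forall p, W p -> f p = g p) ->
  smooth_fun_on W f -> smooth_fun_on W g.
Proof.
move=> oW fg sf c ac; apply: Csmooth_ext (sf c ac); first exact: open_chart.
by move=> z [_ Wz]; exact: fg.
Qed.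

Lemma smooth_fun_local W f :
  (forall p, W p -> exists2 V, V p & smooth_fun_on V f) -> smooth_fun_on W f.
Proof.
move=> H c ac; apply: Csmooth_local => z [cz Wz].
by have [V Vz sf] := H _ Wz; exists (cimg c `&` cinv c @^-1` V) => //; exact: sf.
Qed.

Lemma smooth_fun_cst W a : smooth_fun_on W (fun=> a).
Proof. by move=> c _ k; exact: diff_iter_cst. Qed.

Definition cinf_cst (a : R) : Cinf M := CInf (@smooth_fun_cst setT a).

Lemma smooth_fun_inv W f : open W -> (forall p, W p -> f p != 0) ->
  smooth_fun_on W f -> smooth_fun_on W (fun p => (f p)^-1).
Proof.
move=> oW f0 sf c ac k; apply: diff_iterV (sf c ac k); first exact: open_chart.
by move=> z [_ Wz]; exact: f0.
Qed.

Lemma smooth_fun_flat W f : open W -> smooth_fun_on W f ->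
  smooth_fun_on W (fun p => flat 0 (f p)).
Proof.
by move=> oW sf c ac; apply: (@Csmooth_flat _ _ _ (f \o cinv c)); [exact: open_chart|exact: sf].
Qed.

Lemma smooth_chart (c : chart R M m) (U : set 'rV[R]_m) (F : 'rV[R]_m -> R) :
  atlas c -> open U -> Csmooth U F ->
  smooth_fun_on (cdom c `&` c @^-1` U) (fun p => F (c p)).
Proof.
move=> ac oU sF d ad.
have oW : open (cdom c `&` c @^-1` U).
  by apply: open_cont_pre => //; [exact: cdom_open|exact: cmap_cont].
apply: (@Csmooth_comp _ _ _ _ U (c \o cinv d)) => //.
- exact: open_chart.
- by move=> z [_ []].
- move=> j; apply: Csmooth_subset ((atlas_compat ad ac).1 j).
  by move=> z [dz [cz _]].
Qed.

Lemma smooth_coord (c : chart R M m) i : atlas c ->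
  smooth_fun_on (cdom c) (fun p => c p 0 i).
Proof.
move=> ac; rewrite -[cdom c]setIT -(preimage_setT c).
by apply: (@smooth_chart c setT (fun z => z 0 i)) => // [|k]; [exact: openT|exact: diff_iter_coord].
Qed.

Lemma smooth_fun_nbhs0 W f : open W -> (forall p, W p -> f p = 0) -> smooth_fun_on W f.
Proof. by move=> oW f0; apply: smooth_fun_ext (@smooth_fun_cst W 0) => // p /f0. Qed.

(** For open [W], the set [W] and the complement of [K] form an open cover, and [f] is 0 on the
    latter; smoothness on [W] thus gives smoothness everywhere. *)
Definition supported W f := exists2 K, closed K /\ K `<=` W & forall p, f p != 0 -> K p.

Lemma supported_in W f p : supported W f -> f p != 0 -> W p.
Proof. by move=> [K [_ KW] h] /h /KW. Qed.

Lemma supported_mull W f g : supported W f -> supported W (fun p => g p * f p).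
Proof. by move=> [K HK h]; exists K => // p; rewrite mulf_eq0 negb_or => /andP[_ /h]. Qed.

Lemma supported_subset W V f : W `<=` V -> supported W f -> supported V f.
Proof. by move=> WV [K [cK KW] h]; exists K => //; split => // p /KW /WV. Qed.

Lemma supported_smooth W f : open W -> supported W f -> smooth_fun_on W f ->
  smooth_fun_on setT f.
Proof.
move=> oW [K [cK KW] h] sf; apply: smooth_fun_local => p _.
have [Kp|nKp] := pselect (K p); first by exists W => //; exact: KW.
exists (~` K) => //; apply: smooth_fun_nbhs0; first exact: closed_openC.
by move=> q nKq; apply/eqP; apply: contrapT => /negP /h.
Qed.

Lemma supported_mul_smooth W (k : Cinf M) f : open W -> supported W k ->
  smooth_fun_on W f -> smooth_fun_on setT (fun p => f p * k p).
Proof.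
move=> oW sk sf; apply: (supported_smooth oW); first exact: supported_mull.
apply: smooth_fun_mul => //; exact: smooth_fun_subset (cinfP k).
Qed.

(** The set carrying the cutoff is the image of a closed ball under [cinv c]: it is compact, hence
    closed in [M] because [M] is Hausdorff, and extension by 0 outside the chart is smooth. *)
Lemma cutoff_exists W p : open W -> W p -> exists2 k : Cinf M, supported W k & k p = 1.
Proof.
move=> oW Wp; have [c ac cp] := atlas_cover p.
pose W' := cimg c `&` cinv c @^-1` W.
have oW' : open W' by exact: open_chart.
have W'p : W' (c p) by split; [exact: cmap_img|rewrite /preimage /= cmapK].
have : nbhs (c p) W' by exact: open_nbhs_nbhs.
move=> /nbhs_closedballP [[r /= rP] HB].
have r0 : 0 < r by case/andP: rP => _; rewrite in_itv /= andbT.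
have [b [sb b0 bB]] := bump_rV (c p) r0.
pose f q : R := if `[< cdom c q >] then b (c q) / b (c p) else 0.
pose K := cinv c @` closed_ball (c p) r.
have KW : K `<=` W `&` cdom c.
  by move=> _ [z /HB [cz Wz] <-]; split => //; exact: cinv_dom.
have sup : supported (W `&` cdom c) f.
  exists K; first split => //.
    apply: (compact_closed mspace_hausdorff); apply: continuous_compact.
      apply: continuous_in_subspaceT => z; rewrite inE => /HB [cz _].
      exact: cinv_cont.
    apply: bounded_closed_compact; last exact: closed_ball_closed.
    exists (`|c p| + r); split; first exact: num_real.
    move=> N hN z; rewrite closed_ballE // /closed_ball_ /= => hz.
    apply: le_trans (ltW hN); rewrite -[z](subrK (c p)) addrC.
    by apply: le_trans (ler_normD _ _) _; rewrite lerD2l distrC.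
  move=> q; rewrite /f; case: asboolP => [cq|]; last by rewrite eqxx.
  rewrite mulf_eq0 negb_or => /andP[/bB bq _]; exists (c q); last exact: cmapK.
  by apply: subset_closed_ball; rewrite -ball_normE /= distrC.
have sf : smooth_fun_on setT f.
  apply: (supported_smooth (cdom_open c)).
    by apply: supported_subset sup; exact: subIsetr.
  apply: (@smooth_fun_ext _ (fun q => (b (c p))^-1 * b (c q) + 0)); first exact: cdom_open.
    by move=> q cq; rewrite /f asboolT // addr0 mulrC.
  apply: smooth_fun_lin; [exact: cdom_open| |exact: smooth_fun_cst].
  by rewrite -[cdom c]setIT -(preimage_setT c); apply: smooth_chart => //; exact: openT.
exists (CInf sf); first by apply: supported_subset sup; exact: subIsetl.
by rewrite /= /f asboolT // divff // gt_eqF.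
Qed.

End Functions.

(** * Derivations at a point in a chart *)

Section TangentVectors.
Variables (R : realType) (m : nat) (M : manifold R m).

Lemma smooth_fun_sum (J : finType) (W : set M) (F : J -> M -> R) : open W ->
  (forall j, smooth_fun_on W (F j)) -> smooth_fun_on W (fun p => \sum_j F j p).
Proof.
move=> oW sF; elim: (index_enum J) => [|j s IH].
  apply: smooth_fun_ext (@smooth_fun_cst _ _ _ W 0) => // p _; by rewrite big_nil.
apply: smooth_fun_ext (smooth_fun_lin 1 oW (sF j) IH) => // p _.
by rewrite big_cons mul1r.
Qed.

Lemma tangent_eqf (x : M) (v : tangent x) (f g : Cinf M) : f =1 g -> v f = v g.
Proof. by move=> /cinf_eq ->. Qed.

Lemma tangent_cst (x : M) (v : tangent x) a : v (cinf_cst M a) = 0.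
Proof.
have v0 : v (cinf_cst M 0) = 0.
  rewrite (@tangent_eqf _ v _ (cinf_lin (-1) (cinf_cst M 0) (cinf_cst M 0))).
    by rewrite tangent_lin mulN1r addNr.
  by move=> p /=; rewrite mulr0 addr0.
have v1 : v (cinf_cst M 1) = 0.
  have := tangent_mul v (cinf_cst M 1) (cinf_cst M 1).
  rewrite (@tangent_eqf _ v _ (cinf_cst M 1)); last by move=> p /=; rewrite mulr1.
  by move=> /= /eqP; rewrite !mul1r -subr_eq subrr eq_sym => /eqP.
rewrite (@tangent_eqf _ v _ (cinf_lin a (cinf_cst M 1) (cinf_cst M 0))).
  by rewrite tangent_lin v0 v1 mulr0 addr0.
by move=> p /=; rewrite mulr1 addr0.
Qed.

(** [Cinf] carries no additive structure here, so the sum enters as a function [S] with the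
    prescribed values. *)
Lemma tangent_sum (x : M) (v : tangent x) n (F : 'I_n -> Cinf M) (S : Cinf M) :
  (forall p, S p = \sum_i F i p) -> v S = \sum_i v (F i).
Proof.
elim: n F S => [|n IH] F S SE.
  rewrite big_ord0 (@tangent_eqf _ v _ (cinf_cst M 0)) ?tangent_cst // => p.
  by rewrite SE big_ord0.
rewrite big_ord_recl -(IH _ (cinf_lin (-1) (F ord0) S)).
  by rewrite tangent_lin mulN1r addNKr.
by move=> p /=; rewrite SE big_ord_recl mulN1r addKr.
Qed.

Lemma tangent_sumE (x : M) (J : finType) (v : J -> tangent x) f :
  (\sum_j v j) f = \sum_j v j f.
Proof. by apply: (big_morph (fun w : tangent x => w f)). Qed.

Lemma chart_rep_smooth (c : chart R M m) (f : Cinf M) : atlas c -> Csmooth (cimg c) (f \o cinv c).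
Proof.
by move=> ac; have := cinfP f ac; rewrite preimage_setT setIT.
Qed.

Lemma chart_rep_differentiable (c : chart R M m) (f : Cinf M) y :
  atlas c -> cdom c y -> differentiable (f \o cinv c) (c y).
Proof. by move=> ac cy; have [H _] := chart_rep_smooth f ac 0%N; exact/H/cmap_img. Qed.

Section Chart.
Variables (c : chart R M m) (ac : atlas c) (y : M) (cy : cdom c y).

(* By Hadamard's lemma f - f y = sum_i (z_i - y_i) g_i near y, so that a derivation at y is
   determined by its values on the (cut off) coordinates. *)
Lemma tangent_chart (v : tangent y) :
  exists w : 'rV[R]_m, forall f : Cinf M, v f = 'D_w (f \o cinv c) (c y).
Proof.
have : nbhs (c y) (cimg c).
  by apply: open_nbhs_nbhs; split; [exact: cimg_open|exact: cmap_img].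
move=> /nbhs_ballP[r /= r0 HB].
pose B := [set z : 'rV[R]_m | `|z - c y| < r].
have BE : B = ball (c y) r by rewrite -ball_normE; apply/seteqP; split => z /=; rewrite distrC.
have oB : open B by rewrite BE; exact: ball_open.
have By : B (c y) by rewrite /B /= subrr normr0.
have Bc : B `<=` cimg c by rewrite BE.
pose W := cdom c `&` c @^-1` B.
have oW : open W by apply: open_cont_pre => //; [exact: cdom_open|exact: cmap_cont].
have [k sk ky] := cutoff_exists oW (conj cy By).
have shi i : smooth_fun_on W (fun p => c p 0 i - c y 0 i).
  apply: (@smooth_fun_ext _ _ _ _ (fun p => 1 * c p 0 i + - c y 0 i)) => //.
    by move=> p _; rewrite mul1r.
  apply: smooth_fun_lin => //; last exact: smooth_fun_cst.
  by apply: smooth_fun_subset (smooth_coord i ac) => p [].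
pose h i : Cinf M := CInf (supported_mul_smooth oW sk (shi i)).
exists (\row_i v (h i)) => f.
have sF : Csmooth B (f \o cinv c) by apply: Csmooth_subset (chart_rep_smooth f ac).
have [g [sg gy Hg]] := hadamard r0 sF.
have sgc i : smooth_fun_on W (fun p => g i (c p)) by exact: smooth_chart (sg i).
pose G i : Cinf M := CInf (supported_mul_smooth oW sk (sgc i)).
(* Each of [h i] and [G i] carries one factor [k], hence the square; as [k y = 1] and f - f y
   vanishes at [y], the factors do not change the value of [v]. *)
pose S := cinf_mul k (cinf_mul k (cinf_lin (-1) (cinf_cst M (f y)) f)).
have SE p : S p = \sum_i cinf_mul (h i) (G i) p.
  rewrite /S /=; have [->|k0] := eqVneq (k p) 0.
    by rewrite !mul0r big1 // => i _; rewrite mulr0 mul0r.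
  have [cp Bp] := supported_in sk k0.
  have := Hg _ Bp; rewrite /= !cmapK // => ->.
  rewrite mulN1r addKr !mulr_sumr; apply: eq_bigr => i _; ring.
have vS : v S = v f by rewrite /S !tangent_mul tangent_lin tangent_cst /= ky; ring.
rewrite -vS (tangent_sum v SE).
rewrite derive_delta; last exact: chart_rep_differentiable.
apply: eq_bigr => i _; rewrite tangent_mul /= subrr ky gy mxE; ring.
Qed.

Lemma dir_tangent (w : 'rV[R]_m) :
  (fun f : Cinf M => 'D_w (f \o cinv c) (c y) : R) \in tangent_pred y.
Proof.
have D (f : Cinf M) : derivable (f \o cinv c) (c y) w.
  by apply: diff_derivable; exact: chart_rep_differentiable.
apply/asboolP; split => [a f g|f g].
  rewrite -[LHS]/('D_w (a *: (f \o cinv c) + (g \o cinv c)) (c y)).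
  by rewrite deriveD ?deriveZ //; exact: derivableZ.
rewrite -[LHS]/('D_w ((f \o cinv c) * (g \o cinv c)) (c y)) deriveM //=.
by rewrite cmapK.
Qed.

End Chart.

End TangentVectors.

Section Frames.
Variables (R : realType) (m : nat) (M : manifold R m).

Section CoordinateField.
Variables (c : chart R M m) (ac : atlas c) (a : Cinf M) (sa : supported (cdom c) a).
Variable i : 'I_m.

Lemma coord_field_subproof (p : M) :
  (fun f : Cinf M => 'D_(delta_mx 0 i) (f \o cinv c) (c p) * a p : R) \in tangent_pred p.
Proof.
have [a0|a0] := eqVneq (a p) 0.
  by rewrite a0; apply/asboolP; split => [b f g|f g]; rewrite !mulr0 ?addr0.
have /asboolP[H1 H2] := dir_tangent ac (supported_in sa a0) (delta_mx 0 i).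
by apply/asboolP; split => [b f g|f g]; rewrite ?H1 ?H2; ring.
Qed.

Lemma coord_field_smooth (f : Cinf M) :
  smooth_fun_on [set: M] (fun p => Tangent (coord_field_subproof p) f).
Proof.
apply: (supported_mul_smooth (@cdom_open _ _ _ c) sa).
have := @smooth_chart _ _ M c (cimg c) ('D_(delta_mx 0 i) (f \o cinv c)) ac (@cimg_open _ _ _ c).
rewrite (_ : cdom c `&` _ = cdom c); last first.
  by apply/seteqP; split => [p []//|p cp]; split => //; exact: cmap_img.
apply => K; have [_ ] := chart_rep_smooth f ac K.+1; exact.
Qed.

Definition coord_field : vfield M := VField coord_field_smooth.

End CoordinateField.

(* A cut-off form of [v = sum_i v(z_i) d/dz_i]: in the proof z_i is replaced by k z_i, with k
   a cutoff function, and h = k^3; the terms v(k z_i) k - (k z_i) v(k) = k^2 v(z_i) involve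
   global functions only. *)
Lemma local_frame (x : M) : exists2 h : Cinf M, h x = 1 &
  exists (J : finType) (f : J -> Cinf M) (Z : J -> vfield M),
    forall y (v : tangent y), h y *: v = \sum_j v (f j) *: Z j y.
Proof.
have [c ac cx] := atlas_cover x.
have [k sk kx] := cutoff_exists (@cdom_open _ _ _ c) cx.
pose xi i : Cinf M := CInf (supported_mul_smooth (@cdom_open _ _ _ c) sk (smooth_coord i ac)).
exists (cinf_mul k (cinf_mul k k)); first by rewrite /= kx !mulr1.
have sk2 : supported (cdom c) (cinf_mul k k) by exact: supported_mull.
have sxi i : supported (cdom c) (cinf_mul (cinf_lin (-1) (xi i) (cinf_cst M 0)) k).
  exact: supported_mull.
exists ('I_m * bool)%type, (fun j => if j.2 then xi j.1 else k),
  (fun j => if j.2 then coord_field ac sk2 j.1 else coord_field ac (sxi j.1) j.1).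
move=> y v; apply: tangent_eq => f.
rewrite tangent_sumE -(pair_bigA _ (fun i b => ((v (if b then xi i else k) *:
  (if b then coord_field ac sk2 i else coord_field ac (sxi i) i) y : tangent y) f : R))) /=.
under eq_bigr do rewrite big_bool /= .
rewrite -[LHS]/(k y * (k y * k y) * v f).
under eq_bigr => i _.
  rewrite -[X in X + _]/(v (xi i) * ('D_(delta_mx 0 i) (f \o cinv c) (c y) * (k y * k y))).
  rewrite -[X in _ + X]/(v k * ('D_(delta_mx 0 i) (f \o cinv c) (c y) *
    ((-1 * (c y 0 i * k y) + 0) * k y))).
  over.
have [k0|k0] := eqVneq (k y) 0.
  by rewrite k0 !mul0r big1 // => i _; rewrite !mulr0 addr0.
have cy := supported_in sk k0.
have [w vw] := tangent_chart ac cy v.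
have vxi i : v (xi i) = k y * w 0 i + c y 0 i * v k.
  rewrite !vw.
  have Dk : derivable (k \o cinv c) (c y) w.
    by apply: diff_derivable; exact: chart_rep_differentiable.
  have -> : 'D_w (xi i \o cinv c) (c y) =
      'D_w (fun z : 'rV[R]_m => z 0 i * (k \o cinv c) z) (c y).
    apply: near_eq_derive; have : nbhs (c y) (cimg c).
      by apply: open_nbhs_nbhs; split; [exact: cimg_open|exact: cmap_img].
    by apply: filterS => z cz /=; rewrite cinvK.
  rewrite derive_mul_coord //.
  by rewrite /= cmapK // addrC.
rewrite vw derive_delta; last exact: chart_rep_differentiable.
rewrite mulr_sumr; apply: eq_bigr => i _; rewrite vxi; ring.
Qed.

(** The coefficients [v (f j)] of the local frame are frozen at their values for the given
    vector. *)
Lemma tangent_extend (x : M) (v : tangent x) : exists X : vfield M, X x = v.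
Proof.
have [h hx [J [f [Z hZ]]]] := local_frame x.
have sX (g : Cinf M) : smooth_fun_on [set: M] (fun p => (\sum_j v (f j) *: Z j p) g).
  apply: (@smooth_fun_ext _ _ _ _ (fun p => \sum_j (v (f j) * Z j p g + 0))) => //.
  - exact: openT.
  - by move=> p _; rewrite tangent_sumE; apply: eq_bigr => j _; rewrite addr0.
  apply: smooth_fun_sum => [|j]; first exact: openT.
  apply: smooth_fun_lin; [exact: openT|exact: vfieldP|exact: smooth_fun_cst].
by exists (VField sX) => /=; rewrite -hZ hx scale1r.
Qed.

End Frames.

(** * Sections of line bundles and connections *)

Section Continuity.
Variables (R : realType) (m : nat) (M : manifold R m).

Lemma cinf_continuous (f : Cinf M) : continuous f.
Proof.
move=> p; have [c ac cp] := atlas_cover p.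
have Fc : {for c p, continuous (f \o cinv c)}.
  by apply: differentiable_continuous; exact: chart_rep_differentiable.
have H : {for p, continuous ((f \o cinv c) \o c)}.
  by apply: continuous_comp => //; exact: cmap_cont.
have nc : \forall q \near p, (((f \o cinv c) \o c) q) = f q.
  have : nbhs p (cdom c) by apply: open_nbhs_nbhs; split; [exact: cdom_open|].
  by apply: filterS => q cq /=; rewrite cmapK.
rewrite /prop_for /continuous_at /= cmapK // in H.
by apply: cvg_trans H; exact: near_eq_cvg.
Qed.

Lemma cinf_open_gt (f : Cinf M) a : open [set p | a < f p].
Proof.
apply: (@open_comp _ _ f [set y | a < y]) => [p _|]; last exact: open_gt.
exact: cinf_continuous.
Qed.

Lemma cinf_open_neq0 (f : Cinf M) : open [set p | f p != 0].
Proof.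
apply: (@open_comp _ _ f [set y | y != 0]) => [p _|]; last exact: open_neq.
exact: cinf_continuous.
Qed.

Lemma supported_smooth_on (W V : set M) (f : M -> R) : open W -> open V -> supported W f ->
  smooth_fun_on (W `&` V) f -> smooth_fun_on V f.
Proof.
move=> oW oV [K [cK KW] h] sf; apply: smooth_fun_local => p Vp.
have [Kp|nKp] := pselect (K p); first by exists (W `&` V) => //; split => //; exact: KW.
exists (~` K) => //; apply: smooth_fun_nbhs0; first exact: closed_openC.
by move=> q nKq; apply/eqP; apply: contrapT => /negP /h.
Qed.

(** The index k stands for the basic open set numbered k by [i] and selects some p whose [F p]
    contains that set; [None] marks the indices with no such p. *)
Lemma countable_cover (F : M -> set M) : (forall p, open (F p) /\ F p p) ->
  exists s : nat -> option M, forall q, exists k p, s k = Some p /\ F p q.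
Proof.
move=> FP; have [B /countable_injP [i iB] [oB bB]] : @second_countable M by case: M.
pose P k p := exists b, [/\ B b, i b = k & b `<=` F p].
exists (fun k => if pselect (exists p, P k p) is left e then Some (projT1 (cid e)) else None).
move=> q; have [oF Fq] := FP q.
have [b [Bb bq] bF] := bB q (F q) (open_nbhs_nbhs (conj oF Fq)).
exists (i b); case: pselect => [e|]; last by case; exists q, b.
exists (projT1 (cid e)); split => //; case: (cid e) => p /= [b' [Bb' ib b'F]].
apply: b'F; have -> // : b' = b by apply: iB; rewrite ?inE.
Qed.

End Continuity.

Section LineBundleSections.
Variables (R : realType) (m : nat) (M : manifold R m) (L : line_bundle M).

(** In the chart of the total space attached to [tau] the frame is the slice with last coordinate 1.
    Its last coordinate in the chart attached to [tau'] is the transition function, which is smooth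
    by compatibility of the charts. *)
Lemma frame_smooth (tau tau' : trivialization L) : ltriv tau -> ltriv tau' ->
  smooth_fun_on (tdom tau `&` tdom tau') (fun x => tau' x (tframe tau x)).
Proof.
move=> at_ at' c ac.
have [d [ad dd di dE]] := ltriv_smooth ac at_.
have [d' [ad' dd' di' dE']] := ltriv_smooth ac at'.
set V := cimg c `&` _.
have oV : open V by apply: open_chart; apply: openI; exact: tdom_open.
pose row1 (z : 'rV[R]_m) : 'rV[R]_(m + 1) := row_mx z (1 : 'M[R]_1).
have row1P z : V z -> cimg d (row1 z) /\
    cinv d (row1 z) = lpt (tframe tau (cinv c z)).
  move=> [cz [tz _]]; have cdz := cinv_dom cz; split.
    by rewrite di /row1 /= row_mxKl.
  rewrite -[RHS](@cmapK _ _ _ d); last by rewrite dd /preimage /= lproj_pt.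
  by rewrite dE // cinvK // tmap_frame.
apply: (@Csmooth_ext _ _ _ (fun z => (d' \o cinv d) (row1 z) 0 (rshift m (0 : 'I_1)))) => //.
  move=> z Vz; have [_ e] := row1P z Vz; case: Vz => [cz [tz t'z]] /=.
  by rewrite e dE' ?row_mxEr ?mxE ?eqxx ?mulr1n //; exact: cinv_dom.
apply: (@Csmooth_comp R m (m + 1) V (cimg d `&` cinv d @^-1` cdom d') row1
    (fun z => (d' \o cinv d) z 0 (rshift m (0 : 'I_1)))) => //.
- by apply: open_chart; exact: cdom_open.
- move=> z Vz; have [h e] := row1P z Vz; split => //.
  case: Vz => [cz [tz t'z]]; rewrite /preimage /= e dd' /preimage /= lproj_pt.
  by split => //; exact: cinv_dom.
- move=> j k; rewrite /row1; case: (splitP j) => i ji.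
    rewrite (_ : (fun z => _) = fun z : 'rV[R]_m => z 0 i); first exact: diff_iter_coord.
    apply/funext => z; rewrite -(row_mxEl z (1 : 'M[R]_1)).
    by congr (row_mx _ _ _ _); exact: val_inj.
  rewrite (_ : (fun z => _) = cst 1); first exact: diff_iter_cst.
  apply/funext => z; rewrite -[RHS](_ : (1 : 'M[R]_1) 0 i = 1).
    by rewrite -(row_mxEr z (1 : 'M[R]_1)); congr (row_mx _ _ _ _); exact: val_inj.
  by rewrite mxE ord1.
- exact: (atlas_compat ad ad').1.
Qed.

Section Frame.
Variables (tau : trivialization L) (ltau : ltriv tau).
Variables (k : Cinf M) (sk : supported (tdom tau) k).

Lemma frame_sect_smooth : smooth_section (fun x => k x *: tframe tau x).
Proof.
move=> tau' ltau'; apply: (@supported_smooth_on _ _ _ (tdom tau)).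
- exact: tdom_open.
- exact: tdom_open.
- have [K HK h] := sk; exists K => // p; apply: contraNP => nK.
  have -> : k p = 0 by apply/eqP; apply: contrapT => /negP/h.
  by rewrite scale0r linear0.
- have oW : open (tdom tau `&` tdom tau') by apply: openI; exact: tdom_open.
  apply: (@smooth_fun_ext _ _ _ _ (fun x => k x * tau' x (tframe tau x))) => //.
    by move=> x _; rewrite linearZ.
  apply: smooth_fun_mul => //; last exact: frame_smooth.
  exact: smooth_fun_subset (cinfP k).
Qed.

Definition frame_sect : sect L := Sect frame_sect_smooth.

Lemma coef_smooth (l : sect L) : smooth_fun_on setT (fun x => tau x (l x) * k x).
Proof.
apply: (supported_mul_smooth (@tdom_open _ _ _ _ tau) sk); exact: sectP.
Qed.

Definition coef (l : sect L) : Cinf M := CInf (coef_smooth l).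

Lemma coef_frame l x : coef l x *: frame_sect x = (k x * k x) *: l x.
Proof.
have [k0|k0] := eqVneq (k x) 0; first by rewrite /= k0 mulr0 mul0r !scale0r.
have tx := supported_in sk k0.
by rewrite /= -{2}(tframe_span tx (l x)) !scalerA; congr (_ *: _); ring.
Qed.

Lemma coef_lin a l l' x : coef (sect_lin a l l') x = a * coef l x + coef l' x.
Proof. by rewrite /= linearP mulrDl -mulrA. Qed.

Lemma coef_mul f l x : coef (sect_mul f l) x = f x * coef l x.
Proof. by rewrite /= linearZ -mulrA. Qed.
End Frame.

(** The factor [h] admits sections given by a quotient, such as the normalized sum in
    [connection_exists]. *)
Lemma smooth_section_local (l : forall x, L x) :
  (forall p, exists (l' : sect L) (h : Cinf M) (V : set M),
     [/\ open V, V p, h p != 0 & forall q, V q -> h q *: l q = l' q]) ->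
  smooth_section l.
Proof.
move=> H tau ltau; apply: smooth_fun_local => p tp.
have [l' [h [V [oV Vp h0 hl]]]] := H p.
pose W := (V `&` [set q | h q != 0]) `&` tdom tau.
have oW : open W.
  by apply: openI; [apply: openI => //; exact: cinf_open_neq0|exact: tdom_open].
exists W => //.
apply: (@smooth_fun_ext _ _ _ _ (fun q => (h q)^-1 * tau q (l' q))) => //.
  by move=> q [[Vq hq] _]; rewrite -hl // linearZ mulKf.
apply: smooth_fun_mul => //.
  apply: smooth_fun_inv => //; first by move=> q [[]].
  exact: smooth_fun_subset (cinfP h).
by apply: smooth_fun_subset (sectP l' ltau) => q [].
Qed.

Lemma sect_value (x : M) (v : L x) : exists l : sect L, l x = v.
Proof.
have [tau ltau tx] := ltriv_cover L x.
have [k sk kx] := cutoff_exists (@tdom_open _ _ _ _ tau) tx.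
exists (sect_lin (tau x v) (frame_sect ltau sk) (sect0 L)) => /=.
by rewrite kx scale1r addr0 tframe_span.
Qed.

Lemma line_form (x : M) : exists (phi : {linear L x -> R^o}) (e : L x),
  phi e = 1 /\ forall v, v = phi v *: e.
Proof.
have [tau ltau tx] := ltriv_cover L x; exists (tau x), (tframe tau x).
by split; [exact: tmap_frame|move=> v; rewrite tframe_span].
Qed.

Lemma line_ratio (x : M) (v w : L x) : w != 0 -> exists r : R, v = r *: w.
Proof.
have [phi [e [pe He]]] := line_form x => w0.
have pw : phi w != 0.
  by apply: contraNneq w0 => pw; rewrite (He w) pw scale0r.
exists (phi v / phi w); transitivity (phi v *: e); first exact: He.
by rewrite [X in _ = _ *: X]He scalerA divfK.
Qed.

Lemma sect_sum (J : finType) (F : J -> sect L) : exists S : sect L, forall x, S x = \sum_j F j x.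
Proof.
elim: (index_enum J) => [|j s [S HS]].
  by exists (sect0 L) => x; rewrite big_nil.
by exists (sect_lin 1 (F j) S) => x; rewrite big_cons /= scale1r HS.
Qed.

(** The Leibniz rule for a section that does not vanish at [x] recovers the symbol from the
    action. *)
Lemma atiyah_eq (x : M) (d e : atiyah L x) : (forall l, at_act d l = at_act e l) -> d = e.
Proof.
move=> H; have [phi [v [pv Hv]]] := line_form x; have [l lx] := sect_value v.
have E : symb d = symb e.
  apply: tangent_eq => f; have := H (sect_mul f l).
  rewrite !at_act_mul H lx => /addIr /(congr1 phi).
  by rewrite !linearZ pv /= ![_ *: _]mulr1.
apply: val_inj; move: H E; rewrite /at_act /symb /=.
by case: (atiyah_val d) (atiyah_val e) => [a b] [a' b'] /= /funext -> ->.
Qed.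

Lemma atiyahDZ (x : M) a (d e : atiyah L x) l :
  at_act (a *: d + e) l = a *: at_act d l + at_act e l.
Proof. by []. Qed.

(** A vanishing symbol makes [d] linear over functions. Comparing [k^2 l] with the coefficient of
    [l] times the cut-off frame, at [x] where k = 1, shows that only the value of [l] at [x]
    matters. *)
Lemma symb0_scalar (x : M) (d : atiyah L x) : symb d = 0 ->
  exists r : R, forall l, at_act d l = r *: l x.
Proof.
move=> d0; have [tau ltau tx] := ltriv_cover L x.
have [k sk kx] := cutoff_exists (@tdom_open _ _ _ _ tau) tx.
have dM f l : at_act d (sect_mul f l) = f x *: at_act d l.
  by rewrite at_act_mul d0 scale0r add0r.
exists (tau x (at_act d (frame_sect ltau sk))) => l.
have : at_act d (sect_mul (coef ltau sk l) (frame_sect ltau sk)) =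
       at_act d (sect_mul (cinf_mul k k) l).
  by congr (at_act d _); apply: sect_eq => y; exact: coef_frame.
rewrite !dM /= kx !mulr1 scale1r => <-.
rewrite -{1}(tframe_span tx (at_act d _)) -{2}(tframe_span tx (l x)) !scalerA.
by rewrite mulrC.
Qed.

End LineBundleSections.

(** * Locally finite families of cut-off frames, and the connection they define *)

Section Connections.
Variables (R : realType) (m : nat) (M : manifold R m) (L : line_bundle M).

(* Pairs (coframe, frame) made global by cutting off: [s] is the square of the cutoff. *)
Definition quasi_frame (c : sect L -> Cinf M) (e : sect L) (s : Cinf M) :=
  [/\ forall a l l' x, c (sect_lin a l l') x = a * c l x + c l' x,
      forall f l x, c (sect_mul f l) x = f x * c l x &
      forall l x, c l x *: e x = s x *: l x].

(** The cutoff is doubled so that its value at [p] lies strictly above the threshold 1 of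
    [head_cut]; being greater than 1 is an open condition. *)
Lemma quasi_frame_at (p : M) : exists t : (sect L -> Cinf M) * sect L * Cinf M,
  quasi_frame t.1.1 t.1.2 (cinf_mul t.2 t.2) /\ t.2 p = 2.
Proof.
have [tau ltau tx] := ltriv_cover L p.
have [k sk kx] := cutoff_exists (@tdom_open _ _ _ _ tau) tx.
have sk2 : supported (tdom tau) (cinf_lin 1 k k).
  have [K HK h] := sk; exists K => // q; apply: contraNP => nK /=.
  have -> : k q = 0 by apply/eqP; apply: contrapT => /negP/h.
  by rewrite mulr0 addr0.
exists (coef ltau sk2, frame_sect ltau sk2, cinf_lin 1 k k); split => /=; last first.
  by rewrite kx mulr1.
by split => *; [exact: coef_lin|exact: coef_mul|exact: coef_frame].
Qed.

(* Multiplying the n-th function of a family by head_cut k n kills it wherever an earlier k j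
   is at least 1; this makes a countable family locally finite without any compactness. *)
Fixpoint head_cut (k : nat -> Cinf M) (n : nat) : Cinf M :=
  if n is n'.+1 then cinf_mul (head_cut k n')
    (CInf (smooth_fun_flat openT (cinfP (cinf_lin (-1) (k n') (cinf_cst M 1)))))
  else cinf_cst M 1.

Lemma head_cut_eq0 (k : nat -> Cinf M) n j x : (j < n)%N -> 1 <= k j x -> head_cut k n x = 0.
Proof.
elim: n => // n IH; rewrite ltnS leq_eqVlt => /orP[/eqP ->|jn] h /=.
  by rewrite flat_le0 ?mulr0 //; lra.
by rewrite IH // mul0r.
Qed.

Lemma head_cut_gt0 (k : nat -> Cinf M) n x :
  (forall j, (j < n)%N -> k j x < 1) -> 0 < head_cut k n x.
Proof.
elim: n => [|n IH] h /=; first by rewrite ltr01.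
apply: mulr_gt0; first by apply: IH => j jn; apply: h; exact: ltnW.
by apply: flat_gt0; have := h n (ltnSn n); lra.
Qed.

(** At q the least index with [1 <= t k q] is not killed by [head_cut], which gives positivity;
    where [1 < t k], all members with index greater than k vanish, which gives local finiteness. *)
Lemma quasi_frames : exists (c : nat -> sect L -> Cinf M) (e : nat -> sect L)
    (s : nat -> Cinf M), [/\ forall k, quasi_frame (c k) (e k) (s k),
  forall k x, 0 <= s k x, forall q, exists k, 0 < s k q &
  forall q, exists V N, [/\ open V, V q &
    forall k x, (N <= k)%N -> V x -> s k x = 0 /\ e k x = 0]].
Proof.
have /choice[D HD] := quasi_frame_at.
have [pt Hpt] : exists pt : nat -> option M, forall q, exists k p, pt k = Some p /\ 1 < (D p).2 q.
  apply: (@countable_cover _ _ M (fun p => [set q | 1 < (D p).2 q])) => p.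
  by split; [exact: cinf_open_gt|rewrite /= (HD p).2 ltr1n].
pose c k : sect L -> Cinf M := if pt k is Some p then (D p).1.1 else fun=> cinf_cst M 0.
pose e k : sect L := if pt k is Some p then (D p).1.2 else sect0 L.
pose t k : Cinf M := if pt k is Some p then (D p).2 else cinf_cst M 0.
have Q k : quasi_frame (c k) (e k) (cinf_mul (t k) (t k)).
  rewrite /c /e /t; case: (pt k) => [p|]; first by case: (HD p).
  by split => [a l l' x|f l x|l x] /=; rewrite ?mulr0 ?addr0 ?scale0r.
have T q : exists k, 1 < t k q.
  by have [k [p [ok h]]] := Hpt q; exists k; rewrite /t ok.
pose w k := head_cut t k.
exists (fun k l => cinf_mul (w k) (c k l)), (fun k => sect_mul (w k) (e k)),
  (fun k => cinf_mul (cinf_mul (w k) (t k)) (cinf_mul (w k) (t k))); split.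
- move=> k; have [Q1 Q2 Q3] := Q k; split => [a l l' x|f l x|l x] /=.
  + by rewrite Q1; ring.
  + by rewrite Q2; ring.
  + have -> : (w k x * c k l x) *: (w k x *: e k x) = (w k x * w k x) *: (c k l x *: e k x).
      by rewrite !scalerA; congr (_ *: _); ring.
    rewrite Q3 scalerA /=.
    by congr (_ *: _); ring.
- by move=> k x /=; rewrite -expr2 sqr_ge0.
- move=> q; have [k0 k0q] := T q.
  have ex : exists k, 1 <= t k q by exists k0; exact: ltW.
  case: (ex_minnP ex) => k kq kmin; exists k; rewrite /= -expr2 exprn_even_gt0 //=.
  apply: mulf_neq0; last by rewrite gt_eqF // (lt_le_trans ltr01).
  rewrite gt_eqF //; apply: head_cut_gt0 => j jk; rewrite ltNge; apply: contraL jk => h.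
  by rewrite -leqNgt; exact: kmin.
- move=> q; have [k kq] := T q.
  exists [set x | 1 < t k x], k.+1; split => //; first exact: cinf_open_gt.
  move=> j x kj /= /ltW h.
  by rewrite /w (head_cut_eq0 kj h) !mul0r scale0r.
Qed.

Lemma sum_trunc (V : nmodType) (a : nat -> V) N N' : (forall k, (N <= k)%N -> a k = 0) ->
  (forall k, (N' <= k)%N -> a k = 0) -> \sum_(k < N) a k = \sum_(k < N') a k.
Proof.
wlog NN : N N' / (N <= N')%N => [H|] h h'.
  by case: (leqP N N') => [/H|/ltnW/H ->]; first apply.
rewrite -!(big_mkord xpredT) [RHS](big_cat_nat (leq0n N) NN) /=.
rewrite [X in _ = _ + X]big_nat_cond [X in _ = _ + X]big1 ?addr0 //.
by move=> k; rewrite andbT => /andP[/h].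
Qed.

(* The connection induced by embedding L in a trivial bundle of locally finite rank. *)
Lemma connection_exists : inhabited (connection L).
Proof.
have [c [e [s [Q s0 spos fin]]]] := quasi_frames.
have /choice[N HN] : forall q, exists n : nat, forall k, (n <= k)%N -> s k q = 0 /\ e k q = 0.
  by move=> q; have [V [n [_ Vq h]]] := fin q; exists n => k nk; exact: h.
pose S (x : M) : R := \sum_(k < N x) s k x.
have S_pos x : 0 < S x.
  have [k kx] := spos x; have kN : (k < N x)%N.
    by rewrite ltnNge; apply/negP => /(HN x) [sk _]; rewrite sk ltxx in kx.
  rewrite /S (bigD1 (Ordinal kN)) //=; apply: ltr_wpDr => //.
  by apply: sumr_ge0 => j _; exact: s0.
pose na (x : M) (v : tangent x) (l : sect L) : L x :=
  (S x)^-1 *: \sum_(k < N x) v (c k l) *: e k x.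
have na_at x (v : tangent x) : (na x v, v) \in @atiyah_pred _ _ _ L x.
  apply/asboolP; split => [a l l'|f l] /=; rewrite /na.
    rewrite scalerA [a * _]mulrC -scalerA -scalerDr; congr (_ *: _).
    rewrite scaler_sumr -big_split /=; apply: eq_bigr => k _; have [Q1 _ _] := Q k.
    rewrite (tangent_eqf v (g := cinf_lin a (c k l) (c k l'))) ?tangent_lin.
      by rewrite scalerDl scalerA.
    by move=> y; exact: Q1.
  rewrite scalerA [f x * _]mulrC -scalerA.
  have -> : v f *: l x = (S x)^-1 *: (\sum_(k < N x) (v f * s k x) *: l x).
    by rewrite -scaler_suml -mulr_sumr scalerA mulrCA mulVf ?mulr1 // gt_eqF.
  rewrite -scalerDr; congr (_ *: _); rewrite scaler_sumr -big_split /=; apply: eq_bigr => k _.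
  have [_ Q2 Q3] := Q k.
  rewrite (tangent_eqf v (g := cinf_mul f (c k l))) ?tangent_mul.
    by rewrite scalerDl [RHS]addrC -!scalerA -Q3 !scalerA [v f * _]mulrC.
  by move=> y; exact: Q2.
pose nab x v := Atiyah (na_at x v).
have nab_lin x : linear (nab x).
  move=> a v w; apply: atiyah_eq => l.
  rewrite atiyahDZ /nab /at_act /= /na scalerA [a * _]mulrC -scalerA -scalerDr.
  congr (_ *: _); rewrite scaler_sumr -big_split; apply: eq_bigr => k _ /=.
  by rewrite -[LHS]/((a * v (c k l) + w (c k l)) *: e k x) scalerDl scalerA.
pose NL x : {linear tangent x -> atiyah L x} :=
  HB.pack (nab x) (GRing.isLinear.Build _ _ _ _ (nab x) (nab_lin x)).
have sm (X : vfield M) (l : sect L) : smooth_section (fun x => at_act (NL x (X x)) l).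
  (* The truncation [N x] varies with x in no controlled way; near [p] the fixed bound [n] gives the
     same sums, and multiplication by [S] removes the quotient. *)
  apply: smooth_section_local => p.
  have [V [n [oV Vp h]]] := fin p.
  have [T HT] := sect_sum (fun k : 'I_n => sect_mul (vf_act X (c k l)) (e k)).
  have sS : smooth_fun_on setT (fun x => \sum_(k < n) s k x).
    by apply: smooth_fun_sum => [|k]; [exact: openT|exact: cinfP].
  have SE q : V q -> S q = \sum_(k < n) s k q.
    move=> Vq; apply: (sum_trunc (a := fun k => s k q)) => k nk.
      by have [] := HN q k nk.
    by have [] := h k q nk Vq.
  exists T, (CInf sS), V; split => //=.
    by rewrite -SE // gt_eqF.
  move=> q Vq; rewrite -SE // HT /at_act /= /na scalerA divff ?gt_eqF // scale1r.
  apply: (sum_trunc (a := fun k => X q (c k l) *: e k q)) => k nk.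
    by have [_ ->] := HN q k nk; rewrite scaler0.
  by have [_ ->] := h k q nk Vq; rewrite scaler0.
by split; exact: (@Connection _ _ _ L NL (fun x v => erefl) sm).
Qed.

Lemma at_one_subproof (x : M) : ((fun l : sect L => l x), 0 : tangent x) \in @atiyah_pred _ _ _ L x.
Proof. by apply/asboolP; split => [a l l'|f l] //=; rewrite scale0r add0r. Qed.

Definition at_one (x : M) : atiyah L x := Atiyah (at_one_subproof x).

Lemma symb_one x : symb (at_one x) = 0. Proof. by []. Qed.

Lemma fnablaP (na : connection L) x (d : atiyah L x) :
  d = na x (symb d) + fnabla na d *: at_one x.
Proof.
have [r Hr] : exists r : R, forall l, at_act (d - na x (symb d)) l = r *: l x.
  by apply: symb0_scalar; rewrite linearB /= nabla_symb subrr.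
have Hr' l : at_act d l - at_act (na x (symb d)) l = r *: l x by exact: Hr.
have := @xgetPex _ 0 [set r : R | forall l : sect L,
    at_act d l - at_act (na x (symb d)) l = r *: l x] (ex_intro _ r Hr').
rewrite -/(fnabla na d) /= => H; apply: atiyah_eq => l.
by rewrite addrC atiyahDZ -H subrK.
Qed.

Lemma symb_nabla_one (na : connection L) x (v : tangent x) r :
  symb (na x v + r *: at_one x) = v.
Proof. by rewrite linearD linearZ /= nabla_symb symb_one scaler0 addr0. Qed.

Lemma fnabla_uniq (na : connection L) x (v : tangent x) r :
  fnabla na (na x v + r *: at_one x) = r.
Proof.
have := fnablaP na (na x v + r *: at_one x).
rewrite symb_nabla_one => /addrI H.
have [phi [u [pu _]]] := line_form L x; have [l lx] := sect_value u.
have := congr1 (fun d => phi (at_act d l)) H.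
by rewrite -![at_act (_ *: at_one x) l]/(_ *: l x) !linearZ /= lx pu ![_ *: _]mulr1 => <-.
Qed.

Lemma nabla_der_smooth (na : connection L) (X : vfield M) r l :
  smooth_section (fun x => at_act (na x (X x) + r *: at_one x) l).
Proof.
have -> : (fun x => at_act (na x (X x) + r *: at_one x) l) =
    sect_lin r l (Sect (nabla_smooth na X l)).
  by apply: functional_extensionality_dep => x /=; rewrite [RHS]addrC.
exact: sectP.
Qed.

(** The constant multiple of the identity lets these derivations take every value at a given point,
    as [atiyah_extend] uses. *)
Definition nabla_der (na : connection L) (X : vfield M) (r : R) : derivation L :=
  @Derivation _ _ _ L _ (nabla_der_smooth na X r)
    (fun f => eq_ind_r (fun g => smooth_fun_on setT g) (vfieldP X f)
      (funext (fun x => congr1 (fun v : tangent x => v f) (symb_nabla_one na (X x) r)))).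

Definition one_der : derivation L :=
  @Derivation _ _ _ L at_one (fun l => sectP l) (fun f => @smooth_fun_cst _ _ M setT 0).

Lemma atiyah_extend (x : M) (d : atiyah L x) : exists D : derivation L, D x = d.
Proof.
have [na] := connection_exists.
have [X Xx] := tangent_extend (symb d).
by exists (nabla_der na X (fnabla na d)); rewrite /= Xx -fnablaP.
Qed.

End Connections.

(** * The differential of Atiyah forms *)

(** Identities in a line reduce to scalar ones. The linearity of [phi] is handed over as rewriting
    rules for a plain function into [R], so that [ring] can conclude in [line_ring]. *)
Lemma line_inj (R : realType) (m : nat) (M : manifold R m) (L : line_bundle M) x (u v : L x) :
  (forall phi : L x -> R, (forall u v, phi (u + v) = phi u + phi v) ->
    (forall u, phi (- u) = - phi u) -> (forall a u, phi (a *: u) = a * phi u) ->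
    phi 0 = 0 -> phi u = phi v) -> u = v.
Proof.
have [phi [e [_ He]]] := line_form L x => H; rewrite (He u) (H phi) -?He //.
- exact: linearD.
- exact: linearN.
- by move=> a w; rewrite linearZ.
- exact: linear0.
Qed.

Ltac line_ring := apply: line_inj;
  let phi := fresh "phi" in let pD := fresh "pD" in let pN := fresh "pN" in
  let pZ := fresh "pZ" in let p0 := fresh "p0" in
  intros phi pD pN pZ p0; rewrite ?(pD, pN, pZ, p0); ring.

Section Forms.
Variables (R : realType) (m : nat) (M : manifold R m) (L : line_bundle M).
Implicit Types (x y p : M) (na : connection L) (theta : form1 L) (omega : aform2 L).

Lemma vfield_eq (X Y : vfield M) : (forall x, X x = Y x) -> X = Y.
Proof.
case: X Y => [X hX] [Y hY] /= XY.
have {}XY : X = Y by exact: functional_extensionality_dep.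
by rewrite XY in hX *; congr VField; exact: Prop_irrelevance.
Qed.

Lemma aform2_eq omega omega' :
  (forall x d e, omega x d e = omega' x d e) -> omega = omega'.
Proof.
case: omega omega' => [w1 a1 b1 c1 d1] [w2 a2 b2 c2 d2] /= H.
have E : w1 = w2.
  apply: functional_extensionality_dep => x; apply/funext => d; apply/funext => e; exact: H.
by rewrite E in a1 b1 c1 d1 *; congr AForm2; exact: Prop_irrelevance.
Qed.

Lemma form1_eq theta theta' : (forall x v, theta x v = theta' x v) -> theta = theta'.
Proof.
case: theta theta' => [t1 h1] [t2 h2] /= H.
have E : t1 = t2.
  apply: functional_extensionality_dep => x; have /funext := H x.
  case: (t1 x) (t2 x) => [f [[f1] [f2]]] [g [[g1] [g2]]] /= fg; rewrite fg in f1 f2 *.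
  by rewrite (Prop_irrelevance f1 g1) (Prop_irrelevance f2 g2).
by rewrite E in h1 *; congr Form1; exact: Prop_irrelevance.
Qed.

Lemma at_act_sum x (d : atiyah L x) (J : finType) (F : J -> sect L) (S : sect L) :
  (forall y, S y = \sum_j F j y) -> at_act d S = \sum_j at_act d (F j).
Proof.
elim: (index_enum J) S => [|j s IH] S SE.
  rewrite big_nil; have -> : S = sect_lin (-1) S S.
    by apply: sect_eq => y; rewrite /= SE big_nil scaler0 addr0.
  by rewrite at_act_lin scaleN1r addNr.
rewrite big_cons -(IH (sect_lin (-1) (F j) S)).
  by rewrite at_act_lin scaleN1r addNKr.
by move=> y /=; rewrite SE big_cons scaleN1r addKr.
Qed.

(* [Th = h^-1 sum_j df_j (x) mu_j] wherever h does not vanish. *)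
Definition decomposes (Th : forall x, tangent x -> L x) (h : Cinf M) (J : finType)
    (f : J -> Cinf M) (mu : J -> sect L) :=
  forall y (v : tangent y), h y *: Th y v = \sum_j v (f j) *: mu j y.

(* The value of d_D sigma^* Th on (d, e) computed from such a decomposition, at a point where
   h = 1: the Leibniz rule applied to h Th = sum_j df_j (x) mu_j. *)
Definition ddec (h : Cinf M) (J : finType) (f : J -> Cinf M) (mu : J -> sect L) x
    (th : tangent x -> L x) (d e : atiyah L x) : L x :=
  \sum_j (symb e (f j) *: at_act d (mu j) - symb d (f j) *: at_act e (mu j))
  - (symb d h *: th (symb e) - symb e h *: th (symb d)).

Lemma form1_decomposes theta x : exists (h : Cinf M) (J : finType) (f : J -> Cinf M)
  (mu : J -> sect L), h x = 1 /\ decomposes (fun y v => theta y v) h f mu.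
Proof.
have [h hx [J [f [Z hZ]]]] := local_frame x.
exists h, J, f, (fun j => form1_eval theta (Z j)); split => // y v.
rewrite -[LHS]linearZ hZ linear_sum; apply: eq_bigr => j _; exact: linearZ.
Qed.

(** [Th] is a bare family of maps, so that pull-backs of forms are included; the product of [h] with
    its value on a field is a section because it is a finite sum of sections. *)
Lemma decomposes_sect Th h (J : finType) (f : J -> Cinf M) mu (X : vfield M) :
  decomposes Th h f mu ->
  exists2 S : sect L, (forall y, S y = h y *: Th y (X y)) &
    forall x (d : atiyah L x), at_act d S =
      \sum_j (symb d (vf_act X (f j)) *: mu j x + X x (f j) *: at_act d (mu j)).
Proof.
move=> H; have [S HS] := sect_sum (fun j => sect_mul (vf_act X (f j)) (mu j)).
exists S => [y|x d]; first by rewrite HS H.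
by rewrite (at_act_sum d HS); apply: eq_bigr => j _; rewrite at_act_mul.
Qed.

(** Both sides are the derivative of the local section S/h = S'/h', by the quotient rule at a point
    where both denominators are 1. *)
Lemma sect_twist x (d : atiyah L x) (h h' : Cinf M) (S S' : sect L) :
  h x = 1 -> h' x = 1 -> (forall y, h' y *: S y = h y *: S' y) ->
  at_act d S - symb d h *: S x = at_act d S' - symb d h' *: S' x.
Proof.
move=> hx h'x E; have Ex : S x = S' x by have := E x; rewrite hx h'x !scale1r.
have : at_act d (sect_mul h' S) = at_act d (sect_mul h S') by congr at_act; exact: sect_eq.
rewrite !at_act_mul hx h'x !scale1r Ex => H.
by apply/eqP; rewrite subr_eq addrAC [at_act d S' + _]addrC -H [_ - _]addrC addKr.
Qed.

(** The right-hand side is the Koszul formula for [Th], each derivative of [Th] on a field being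
    computed from [h Th] by the quotient rule. *)
Lemma ddec_der Th h (J : finType) (f : J -> Cinf M) mu (D1 D2 : derivation L) x
    (S1 S2 : sect L) :
  decomposes Th h f mu -> h x = 1 ->
  (forall y, S1 y = h y *: Th y (symb (D1 y))) ->
  (forall y, S2 y = h y *: Th y (symb (D2 y))) ->
  ddec h f mu (Th x) (D1 x) (D2 x) =
    (at_act (D1 x) S2 - symb (D1 x) h *: S2 x) - (at_act (D2 x) S1 - symb (D2 x) h *: S1 x)
    - Th x (symb (der_bracket D1 D2 x)).
Proof.
move=> H hx E1 E2.
have [S1' E1' A1] := decomposes_sect (der_symb D1) H.
have [S2' E2' A2] := decomposes_sect (der_symb D2) H.
have -> : S1 = S1' by apply: sect_eq => y; rewrite E1 E1'.
have -> : S2 = S2' by apply: sect_eq => y; rewrite E2 E2'.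
rewrite A1 A2 E1' E2' hx !scale1r /=.
have -> : Th x (symb (der_bracket D1 D2 x)) =
    \sum_j (symb (D1 x) (vf_act (der_symb D2) (f j)) - symb (D2 x) (vf_act (der_symb D1) (f j)))
       *: mu j x.
  by rewrite -[LHS]scale1r -hx H.
have -> : ddec h f mu (Th x) (D1 x) (D2 x) =
    \sum_j (symb (D1 x) (vf_act (der_symb D2) (f j)) *: mu j x +
        symb (D2 x) (f j) *: at_act (D1 x) (mu j)) -
    \sum_j (symb (D2 x) (vf_act (der_symb D1) (f j)) *: mu j x +
        symb (D1 x) (f j) *: at_act (D2 x) (mu j)) -
    \sum_j (symb (D1 x) (vf_act (der_symb D2) (f j)) - symb (D2 x) (vf_act (der_symb D1) (f j)))
       *: mu j x - (symb (D1 x) h *: Th x (symb (D2 x)) - symb (D2 x) h *: Th x (symb (D1 x))).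
  rewrite /ddec -!sumrB; congr (_ - _); apply: eq_bigr => j _.
  line_ring.
line_ring.
Qed.

(** After extension of [d] and [e] to derivations, [f] and [mu] disappear by [ddec_der] and the
    choice of [h] by [sect_twist]. It serves to compare the pull-backs of a form along source and
    target, which come with unrelated decompositions. *)
Lemma ddec_indep Th Th' h h' (J J' : finType) (f : J -> Cinf M) (f' : J' -> Cinf M) mu mu' x
    (d e : atiyah L x) :
  (forall y v, Th y v = Th' y v) -> decomposes Th h f mu -> decomposes Th' h' f' mu' ->
  h x = 1 -> h' x = 1 -> ddec h f mu (Th x) d e = ddec h' f' mu' (Th' x) d e.
Proof.
move=> TT H H' hx h'x.
have [D1 <-] := atiyah_extend d; have [D2 <-] := atiyah_extend e.
have [S1 E1 _] := decomposes_sect (der_symb D1) H.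
have [S2 E2 _] := decomposes_sect (der_symb D2) H.
have [S1' E1' _] := decomposes_sect (der_symb D1) H'.
have [S2' E2' _] := decomposes_sect (der_symb D2) H'.
rewrite (ddec_der H hx E1 E2) (ddec_der H' h'x E1' E2') TT.
congr (_ - _ - _); apply: sect_twist => // y; rewrite ?E1 ?E2 ?E1' ?E2' !TT !scalerA.
  by rewrite mulrC.
by rewrite mulrC.
Qed.

Lemma symb_cst x (d : atiyah L x) a : symb d (cinf_cst M a) = 0.
Proof. exact: tangent_cst. Qed.

Lemma ddec_koszul theta h (J : finType) (f : J -> Cinf M) mu (D1 D2 : derivation L) x :
  decomposes (fun y v => theta y v) h f mu -> h x = 1 ->
  ddec h f mu (theta x) (D1 x) (D2 x) = koszul1 (sigma_pull theta) D1 D2 x.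
Proof.
move=> H hx.
have [S1 E1 _] := decomposes_sect (der_symb D1) H.
have [S2 E2 _] := decomposes_sect (der_symb D2) H.
rewrite (ddec_der H hx E1 E2) /koszul1; congr (_ - _ - _).
  rewrite (@sect_twist _ _ h (cinf_cst M 1) _ (aform1_eval (sigma_pull theta) D2)) //.
    by rewrite symb_cst scale0r subr0.
  by move=> y; rewrite E2 /= scale1r.
rewrite (@sect_twist _ _ h (cinf_cst M 1) _ (aform1_eval (sigma_pull theta) D1)) //.
  by rewrite symb_cst scale0r subr0.
by move=> y; rewrite E1 /= scale1r.
Qed.

Definition koszul1_sect (eta : aform1 L) (D1 D2 : derivation L) : sect L :=
  sect_lin (-1) (aform1_eval eta (der_bracket D1 D2))
    (sect_lin (-1) (der_act D2 (aform1_eval eta D1)) (der_act D1 (aform1_eval eta D2))).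

Lemma koszul1_sectE eta D1 D2 x : koszul1_sect eta D1 D2 x = koszul1 eta D1 D2 x.
Proof. by rewrite /koszul1 /= !scaleN1r addrC [- _ + _]addrC. Qed.

Lemma symbDZ x a (d e : atiyah L x) f : symb (a *: d + e) f = a * symb d f + symb e f.
Proof. by []. Qed.

Lemma ddec_linear_l h (J : finType) (f : J -> Cinf M) mu x (th : {linear tangent x -> L x}) e :
  linear (fun d => ddec h f mu th d e).
Proof.
move=> a d d'; rewrite /ddec.
have -> : th (symb (a *: d + d')) = a *: th (symb d) + th (symb d') by rewrite !linearP.
rewrite (eq_bigr (fun j =>
  a *: (symb e (f j) *: at_act d (mu j) - symb d (f j) *: at_act e (mu j)) +
  (symb e (f j) *: at_act d' (mu j) - symb d' (f j) *: at_act e (mu j)))); last first.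
  by move=> j _; rewrite atiyahDZ symbDZ; line_ring.
by rewrite symbDZ big_split -scaler_sumr; line_ring.
Qed.

Lemma ddec_antisym h (J : finType) (f : J -> Cinf M) mu x (th : tangent x -> L x) d e :
  ddec h f mu th d e = - ddec h f mu th e d.
Proof.
rewrite /ddec [RHS]opprD -sumrN; congr (_ + _); last by line_ring.
by apply: eq_bigr => j _; line_ring.
Qed.

Lemma ddec_linear_r h (J : finType) (f : J -> Cinf M) mu x (th : {linear tangent x -> L x}) d :
  linear (ddec h f mu th d).
Proof.
move=> a e e'; rewrite ddec_antisym ddec_linear_l.
rewrite [ddec _ _ _ _ d e]ddec_antisym [ddec _ _ _ _ d e']ddec_antisym; line_ring.
Qed.

Lemma ddec_alt h (J : finType) (f : J -> Cinf M) mu x (th : tangent x -> L x) d :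
  ddec h f mu th d d = 0.
Proof. by rewrite /ddec subrr subr0 big1 // => j _; rewrite subrr. Qed.

(** The default of [xget] is excluded by a form built from [ddec], with a decomposition chosen at
    each point: bilinearity is clear from [ddec], and smoothness from the Koszul side. *)
Lemma dD_koszul theta (D1 D2 : derivation L) x :
  dD (sigma_pull theta) x (D1 x) (D2 x) = koszul1 (sigma_pull theta) D1 D2 x.
Proof.
suff [w Hw] : exists w : aform2 L, forall (D1 D2 : derivation L) x,
    w x (D1 x) (D2 x) = koszul1 (sigma_pull theta) D1 D2 x.
  have := @xgetPex {classic aform2 L} (aform2_0 L : {classic aform2 L})
    [set w : {classic aform2 L} | forall (D1 D2 : derivation L) x,
      w x (D1 x) (D2 x) = koszul1 (sigma_pull theta) D1 D2 x] (ex_intro _ w Hw).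
  exact.
clear D1 D2 x.
pose P x (w : atiyah L x -> atiyah L x -> L x) := exists (h : Cinf M) (J : finType)
  (f : J -> Cinf M) (mu : J -> sect L), [/\ h x = 1,
    decomposes (fun y v => theta y v) h f mu & w = ddec h f mu (theta x)].
have Pex x : exists w, P x w.
  have [h [J [f [mu [hx H]]]]] := form1_decomposes theta x.
  by exists (ddec h f mu (theta x)), h, J, f, mu.
pose w x := projT1 (cid (Pex x)).
have wP x : P x (w x) := projT2 (cid (Pex x)).
have wK (D1 D2 : derivation L) x : w x (D1 x) (D2 x) = koszul1 (sigma_pull theta) D1 D2 x.
  by have [h [J [f [mu [hx H ->]]]]] := wP x; exact: ddec_koszul.
have wl x e : linear (fun d => w x d e).
  by have [h [J [f [mu [_ _ ->]]]]] := wP x; exact: ddec_linear_l.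
have wr x d : linear (w x d).
  by have [h [J [f [mu [_ _ ->]]]]] := wP x; exact: ddec_linear_r.
have wa x d : w x d d = 0.
  by have [h [J [f [mu [_ _ ->]]]]] := wP x; exact: ddec_alt.
have ws (D1 D2 : derivation L) : smooth_section (fun x => w x (D1 x) (D2 x)).
  have -> : (fun x => w x (D1 x) (D2 x)) = koszul1_sect (sigma_pull theta) D1 D2.
    by apply: functional_extensionality_dep => x; rewrite koszul1_sectE.
  exact: sectP.
by exists (AForm2 wl wr wa ws).
Qed.

Lemma dD_ddec theta h (J : finType) (f : J -> Cinf M) mu x d e :
  decomposes (fun y v => theta y v) h f mu -> h x = 1 ->
  dD (sigma_pull theta) x d e = ddec h f mu (theta x) d e.
Proof.
move=> H hx; have [D1 <-] := atiyah_extend d; have [D2 <-] := atiyah_extend e.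
by rewrite dD_koszul (ddec_koszul _ _ H hx).
Qed.

(** The identity has symbol 0, so of [ddec] only the sum of [df_j] times [mu_j] remains. This
    recovers [theta] from its differential. *)
Lemma dD_one theta x (e : atiyah L x) :
  dD (sigma_pull theta) x (at_one L x) e = theta x (symb e).
Proof.
have [h [J [f [mu [hx H]]]]] := form1_decomposes theta x.
have z g : symb (at_one L x) g = 0 by [].
rewrite (dD_ddec _ _ H hx) /ddec z symb_one linear0 scaler0 scale0r !subr0.
rewrite -[RHS]scale1r -hx H; apply: eq_bigr => j _.
by rewrite z scale0r subr0.
Qed.

Lemma aform2_0r omega x d : omega x d 0 = 0.
Proof.
have := aform2_linr omega d (-1) 0 0.
by rewrite scaler0 addr0 scaleN1r addNr.
Qed.

Lemma aform2_0l omega x d : omega x 0 d = 0.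
Proof.
have := aform2_linl omega d (-1) 0 0.
by rewrite scaler0 addr0 scaleN1r addNr.
Qed.

Lemma aform2_Zr omega x d a e : omega x d (a *: e) = a *: omega x d e.
Proof. by have := aform2_linr omega d a e 0; rewrite !addr0 aform2_0r addr0. Qed.

Lemma aform2_Zl omega x d a e : omega x (a *: e) d = a *: omega x e d.
Proof. by have := aform2_linl omega d a e 0; rewrite !addr0 aform2_0l addr0. Qed.

Lemma aform2_Dr omega x d e e' : omega x d (e + e') = omega x d e + omega x d e'.
Proof. by have := aform2_linr omega d 1 e e'; rewrite !scale1r. Qed.

Lemma aform2_Dl omega x d e e' : omega x (e + e') d = omega x e d + omega x e' d.
Proof. by have := aform2_linl omega d 1 e e'; rewrite !scale1r. Qed.

Lemma aform2_antisym omega x d e : omega x d e = - omega x e d.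
Proof.
apply/eqP; rewrite -addr_eq0; apply/eqP.
have := aform2_alt omega (d + e).
by rewrite aform2_Dl !aform2_Dr !aform2_alt addr0 add0r.
Qed.

Lemma der_symb_nabla na X r : der_symb (nabla_der na X r) = X.
Proof. by apply: vfield_eq => x; exact: symb_nabla_one. Qed.

(** The restriction of [dD] to horizontal lifts satisfies the formula that specifies [dnabla], so it
    both proves existence and identifies the result. *)
Lemma dnablaE na theta x (v w : tangent x) :
  dnabla na theta x v w = dD (sigma_pull theta) x (na x v) (na x w).
Proof.
pose om := dD (sigma_pull theta).
pose t y (v w : tangent y) := om y (na y v) (na y w).
have tl y w' : linear (fun v => t y v w') by move=> a v1 v2; rewrite /t linearP aform2_linl.
have tr y v' : linear (t y v') by move=> a v1 v2; rewrite /t linearP aform2_linr.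
have ta y v' : t y v' v' = 0 by exact: aform2_alt.
have ts (X Y : vfield M) : smooth_section (fun y => t y (X y) (Y y)).
  have -> : (fun y => t y (X y) (Y y)) =
      aform2_eval om (nabla_der na X 0) (nabla_der na Y 0).
    by apply: functional_extensionality_dep => y /=; rewrite !scale0r !addr0.
  exact: sectP.
have tP (X Y : vfield M) y : t y (X y) (Y y) =
    at_act (na y (X y)) (form1_eval theta Y) - at_act (na y (Y y)) (form1_eval theta X)
    - theta y (vf_bracket X Y y).
  have N Z : nabla_der na Z 0 y = na y (Z y) by rewrite /= scale0r addr0.
  have -> : t y (X y) (Y y) = om y (nabla_der na X 0 y) (nabla_der na Y 0 y) by rewrite !N.
  have E Z : aform1_eval (sigma_pull theta) (nabla_der na Z 0) = form1_eval theta Z.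
    by apply: sect_eq => z /=; rewrite symb_nabla_one.
  rewrite dD_koszul /koszul1 !E !N.
  rewrite -[sigma_pull _ y _]/(theta y (vf_bracket (der_symb (nabla_der na X 0))
    (der_symb (nabla_der na Y 0)) y)).
  by rewrite !der_symb_nabla.
have [X Xx] := tangent_extend v; have [Y Yx] := tangent_extend w.
have := @xgetPex {classic form2 L} (form2_0 L : {classic form2 L})
  [set tau : {classic form2 L} | forall (X Y : vfield M) x, tau x (X x) (Y x) =
      at_act (na x (X x)) (form1_eval theta Y) - at_act (na x (Y x)) (form1_eval theta X)
      - theta x (vf_bracket X Y x)] (ex_intro _ (Form2 tl tr ta ts) tP).
rewrite /= => H.
by rewrite -Xx -Yx [LHS]H -tP.
Qed.

(* [omega = f_nabla /\ theta + d^nabla theta] in the splitting [DL = TM + R] given by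
   [nabla]. *)
Lemma dD_split na theta x (d e : atiyah L x) : dD (sigma_pull theta) x d e =
  fnabla na d *: theta x (symb e) - fnabla na e *: theta x (symb d)
  + dnabla na theta x (symb d) (symb e).
Proof.
rewrite dnablaE {1}(fnablaP na d) {1}(fnablaP na e).
rewrite aform2_Dl !aform2_Dr !aform2_Zl !aform2_Zr aform2_alt.
rewrite [dD _ x (na _ _) (at_one _ _)]aform2_antisym !dD_one /= !nabla_symb; line_ring.
Qed.

Lemma one_bracket (D : derivation L) x : der_bracket (one_der L) D x = 0.
Proof.
apply: atiyah_eq => l; rewrite [at_act 0 l](_ : _ = 0) //.
rewrite [LHS]der_bracket_act /= scaleN1r.
have -> : der_act (one_der L) l = l by exact: sect_eq.
by rewrite addNr.
Qed.

(* Cartan's formula: contraction with the identity derivation is a contracting homotopy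
   of the Atiyah complex. *)
Lemma dD_closed_exact na omega : dD_closed omega ->
  exists theta, dD (sigma_pull theta) = omega.
Proof.
move=> cl.
have lin x : linear (fun v => omega x (at_one L x) (na x v)).
  by move=> a v w; rewrite linearP aform2_linr.
pose th x : {linear tangent x -> L x} :=
  HB.pack (fun v => omega x (at_one L x) (na x v)) (GRing.isLinear.Build _ _ _ _ _ (lin x)).
have sm (X : vfield M) : smooth_section (fun x => th x (X x)).
  have -> : (fun x => th x (X x)) = aform2_eval omega (one_der L) (nabla_der na X 0).
    by apply: functional_extensionality_dep => x /=; rewrite scale0r addr0.
  exact: sectP.
pose theta := Form1 sm; exists theta.
have O x (e : atiyah L x) : theta x (symb e) = omega x (at_one L x) e.
  by rewrite /= [in RHS](fnablaP na e) aform2_Dr aform2_Zr aform2_alt scaler0 addr0.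
apply: aform2_eq => x d e.
have [D1 <-] := atiyah_extend d; have [D2 <-] := atiyah_extend e.
(* The identity acts trivially and its brackets vanish, so closedness on (1, [D1], [D2]) says that
   [omega] is the Koszul expression of its own contraction with 1. *)
rewrite dD_koszul; have := cl (one_der L) D1 D2 x.
rewrite /koszul2 !one_bracket !aform2_0l subr0 addr0.
rewrite [omega x _ (one_der L x)]aform2_antisym opprK.
have E D : aform1_eval (sigma_pull theta) D = aform2_eval omega (one_der L) D.
  by apply: sect_eq => y; exact: O.
rewrite /koszul1 !E [sigma_pull _ x _]O.
move=> H; apply/eqP; rewrite -subr_eq0; apply/eqP; rewrite -[RHS]oppr0 -H.
by rewrite -[at_act (one_der L x) _]/(omega x (D1 x) (D2 x)); line_ring.
Qed.

(** The iterated actions cancel by the definition of the bracket; the remaining values of [theta]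
    cancel by the Jacobi identity [J], which is checked on sections. *)
Lemma dD_closed_dD theta : dD_closed (dD (sigma_pull theta)).
Proof.
move=> D1 D2 D3 x; rewrite /koszul2 !dD_koszul.
have E D D' : aform2_eval (dD (sigma_pull theta)) D D' = koszul1_sect (sigma_pull theta) D D'.
  by apply: sect_eq => y; rewrite koszul1_sectE -dD_koszul.
rewrite !E /koszul1_sect !at_act_lin /koszul1.
have B (D D' : derivation L) l : at_act (der_bracket D D' x) l =
    at_act (D x) (der_act D' l) - at_act (D' x) (der_act D l) by [].
rewrite !B.
have J : sigma_pull theta x (der_bracket (der_bracket D1 D2) D3 x) =
    sigma_pull theta x (der_bracket (der_bracket D1 D3) D2 x) -
    sigma_pull theta x (der_bracket (der_bracket D2 D3) D1 x).
  rewrite -linearB; congr (sigma_pull theta x _); apply: atiyah_eq => l.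
  have DB (D D' : derivation L) : der_act (der_bracket D D') l =
     sect_lin (-1) (der_act D' (der_act D l)) (der_act D (der_act D' l)).
    by apply: sect_eq => y; exact: der_bracket_act.
  rewrite -[RHS]/(at_act (der_bracket (der_bracket D1 D3) D2 x) l -
    at_act (der_bracket (der_bracket D2 D3) D1 x) l).
  by rewrite !B !DB !at_act_lin; line_ring.
by rewrite J; line_ring.
Qed.

Lemma dD_injective (na : connection L) theta theta' :
  dD (sigma_pull theta) = dD (sigma_pull theta') -> theta = theta'.
Proof.
move=> H; apply: form1_eq => x v.
by rewrite -[v](nabla_symb na) -!dD_one H.
Qed.

End Forms.

(** * Pull-backs *)

Section PullBack.
Variables (R : realType) (m n : nat) (M : manifold R m) (N : manifold R n).
Variables (L : line_bundle M) (L' : line_bundle N) (f : smap M N) (F : vbiso L L' f).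
Variable theta : form1 L'.

Lemma vb_fib_inj x : injective (F x).
Proof. exact: can_inj (@vb_fibK _ _ _ _ _ _ _ _ F x). Qed.

Lemma vb_inv0 x : vb_inv F (0 : L' (f x)) = 0.
Proof. by apply: (@vb_fib_inj x); rewrite vb_invK linear0. Qed.

Lemma vb_inv_sum x (J : finType) (a : J -> R) (v : J -> L' (f x)) :
  vb_inv F (\sum_j a j *: v j) = \sum_j a j *: vb_inv F (v j).
Proof.
apply: (@vb_fib_inj x); rewrite vb_invK linear_sum.
by apply: eq_bigr => j _; rewrite linearZ vb_invK.
Qed.

Lemma vb_invZ x a (v : L' (f x)) : vb_inv F (a *: v) = a *: vb_inv F v.
Proof. by apply: (@vb_fib_inj x); rewrite linearZ !vb_invK. Qed.

Lemma vb_invD x (v w : L' (f x)) : vb_inv F (v + w) = vb_inv F v + vb_inv F w.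
Proof. by apply: (@vb_fib_inj x); rewrite linearD !vb_invK. Qed.

Lemma vb_invN x (v : L' (f x)) : vb_inv F (- v) = - vb_inv F v.
Proof. by rewrite -scaleN1r vb_invZ scaleN1r. Qed.

Lemma decomposes_pull h (J : finType) (g : J -> Cinf N) mu :
  decomposes (fun y v => theta y v) h g mu ->
  decomposes (pull1 F theta) (cinf_comp f h) (fun j => cinf_comp f (g j))
    (fun j => vb_pull F (mu j)).
Proof. by move=> H y v; rewrite /pull1 -vb_invZ /= H vb_inv_sum. Qed.

(** [at_map] and [dmap] act by pulling back sections and functions, so [ddec] on image vectors is
    [ddec] with pulled-back data. *)
Lemma apull2_ddec h (J : finType) (g : J -> Cinf N) mu x (d e : atiyah L x) :
  decomposes (fun y v => theta y v) h g mu -> h (f x) = 1 ->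
  apull2 F (dD (sigma_pull theta)) d e =
  ddec (cinf_comp f h) (fun j => cinf_comp f (g j)) (fun j => vb_pull F (mu j))
    (@pull1 _ _ _ _ _ _ _ _ F theta x) d e.
Proof.
move=> H hx; rewrite /apull2 (dD_ddec _ _ H hx) /ddec vb_invD vb_invN vb_invD vb_invN !vb_invZ.
rewrite (big_morph _ (@vb_invD x) (vb_inv0 x)).
congr (_ - _); apply: eq_bigr => j _.
by rewrite vb_invD vb_invN !vb_invZ /at_act /= !vb_fibK.
Qed.

Lemma at_map_one x : at_map F (at_one L x) = at_one L' (f x).
Proof. by apply: atiyah_eq => l; rewrite /at_act /= vb_invK. Qed.

Lemma pull1_apull2 (na : connection L) x (v : tangent x) :
  pull1 F theta v = apull2 F (dD (sigma_pull theta)) (at_one L x) (na x v).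
Proof. by rewrite /apull2 at_map_one dD_one -[in LHS](nabla_symb na v). Qed.

End PullBack.

(** Forwards, the two pull-backs of [theta] are the same map, and [ddec_indep] applies. Backwards,
    [at_map] preserves the identity derivation, and contraction with it returns the pull-backs of
    [theta]. *)
Lemma partial_closed_dD (R : realType) (n m : nat) (L : lbg R n m) (theta : form1 (lobj L)) :
  partial_closed1 theta <-> partial_closed2 (dD (sigma_pull theta)).
Proof.
split => H g; last first.
  have [na] := connection_exists (larr L).
  by move=> v; rewrite !(pull1_apull2 _ _ na); exact: H.
move=> d e; apply/eqP; rewrite subr_eq0; apply/eqP.
have [h [J [f [mu [hx D]]]]] := form1_decomposes theta (src (grpd L) g).
have [h' [J' [f' [mu' [h'x D']]]]] := form1_decomposes theta (tgt (grpd L) g).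
rewrite (apull2_ddec _ _ _ D hx) (apull2_ddec _ _ _ D' h'x).
apply: (ddec_indep _ _ _ (decomposes_pull (src_vb L) D) (decomposes_pull (tgt_vb L) D')) => //.
by move=> y v; apply/eqP; rewrite -subr_eq0; apply/eqP; exact: H.
Qed.

(** * The infinitesimal action *)

Section InfinitesimalAction.
Variables (R : realType) (n m : nat) (L : lbg R n m).
Local Notation G := (arr L).
Local Notation M := (obj L).
Local Notation LM := (lobj L).
Local Notation LG := (larr L).
Local Notation s := (src (grpd L)).
Local Notation t := (tgt (grpd L)).
Local Notation u := (gunit (grpd L)).
Local Notation i := (ginv (grpd L)).

Lemma lpt_src g (w : LG g) : lpt (src_vb L g w) = src (lgrpd L) (lpt w).
Proof. by rewrite -src_vbE vb_totE. Qed.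

Lemma lpt_tgt g (w : LG g) : lpt (tgt_vb L g w) = tgt (lgrpd L) (lpt w).
Proof. by rewrite -tgt_vbE vb_totE. Qed.

Lemma lpt_inv g (w : LG g) : lpt (inv_vb L g w) = ginv (lgrpd L) (lpt w).
Proof. by rewrite -inv_vbE vb_totE. Qed.

Lemma lpt_unit x (v : LM x) : lpt (unit_vb L x v) = gunit (lgrpd L) (lpt v).
Proof. by rewrite -unit_vbE vb_totE. Qed.

Lemma unit_src_tgt x (w : LG (u x)) : lpt (src_vb L (u x) w) = lpt (tgt_vb L (u x) w).
Proof.
by rewrite -[w](vb_invK (unit_vb L)) lpt_src lpt_tgt lpt_unit src_unit tgt_unit.
Qed.

Lemma acts_uniq g e e1 e2 : @acts _ _ _ L g e e1 -> acts g e e2 -> e1 = e2.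
Proof. by move=> [v [-> ->]] [w [/lpt_inj -> ->]]. Qed.

(* The action of [g^-1] in terms of [L]: since [t^* l] and [s^* l0] are proportional
   over [g], the same factor relates [g^-1 . l (t g)] and [l0 (s g)]. *)
Lemma acts_ratio (l l0 : sect LM) g r :
  vb_pull (tgt_vb L) l g = r *: vb_pull (src_vb L) l0 g ->
  acts (i g) (lpt (l (t g))) (lpt (r *: l0 (s g))).
Proof.
move=> E; set w := vb_pull (tgt_vb L) l g in E; pose w' := inv_vb L g w.
exists (src_vb L (i g) w'); split.
  by rewrite lpt_src /w' lpt_inv src_inv -lpt_tgt /w /= vb_invK.
by rewrite vb_fibK lpt_tgt /w' lpt_inv tgt_inv -lpt_src E linearZ /= vb_invK.
Qed.

Section AtPoint.
Variables (x : M) (l0 : sect LM) (l0x : l0 x != 0).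
Variables (tau : trivialization LG) (ltau : ltriv tau) (tx : tdom tau (u x)).
Variables (k : Cinf G) (sk : supported (tdom tau) k) (kx : k (u x) = 1).

(** With [src_coef], the coefficients of [t^* l] and [s^* l0] in a frame near the unit. Their
    quotient is the factor of [acts_ratio]; on the fibre of [s] over [x] this factor multiplies the
    fixed vector [l0 x]. *)
Definition tgt_coef (l : sect LM) : Cinf G := coef ltau sk (vb_pull (tgt_vb L) l).
Definition src_coef : Cinf G := coef ltau sk (vb_pull (src_vb L) l0).

Lemma l0_src g : s g = x -> l0 (s g) != 0.
Proof. by move=> ->. Qed.

Lemma src_coef_neq0 : src_coef (u x) != 0.
Proof.
rewrite /= kx mulr1; apply: contraNneq (l0_src (src_unit (grpd L) x)) => h.
rewrite -[l0 _](vb_invK (src_vb L)) -(tframe_span tx (vb_inv _ _)) h scale0r.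
by rewrite linear0.
Qed.

Lemma ratio_ex (l : sect LM) g : s g = x -> exists r : R,
  vb_pull (tgt_vb L) l g = r *: vb_pull (src_vb L) l0 g.
Proof.
move=> sg; apply: line_ratio; apply: contraNneq (l0_src sg) => /= h.
by rewrite -[l0 _](vb_invK (src_vb L)) h linear0.
Qed.

Lemma ratio_tgt_coef (l : sect LM) g r :
  vb_pull (tgt_vb L) l g = r *: vb_pull (src_vb L) l0 g -> tgt_coef l g = r * src_coef g.
Proof. by rewrite /tgt_coef /src_coef /= => ->; rewrite linearZ mulrA. Qed.

Lemma tgt_coef_unit (l : sect LM) : l x = (tgt_coef l (u x) / src_coef (u x)) *: l0 x.
Proof.
have [r Hr] := ratio_ex l (src_unit (grpd L) x).
rewrite (ratio_tgt_coef Hr) mulfK ?src_coef_neq0 //; apply: lpt_inj.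
have -> : lpt (l x) = lpt (l (t (u x))) by rewrite tgt_unit.
have -> : lpt (r *: l0 x) = lpt (r *: l0 (s (u x))) by rewrite src_unit.
have -> : r *: l0 (s (u x)) = src_vb L (u x) (vb_pull (tgt_vb L) l (u x)).
  by rewrite Hr linearZ /= vb_invK.
by rewrite unit_src_tgt /= vb_invK.
Qed.

Variable a : algebroid x.

(* The derivative along [a] of the quotient tgt_coef l / src_coef. *)
Definition act_coef (l : sect LM) : R :=
  (src_coef (u x))^-1 * alg_val a (tgt_coef l)
  - (src_coef (u x))^-1 ^+ 2 * tgt_coef l (u x) * alg_val a src_coef.

(** The symbol is the anchor because the pull-back of [f l] along t is f o t times that of [l]. *)
Lemma act_coef_atiyah : (fun l => act_coef l *: l0 x, anchor a) \in @atiyah_pred _ _ _ LM x.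
Proof.
apply/asboolP; split => [b l l'|f l] /=; rewrite /act_coef.
  have N g : tgt_coef (sect_lin b l l') g = b * tgt_coef l g + tgt_coef l' g.
    by rewrite -(coef_lin ltau sk) /tgt_coef vb_pull_lin.
  rewrite (@tangent_eqf _ _ _ _ (alg_val a) _ (cinf_lin b (tgt_coef l) (tgt_coef l')))
    ?tangent_lin ?N; last exact: N.
  by rewrite scalerA -scalerDl; congr (_ *: _); ring.
have N g : tgt_coef (sect_mul f l) g = f (t g) * tgt_coef l g.
  by rewrite /tgt_coef vb_pull_mul coef_mul.
rewrite (@tangent_eqf _ _ _ _ (alg_val a) _ (cinf_mul (cinf_comp t f) (tgt_coef l)))
  ?tangent_mul ?N; last exact: N.
have E : cinf_comp t f (u x) = f x by rewrite /= tgt_unit.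
rewrite -[f (t (u x))]/(cinf_comp t f (u x)) E (tgt_coef_unit l) !scalerA -scalerDl.
congr (_ *: _); have := src_coef_neq0.
move: (src_coef _) (tgt_coef _ _) (alg_val a _) (alg_val a _) (alg_val a _) => D nu a1 a2 a3 _.
rewrite !mulrBr; ring.
Qed.

(** The curve stays over [x] under s, so the translated vectors are multiples [q e] of [l0 x]. Near
    0, where [src_coef] does not vanish, [q] is the quotient of the two coefficients, and the
    quotient rule applies. *)
Lemma alg_curve_deriv r gam (l : sect LM) : alg_curve a r gam -> exists c : R -> LM x,
  (forall e, `|e| < r -> acts (i (gam e)) (lpt (l (t (gam e)))) (lpt (c e))) /\
  forall phi : {linear LM x -> R^o},
    is_derive (0 : R) 1 (fun e => phi (c e) : R) (phi (act_coef l *: l0 x)).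
Proof.
move=> [r0 g0 _ sg dg].
have /choice[q Hq] : forall e : R, exists q : R, `|e| < r ->
    vb_pull (tgt_vb L) l (gam e) = q *: vb_pull (src_vb L) l0 (gam e).
  move=> e; have [er|er] := ltP `|e| r; last by exists 0.
  by have [q Hq] := ratio_ex l (sg e er); exists q.
exists (fun e => q e *: l0 x); split.
  move=> e er; have -> : lpt (q e *: l0 x) = lpt (q e *: l0 (s (gam e))) by rewrite sg.
  by apply: acts_ratio; exact: Hq.
move=> phi; pose Nf e : R := tgt_coef l (gam e); pose Df e : R := src_coef (gam e).
have dN : is_derive (0 : R) 1 Nf (alg_val a (tgt_coef l)) by exact: dg.
have dD : is_derive (0 : R) 1 Df (alg_val a src_coef) by exact: dg.
have D0 : Df 0 != 0 by rewrite /Df g0 src_coef_neq0.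
have dV := is_deriveV D0 dD.
have dQ := is_deriveZ (phi (l0 x)) (is_deriveM dN dV).
have cD : {for 0, continuous Df}.
  by apply: differentiable_continuous; apply/derivable1_diffP; case: dD.
rewrite linearZ /=.
have -> : act_coef l *: (phi (l0 x) : R^o) = phi (l0 x) *: (Nf 0 *: (- Df 0 ^- 2 *: alg_val a src_coef) +
    (Df 0)^-1 *: alg_val a (tgt_coef l)).
  by rewrite /act_coef /Nf /Df g0 /GRing.scale /= -exprVn; ring.
apply: near_eq_is_derive dQ.
have n1 : \forall e \near (0 : R), Df e != 0 by exact: (cvgr_neq0 _ cD D0).
have n2 : \forall e \near (0 : R), `|e| < r.
  by apply/nbhs_norm0P; exists r.
apply: filterS2 n1 n2 => e De er.
have E : Nf e = q e * Df e by exact: ratio_tgt_coef (Hq e er).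
rewrite -[LHS]/(phi (l0 x) * (Nf e * (Df e)^-1)) [RHS]linearZ E mulfK //.
by rewrite mulrC.
Qed.

Lemma inf_action_spec_coef d (l : sect LM) : inf_action_spec a d -> at_act d l = act_coef l *: l0 x.
Proof.
move=> [r [gam [gc H]]]; have [c [cact cd]] := H l.
have [c' [cact' cd']] := alg_curve_deriv l gc.
have [r0 _ _ _ _] := gc.
have cc e : `|e| < r -> c e = c' e.
  move=> er; apply: (@lpt_inj _ _ _ LM x); exact: acts_uniq (cact e er) (cact' e er).
have [phi [e [_ He]]] := line_form LM x.
suff P : phi (at_act d l) = phi (act_coef l *: l0 x) by rewrite (He (at_act d l)) P -He.
have [_ <-] := cd phi; have [_ <-] := cd' phi.
apply: near_eq_derive.
have : \forall e \near (0 : R), `|e| < r by apply/nbhs_norm0P; exists r.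
by apply: filterS => z zr; rewrite cc.
Qed.

End AtPoint.

(* In a chart in which [s] is a coordinate projection, a straight line in the direction of
   an element of [ker ds] stays in the [s]-fibre. *)
Lemma alg_curve_ex (x : M) (a : algebroid x) : exists r gam, alg_curve a r gam.
Proof.
have [c [d [pr [ac ad cp _ Hs]]]] := src_subm (grpd L) (u x).
have [w Hw] := tangent_chart ac cp (alg_val a).
set z0 := c (u x) in Hw.
have dsx q : cdom c q -> cdom d (s q) by move=> /Hs [].
have a0 (f : Cinf M) : alg_val a (cinf_comp s f) = 0.
  have /asboolP H := alg_valP a.
  by rewrite -[LHS]/(dmap s (alg_val a) f) H.
(* [a] kills all functions pulled back along [s]; applied to a cut-off coordinate [k z_j] of [M] and
   to [k] itself, this leaves the component of [w] in the direction [pr j]. *)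
have w0 j : w 0 (pr j) = 0.
  have [k sk kx] := cutoff_exists (@cdom_open _ _ _ d) (dsx _ cp).
  pose xi : Cinf M := CInf (supported_mul_smooth (@cdom_open _ _ _ d) sk (smooth_coord j ad)).
  have := a0 xi; rewrite Hw.
  have -> : 'D_w (cinf_comp s xi \o cinv c) z0 =
      'D_w (fun z : 'rV[R]_n => z 0 (pr j) * (cinf_comp s k \o cinv c) z) z0.
    apply: near_eq_derive; have : nbhs z0 (cimg c).
      by apply: open_nbhs_nbhs; split; [exact: cimg_open|exact: cmap_img].
    apply: filterS => z cz /=; have [_ ->] := Hs _ (cinv_dom cz).
    by rewrite cinvK.
  rewrite derive_mul_coord; last by apply: diff_derivable; exact: chart_rep_differentiable.
  by rewrite -Hw a0 mulr0 add0r /= /z0 cmapK // kx mul1r.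
have : nbhs z0 (cimg c).
  by apply: open_nbhs_nbhs; split; [exact: cimg_open|exact: cmap_img].
move=> /nbhs_ballP[r0 /= r00 HB].
(* The added 1 keeps the denominator of [r] positive when w = 0. *)
have w1 : 0 < `|w| + 1 by rewrite ltr_wpDl.
pose r := r0 / (`|w| + 1).
have rpos : 0 < r by rewrite divr_gt0.
have line_img (e : R) : `|e| < r -> cimg c (z0 + e *: w).
  move=> er; apply: HB; rewrite -ball_normE /= opprD addNKr normrN normrZ.
  move: er; rewrite /r ltr_pdivlMr // mulrDr mulr1 => er.
  by apply: le_lt_trans er; rewrite lerDl.
exists r, (fun e => cinv c (z0 + e *: w)); split => //.
- by rewrite scale0r addr0 cmapK.
- have oU : open [set z : 'rV[R]_1 | `|z 0 0| < r].
    apply: (@open_comp _ _ (fun z : 'rV[R]_1 => z 0 0) [set y : R | `|y| < r]).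
      by move=> z _; exact: coord_continuous.
    rewrite (_ : [set y | _] = ball (0 : R) r); first exact: ball_open.
    by rewrite -ball_normE; apply/seteqP; split => y /=; rewrite sub0r normrN.
  have Fc (z : 'rV[R]_1) : {for z, continuous (fun z : 'rV[R]_1 => z0 + z 0 0 *: w)}.
    apply: (@continuous_comp _ _ _ (fun z : 'rV[R]_1 => z 0 0) (fun e : R => z0 + e *: w)).
      exact: coord_continuous.
    exact: line_continuous.
  have cF (z : 'rV[R]_1) : `|z 0 0| < r ->
      {for z, continuous (fun z : 'rV[R]_1 => cinv c (z0 + z 0 0 *: w))}.
    move=> zr; apply: (@continuous_comp _ _ _ (fun z : 'rV[R]_1 => z0 + z 0 0 *: w) (cinv c)).
      exact: Fc.
    by apply: cinv_cont; exact: line_img.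
  split => // d' ad' j.
  apply: (@Csmooth_comp _ _ _ _ (cimg c `&` cinv c @^-1` cdom d')
    (fun z : 'rV[R]_1 => z0 + z 0 0 *: w) (fun z => (d' \o cinv c) z 0 j)).
  + by apply: open_cont_pre => //; exact: cdom_open.
  + by apply: open_chart; exact: cdom_open.
  + by move=> z [zr dz]; split => //; exact: line_img.
  + move=> j' K.
    have -> : (fun z : 'rV[R]_1 => (z0 + z 0 0 *: w) 0 j') =
        (fun z : 'rV[R]_1 => cst (z0 0 j') z + z 0 0 * cst (w 0 j') z).
      by apply/funext => z; rewrite !mxE.
    have oT : open ([set z : 'rV[R]_1 | `|z 0 0| < r] `&`
        (fun z : 'rV[R]_1 => cinv c (z0 + z 0 0 *: w)) @^-1` cdom d').
      by apply: open_cont_pre => //; exact: cdom_open.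
    apply: diff_iterD => //; first exact: diff_iter_cst.
    by apply: diff_iterM => //; [exact: diff_iter_coord|exact: diff_iter_cst].
  + exact: (atlas_compat ac ad').1.
- move=> e er; have cz := line_img e er.
  have cq := cinv_dom cz.
  rewrite -[RHS](src_unit (grpd L) x) -[LHS](cmapK (dsx _ cq)) -[RHS](cmapK (dsx _ cp)).
  congr (cinv d _); apply/rowP => j.
  rewrite (Hs _ cq).2 (Hs _ cp).2 cinvK // !mxE w0 mulr0 addr0.
  by [].
- move=> f; rewrite Hw -[in X in is_derive _ _ _ X](addr0 z0) -(scale0r w).
  apply: (@line_is_derive _ _ (f \o cinv c)).
  rewrite scale0r addr0; apply: diff_derivable; exact: chart_rep_differentiable.
Qed.

(** The explicit candidate [d0] meets the specification, and whatever meets it equals [d0], whose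
    symbol is the anchor by construction. *)
Lemma symb_inf_action (x : M) (a : algebroid x) : symb (inf_action a) = anchor a.
Proof.
have [phi [e [pe He]]] := line_form LM x.
have e0 : e != 0 by apply/eqP => e0; move: pe; rewrite e0 linear0 => /eqP; rewrite eq_sym oner_eq0.
have [l0 l0e] := sect_value e.
have l0x : l0 x != 0 by rewrite l0e.
have [tau ltau tx] := ltriv_cover LG (u x).
have [k sk kx] := cutoff_exists (@tdom_open _ _ _ _ tau) tx.
pose d0 := Atiyah (act_coef_atiyah l0x ltau tx sk kx a).
have spec0 : inf_action_spec a d0.
  have [r [gam gc]] := alg_curve_ex a; exists r, gam; split => // l.
  exact: (alg_curve_deriv l0x ltau tx sk kx l gc).
have := @xgetPex _ 0 (inf_action_spec a) (ex_intro _ d0 spec0).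
rewrite -/(inf_action a) => spec.
have -> : inf_action a = d0.
  by apply: atiyah_eq => l; exact: (inf_action_spec_coef l0x ltau tx sk kx).
by [].
Qed.

End InfinitesimalAction.

(** * Comparison of the two quasi-isomorphism conditions *)

Section QuasiIsomorphisms.
Variables (R : realType) (n m : nat) (L : lbg R n m).
Local Notation M := (obj L).
Local Notation LM := (lobj L).
Variables (na : connection LM) (theta : form1 LM) (x : M).
Local Notation om := (dD (sigma_pull theta)).
Local Notation DA := (@inf_action R n m L x).
Local Notation one := (at_one LM x).

Lemma fnablaD (d e : atiyah LM x) : fnabla na (d + e) = fnabla na d + fnabla na e.
Proof.
rewrite {1}(fnablaP na d) {1}(fnablaP na e) addrACA -linearD -scalerDl.
exact: fnabla_uniq.
Qed.

Lemma fnablaZ a (d : atiyah LM x) : fnabla na (a *: d) = a * fnabla na d.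
Proof.
rewrite {1}(fnablaP na d) scalerDr -linearZ scalerA; exact: fnabla_uniq.
Qed.

Lemma symb_scale_one r : symb (r *: one) = 0.
Proof. by apply: tangent_eq => f; rewrite -[LHS]/(r * 0) mulr0. Qed.

Lemma symb_nablaB v r : symb (na x v - r *: one) = v.
Proof. by rewrite linearB /= symb_scale_one nabla_symb subr0. Qed.

Lemma fnabla0 : fnabla na (0 : atiyah LM x) = 0.
Proof. by have := fnablaZ 0 (0 : atiyah LM x); rewrite scale0r mul0r. Qed.

Lemma fnablaB (d e : atiyah LM x) : fnabla na (d - e) = fnabla na d - fnabla na e.
Proof. by rewrite fnablaD -scaleN1r fnablaZ mulN1r. Qed.

Lemma anchorB (a b : algebroid x) : anchor (a - b) = anchor a - anchor b.
Proof. by apply: tangent_eq. Qed.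

Lemma fnabla_nabla v : fnabla na (na x v) = 0.
Proof. by have := fnabla_uniq na v 0; rewrite scale0r addr0. Qed.

Lemma fnabla_one : fnabla na one = 1.
Proof. by have := fnabla_uniq na (0 : tangent x) 1; rewrite linear0 add0r scale1r. Qed.

Lemma atiyah_split_eq (d e : atiyah LM x) :
  symb d = symb e -> fnabla na d = fnabla na e -> d = e.
Proof. by move=> h1 h2; rewrite (fnablaP na d) (fnablaP na e) h1 h2. Qed.

Lemma om_split (d e : atiyah LM x) : om x d e =
  fnabla na d *: theta x (symb e) - fnabla na e *: theta x (symb d)
  + dnabla na theta x (symb d) (symb e).
Proof. exact: dD_split. Qed.

Lemma om_nabla (d : atiyah LM x) v : om x d (na x v) =
  fnabla na d *: theta x v + dnabla na theta x (symb d) v.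
Proof. by rewrite om_split fnabla_nabla scale0r subr0 nabla_symb. Qed.

Lemma om_one (d : atiyah LM x) : om x d one = - theta x (symb d).
Proof. by rewrite aform2_antisym dD_one. Qed.

Lemma linear_decomp (psi : atiyah LM x -> LM x) : linear psi -> forall e,
  psi e = psi (na x (symb e)) + fnabla na e *: psi one.
Proof. by move=> lp e; rewrite {1}(fnablaP na e) addrC lp addrC. Qed.

Definition symplectic_at := @quasi_iso R (@atiyah_cplx _ _ _ L x) (@jet_cplx _ _ _ L x)
       (fun=> 0) (fun d => om x d) (fun=> 0).

(** An element of [D_x L] is a pair of a vector and a scalar, and a functional on it is determined
    by its restriction to horizontal vectors and its value on the identity. Each exactness property
    thus takes one Morita condition for the first entry and another to correct the second. *)
Lemma symplectic_of_morita : morita_quasi_iso na theta x -> symplectic_at.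
Proof.
move=> [[_ _ C1] _ [[_ lF] _ _ sq0 sq1] [[H01 H02] [H11 H12] [H21 H22]]].
have C1' a : theta x (anchor a) = 0 by exact: C1.
have sq0' a v : dnabla na theta x (anchor a) v = - Fnabla na a *: theta x v.
  by have /(congr1 (fun f => f v)) := sq0 a I.
have sq1' v a : Fnabla na a *: theta x v = dnabla na theta x v (anchor a).
  by have /(congr1 (fun f => f a)) := sq1 v I.
(* The symbol of [DA] is the linear anchor, and its scalar part is linear because [- Fnabla] is a
   component of the cochain map. *)
have linD : linear DA.
  move=> a v w; apply: atiyah_split_eq.
    by rewrite symb_inf_action [RHS]linearD linearZ /= !symb_inf_action; exact: dmap_atDZ.
  have := lF a v w I I; rewrite fnablaD fnablaZ -!/(Fnabla na _) => H.
  apply: oppr_inj; rewrite H; rewrite /GRing.scale /=; ring.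
have DAB a b : DA (a - b) = DA a - DA b.
  by rewrite addrC -scaleN1r linD scaleN1r addrC.
have DA0 : DA 0 = 0 by rewrite -[in LHS](subrr 0) DAB subrr.
have kerD a e : om x (DA a) e = 0.
  rewrite om_split symb_inf_action C1' scaler0 subr0 sq0' scaleNr.
  by rewrite addrN.
have kerD' a e : om x e (DA a) = 0 by rewrite aform2_antisym kerD oppr0.
split.
- split; [split => [v _|a v w _ _]|split => [v _|a v w _ _]|by []] => //=; first exact: linD.
  by rewrite scaler0 addr0.
- split; [split => [v _|a v w _ _]|split => [v lv|a v w _ _]|by move=> v _; apply/funext] => //=.
  + by move=> a d e; rewrite scaler0 addr0.
  + by rewrite scaler0 addr0.
  + by move=> a b c; rewrite /transpose /= linD; exact: lv.
- split; [split => [v _|a v w _ _]|split => [v _|a v w _ _]|split => [v _|a v w _ _]| |] => //=.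
  + by rewrite scaler0 addr0.
  + exact: aform2_linr.
  + by apply/funext => e; exact: aform2_linl.
  + by move=> a b c; rewrite scaler0 addr0.
  + by rewrite scaler0 addr0.
  + by move=> a _; apply/funext => e; exact: kerD.
  + by move=> d _; apply/funext => a; rewrite /transpose /= kerD'.
- split; split.
  + move=> a [_ /= Da] _; apply: (H01 a); last by rewrite /= /Fnabla Da fnabla0 oppr0.
    by split => //=; rewrite -symb_inf_action Da.
  + by move=> w _; exists 0; [split => //=; exact: DA0|apply/rowP => -[]].
  + move=> d _ [z _ /= zd].
    have omd e : om x d e = 0 by rewrite -(congr1 (fun f => f e) zd).
    have thd : theta x (symb d) = 0 by apply: oppr_inj; rewrite -om_one omd oppr0.
    have [||a _ /= ad] := H11 (symb d); first by split.
      exists (- fnabla na d) => //=; apply/funext => v.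
      by have /eqP := omd (na x v); rewrite om_nabla addrC addr_eq0 => /eqP ->; rewrite -scaleNr.
    (* [a] has the right symbol; its defect [r] in the scalar part is killed by [theta^dagger], so
       an element of the kernel of the anchor corrects it. *)
    pose r := fnabla na d - Fnabla na a.
    have [|a' [_ /= a'0] /eqP] := H02 r.
      split => //=; apply/funext => v; rewrite -[LHS]/(r *: theta x v) -[RHS]/(0 : LM x).
      have := omd (na x v); rewrite om_nabla -ad sq0' scaleNr => H.
      by rewrite /r scalerBl H.
    rewrite subr_eq0 => /eqP ra'; exists (a - a') => //=.
    apply: atiyah_split_eq; first by rewrite symb_inf_action anchorB a'0 subr0.
    by rewrite DAB fnablaB -!/(Fnabla na _) -[RHS](subrK (Fnabla na a)) -/r ra' addrC.
  + move=> psi [/= lp psiD].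
    have psi0 a : psi (na x (anchor a)) + Fnabla na a *: psi one = 0.
      rewrite -symb_inf_action -linear_decomp //.
      exact: (congr1 (fun f => f a) psiD).
    (* By [psi0] the class of [psi one] maps to a coboundary, so [psi one] is a value of [theta]. *)
    have [||v0 _ /= v0E] := H21 (psi one) => //.
      exists (fun v => - psi (na x v)).
        by move=> b v w /=; rewrite linearP lp opprD scalerN.
      apply/funext => a; rewrite /transpose /=; apply/eqP.
      by rewrite eq_sym -addr_eq0 addrC psi0.
    have [|v [_ /= v1] [r _ /= rE]] := H12 (fun v => psi (na x v) + dnabla na theta x v0 v).
      split => /=.
        move=> b v w; rewrite linearP lp form2_linr; line_ring.
      apply/funext => a; rewrite /transpose /= -sq1' v0E -/(Fnabla na a).
      exact: psi0.
    (* The sign of [v0] answers the sign in [om_one]; [v] lies in the kernel of [theta] and [r]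
       settles the remaining horizontal part. *)
    exists (na x (-1 *: v0 + v) + r *: one); first by split.
    exists 0 => //=; apply/funext => e; apply/esym/eqP; rewrite subr_eq0; apply/eqP.
    rewrite om_split fnabla_uniq symb_nabla_one linearP v1 form2_linl v0E.
    rewrite (linear_decomp lp e).
    have := congr1 (fun f => f (symb e)) rE => /= H.
    have -> : psi (na x (symb e)) = r *: theta x (symb e) + dnabla na theta x v (symb e)
        - dnabla na theta x v0 (symb e).
      rewrite [r *: _]H; line_ring.
    by line_ring.
  + by move=> v _ _; exists 0 => //; apply/rowP => -[].
  + move=> al la; have [w _ [psi lp /= E]] := H22 al la.
    exists 0 => //; exists (fun e => fnabla na e *: w + psi (symb e)).
      move=> b d e /=; rewrite fnablaD fnablaZ linearP lp; line_ring.
    apply/funext => a; rewrite /transpose /= symb_inf_action.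
    have /= := congr1 (fun f => f a) E; rewrite /transpose /= => ->.
    by rewrite -/(Fnabla na a) -[RHS]/(al a - 0) -[(al - _) a]/(al a - Fnabla na a *: w); line_ring.
Qed.

(** Cocycles are carried to [D_x L] and its dual: a scalar r becomes r times the identity, a vector
    v becomes [na x v - r *: one], a functional on [T_x M] is composed with the symbol, and w in
    [L_x] becomes [fnabla] times w minus such a composite. *)
Lemma morita_of_symplectic : symplectic_at -> morita_quasi_iso na theta x.
Proof.
move=> [[[_ lD] _ _] _ [_ _ _ sq _] [[H01 _] [H11 H12] [_ H22]]].
have linD : linear DA by move=> a v w; exact: lD.
have DAB a b : DA (a - b) = DA a - DA b.
  by rewrite addrC -scaleN1r linD scaleN1r addrC.
have kerD a e : om x (DA a) e = 0 by exact: (congr1 (fun f => f e) (sq a I)).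
have kerD' a e : om x e (DA a) = 0 by rewrite aform2_antisym kerD oppr0.
have FD b (a a' : algebroid x) : Fnabla na (b *: a + a') = b * Fnabla na a + Fnabla na a'.
  by rewrite /Fnabla linD fnablaD fnablaZ.
have C1' a : theta x (anchor a) = 0.
  by apply: oppr_inj; rewrite -symb_inf_action -om_one kerD oppr0.
have sq0' a v : dnabla na theta x (anchor a) v = - Fnabla na a *: theta x v.
  have /eqP := kerD a (na x v); rewrite om_nabla symb_inf_action addrC addr_eq0 => /eqP ->.
  by rewrite scaleNr.
have sq1' v a : Fnabla na a *: theta x v = dnabla na theta x v (anchor a).
  have := kerD' a (na x v).
  rewrite om_split fnabla_nabla scale0r sub0r nabla_symb symb_inf_action -/(Fnabla na a).
  by move/eqP; rewrite addrC subr_eq0 => /eqP.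
have anchor_lin : linear (@anchor _ _ _ L x) by move=> b a a'; exact: dmap_atDZ.
split.
- split; [split => [v _|b v w _ _]|split => [v _|b v w _ _]|move=> a _] => //=.
  + exact: anchor_lin.
  + exact: linearP.
- split; [split => [v _|b v w _ _]|split => [psi lp|b v w _ _]|move=> r _] => //=.
  + by move=> b v' w; rewrite linearP; line_ring.
  + by apply/funext => e; rewrite scalerDl -scalerA.
  + by move=> b v w; rewrite /transpose /= anchor_lin lp.
  + by apply/funext => a; rewrite /transpose /= C1' scaler0.
- split; [split => [v _|b v w _ _]|split => [v _|b v w _ _]|split => [w _|b v w _ _]| |] => //=.
  + by rewrite FD opprD /GRing.scale /= mulrN.
  + exact: form2_linr.
  + by apply/funext => e; exact: form2_linl.
  + by move=> b a a'; rewrite FD; line_ring.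
  + by apply/funext => a; rewrite -[RHS]/(b *: (Fnabla na a *: v) + Fnabla na a *: w); line_ring.
  + by move=> a _; apply/funext => v; exact: sq0'.
  + by move=> v _; apply/funext => a; exact: sq1'.
- split; split.
  + move=> a [_ /= a0] /= /eqP; rewrite oppr_eq0 => /eqP F0.
    apply: (H01 a) => //; split => //=; apply: atiyah_split_eq.
      by rewrite symb_inf_action a0 linear0.
    by rewrite -/(Fnabla na a) F0 fnabla0.
  + move=> r [_ /= r0].
    have [||a _ /= aE] := H11 (r *: one) => //.
      exists 0 => //=; apply/funext => e; rewrite aform2_Zl dD_one.
      exact: (esym (congr1 (fun f => f (symb e)) r0)).
    (* The sign is that of the component [- Fnabla]. *)
    exists (0 - a).
      split => //=; rewrite anchorB -[anchor a]symb_inf_action aE.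
      by rewrite symb_scale_one subr0; exact: tangent_eq.
    rewrite /= /Fnabla DAB fnablaB aE fnablaZ fnabla_one mulr1.
    have -> : DA 0 = 0 by rewrite -[in LHS](subrr 0) DAB subrr.
    by rewrite fnabla0 sub0r opprK subrr.
  + move=> v [_ /= v0] [r _ /= rE].
    have [||a _ /= aE] := H11 (na x v - r *: one) => //.
      exists 0 => //=; apply/funext => e; rewrite om_split.
      rewrite fnablaB fnabla_nabla fnablaZ fnabla_one mulr1 sub0r.
      rewrite symb_nablaB v0 scaler0 subr0 -(congr1 (fun f => f (symb e)) rE) scaleNr.
      by rewrite addNr.
    exists a => //; rewrite -symb_inf_action aE.
    by rewrite symb_nablaB.
  + move=> psi [/= lp psi0].
    have [|d _ [z _ /= /esym /eqP]] := H12 (psi \o @symb _ _ _ _ x).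
      split => /=; first by move=> b d e /=; rewrite linearP lp.
      apply/funext => a; rewrite /transpose /= symb_inf_action.
      exact: (congr1 (fun f => f a) psi0).
    rewrite subr_eq0 => /eqP dE.
    have E e : psi (symb e) = om x d e := congr1 (fun f => f e) dE.
    have p0 : psi 0 = 0 by have := lp (-1) 0 0; rewrite scaler0 addr0 scaleN1r addNr.
    exists (symb d).
      split => //=; apply: oppr_inj; rewrite -om_one -E symb_one p0 oppr0 //.
    exists (fnabla na d) => //=; apply/funext => w.
    have Ew := E (na x w); rewrite nabla_symb om_nabla in Ew.
    by rewrite -[RHS]/(psi w - dnabla na theta x (symb d) w) Ew addrK.
  + move=> w _ [psi lp /= E].
    have [|d _ [z _ /= /esym /eqP]] := H12 (fun e => fnabla na e *: w - psi (symb e)).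
      split => /=.
        by move=> b d e; rewrite fnablaD fnablaZ linearP lp; line_ring.
      apply/funext => a; rewrite /transpose /= symb_inf_action -/(Fnabla na a).
      by rewrite -(congr1 (fun f => f a) E) subrr.
    rewrite subr_eq0 => /eqP dE.
    have p0 : psi 0 = 0 by have := lp (-1) 0 0; rewrite scaler0 addr0 scaleN1r addNr.
    have := congr1 (fun f => f one) dE; rewrite /= fnabla_one symb_one p0 subr0 scale1r om_one.
    by move=> ->; exists (- symb d) => //=; exact: linearN.
  + move=> al la; have [w _ [psi lp /= E]] := H22 al la.
    exists (psi one) => //; exists (fun v => psi (na x v)).
      by move=> b v v'; rewrite linearP lp.
    apply/funext => a; have /= := congr1 (fun f => f a) E; rewrite /transpose /= => Ea.
    rewrite -[RHS]/(al a - Fnabla na a *: psi one) -[al a]subr0 -[al a - 0]Ea.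
    by rewrite [psi (DA a)](linear_decomp lp) symb_inf_action -/(Fnabla na a) addrK.
Qed.

End QuasiIsomorphisms.

Theorem theorem4p21 (R : realType) (n m : nat) (L : lbg R n m) :
  set_bij (@contact0 R n m L) (@symplectic0 R n m L)
    (fun theta => dD (sigma_pull theta)).
Proof.
(* One connection serves injectivity, the contraction that yields [theta], and the existential in
   [contact0]. *)
have [na0] := connection_exists (lobj L); split.
- move=> theta [pc [na H]]; split.
  + exact/partial_closed_dD.
  + exact: dD_closed_dD.
  + by move=> x; exact: symplectic_of_morita (H x).
- by move=> theta theta' _ _; exact: dD_injective.
- move=> omega [pc cl H]; have [theta E] := dD_closed_exact na0 cl.
  rewrite -E in pc H; exists theta => //; split; first exact/partial_closed_dD.
  by exists na0 => x; apply: morita_of_symplectic; exact: H.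
Qed.
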